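(* Let $k$ be a field, $r\ge1$ an integer, $B=k\langle x,y\rangle/(y^{r+1})$ with $\deg x=\deg y=1$, and let $Q$ be the quiver with vertices $1,\ldots,r+1$, arrows $x_i:i\to1$ for $1\le i\le r+1$ (so $x_1$ is a loop at $1$), and arrows $y_i:i\to i+1$ for $1\le i\le r$. There is an isomorphism $$K_0(\mathsf{qgr}(B))\cong K_0(\mathsf{qgr}(kQ))\cong\frac{\mathbb{Z}[t^{\pm1}]}{(1-t-\cdots-t^{r+1})}$$ of $\mathbb{Z}[t^{\pm1}]$-modules under which $[\mathcal{O}]\mapsto1$ and $[\mathcal{F}(-1)]=t[\mathcal{F}]$ for all $\mathcal{F}\in\mathsf{qgr}(B)$.
   Context: The path algebra $kQ$ is graded by path length. For $D=B$ or $D=kQ$: $\mathsf{gr}\,D$ is the abelian category of finitely presented $\mathbb{Z}$-graded left $D$-modules (degree-preserving maps), $\mathsf{fdim}\,D$ its Serre subcategory of finite dimensional modules, and $\mathsf{qgr}\,D:=\mathsf{gr}\,D/\mathsf{fdim}\,D$. $\mathcal{O}$ is the image of the left module $D$ in $\mathsf{qgr}\,D$. For a graded module $M$ and $n\in\mathbb{Z}$, $M(n)$ is $M$ with grading $M(n)_i=M_{n+i}$; this induces the Serre twist $\mathcal{F}\mapsto\mathcal{F}(n)$ on $\mathsf{qgr}\,D$. $K_0(\mathsf{A})$ is the Grothendieck group of an abelian category $\mathsf{A}$; $K_0(\mathsf{qgr}\,D)$ is a $\mathbb{Z}[t^{\pm1}]$-module with $t$ acting as the twist $(-1)$, i.e.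 $t\cdot[\mathcal{F}]=[\mathcal{F}(-1)]$. *)

(* Defs.v *)
From HB Require Import structures.
From mathcomp Require Import all_boot all_order all_algebra finmap.
From mathcomp.classical Require Import boolp.
From mathcomp.multinomials Require Import monalg.

Set Implicit Arguments.
Unset Strict Implicit.
Unset Printing Implicit Defensive.

Import GRing.Theory.

Local Open Scope ring_scope.

Section ClassQuotient.
Variables (T : Type) (E : T -> T -> Prop).

(* quotient of T by E, as the type of its classes *)
Definition cquot : Type := {c : T -> Prop | exists x, c = E x}.

Definition cpi (x : T) : cquot := exist _ (E x) (ex_intro _ x erefl).

Definition crepr (c : cquot) : T := sval (cid (svalP c)).

Lemma creprK c : cpi (crepr c) = c.
Proof.
case: c => c cP; rewrite /cpi /crepr; case: cid => x /= xE.
exact: eq_exist (esym xE).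
Qed.

Hypotheses (Erefl : forall x, E x x) (Esym : forall x y, E x y -> E y x)
  (Etrans : forall x y z, E x y -> E y z -> E x z).

Lemma cpi_eq x y : E x y -> cpi x = cpi y.
Proof.
move=> xy; apply: eq_exist; apply/funext => z; apply/propext.
by split=> [xz|yz]; [exact: Etrans (Esym xy) xz|exact: Etrans xy yz].
Qed.

Lemma cpi_inj x y : cpi x = cpi y -> E x y.
Proof. by move=> /(congr1 sval) /= ->. Qed.

Lemma crepr_pi x : E (crepr (cpi x)) x.
Proof. by apply: cpi_inj; rewrite creprK. Qed.
End ClassQuotient.

Record category := Category {
  Ob :> Type;
  Hom : Ob -> Ob -> Type;
  idm : forall X, Hom X X;
  hcomp : forall X Y Z, Hom X Y -> Hom Y Z -> Hom X Z;
  hcomp1f : forall X Y (f : Hom X Y), hcomp (idm X) f = f;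
  hcompf1 : forall X Y (f : Hom X Y), hcomp f (idm Y) = f;
  hcompA : forall X Y Z T (f : Hom X Y) (g : Hom Y Z) (h : Hom Z T),
    hcomp f (hcomp g h) = hcomp (hcomp f g) h
}.

Arguments Hom {c} X Y.
Arguments idm {c} X.
Arguments hcomp {c X Y Z} f g.

(* Composition is written in diagrammatic order. *)
Reserved Notation "f ;; g" (at level 50, left associativity).
Notation "f ;; g" := (hcomp f g).

Section AbelianNotions.
Variable C : category.

Definition zero_object (Z : C) : Prop :=
  (forall X : C, exists f : Hom X Z, forall g, g = f) /\
  (forall X : C, exists f : Hom Z X, forall g, g = f).

Definition zero_morphism (X Y : C) (f : Hom X Y) : Prop :=
  exists (Z : C) (a : Hom X Z) (b : Hom Z Y), zero_object Z /\ f = a ;; b.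

Definition is_kernel (K X Y : C) (i : Hom K X) (f : Hom X Y) : Prop :=
  zero_morphism (i ;; f) /\
  forall (T : C) (h : Hom T X), zero_morphism (h ;; f) ->
    exists! u : Hom T K, u ;; i = h.

Definition is_cokernel (X Y Q : C) (f : Hom X Y) (p : Hom Y Q) : Prop :=
  zero_morphism (f ;; p) /\
  forall (T : C) (h : Hom Y T), zero_morphism (f ;; h) ->
    exists! u : Hom Q T, p ;; u = h.

Definition short_exact (X' X X'' : C) (f : Hom X' X) (g : Hom X X'') : Prop :=
  is_kernel f g /\ is_cokernel f g.

Definition Serre_iso (S : C -> Prop) (X Y : C) (f : Hom X Y) : Prop :=
  (exists (K : C) (i : Hom K X), is_kernel i f /\ S K) /\
  (exists (Q : C) (p : Hom Y Q), is_cokernel f p /\ S Q).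

Lemma zero_morphism_compl (X Y Z : C) (f : Hom X Y) (g : Hom Y Z) :
  zero_morphism g -> zero_morphism (f ;; g).
Proof. by case=> N [a [b [N0 ->]]]; exists N, (f ;; a), b; rewrite hcompA. Qed.

Lemma zero_morphism_compr (X Y Z : C) (f : Hom X Y) (g : Hom Y Z) :
  zero_morphism f -> zero_morphism (f ;; g).
Proof. by case=> N [a [b [N0 ->]]]; exists N, a, (b ;; g); rewrite hcompA. Qed.
End AbelianNotions.

Section Localization.
Variables (C : category) (W : forall X Y : C, Hom X Y -> Prop).

(* Morphisms of the localization are formal composites of morphisms of C and
   formal inverses of morphisms in W, modulo the congruence zz_eq generated by
   the composition of C and by s ;; s^-1 = 1, s^-1 ;; s = 1. *)
Inductive zigzag : C -> C -> Type :=
| zz_of X Y of Hom X Y : zigzag X Y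
| zz_inv X Y (s : Hom X Y) of W s : zigzag Y X
| zz_comp X Y Z of zigzag X Y & zigzag Y Z : zigzag X Z.

Inductive zz_eq : forall X Y : C, zigzag X Y -> zigzag X Y -> Prop :=
| zz_refl X Y (f : zigzag X Y) : zz_eq f f
| zz_sym X Y (f g : zigzag X Y) : zz_eq f g -> zz_eq g f
| zz_trans X Y (f g h : zigzag X Y) :
    zz_eq f g -> zz_eq g h -> zz_eq f h
| zz_cong X Y Z (f f' : zigzag X Y) (g g' : zigzag Y Z) :
    zz_eq f f' -> zz_eq g g' -> zz_eq (zz_comp f g) (zz_comp f' g')
| zz_assoc X Y Z T (f : zigzag X Y) (g : zigzag Y Z) (h : zigzag Z T) :
    zz_eq (zz_comp f (zz_comp g h)) (zz_comp (zz_comp f g) h)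
| zz_idl X Y (f : zigzag X Y) : zz_eq (zz_comp (zz_of (idm X)) f) f
| zz_idr X Y (f : zigzag X Y) : zz_eq (zz_comp f (zz_of (idm Y))) f
| zz_funct X Y Z (f : Hom X Y) (g : Hom Y Z) :
    zz_eq (zz_of (f ;; g)) (zz_comp (zz_of f) (zz_of g))
| zz_invr X Y (s : Hom X Y) (Ws : W s) :
    zz_eq (zz_comp (zz_of s) (zz_inv Ws)) (zz_of (idm X))
| zz_invl X Y (s : Hom X Y) (Ws : W s) :
    zz_eq (zz_comp (zz_inv Ws) (zz_of s)) (zz_of (idm Y)).

Definition loc_hom (X Y : C) : Type := cquot (@zz_eq X Y).

Definition loc_pi (X Y : C) (f : zigzag X Y) : loc_hom X Y := cpi _ f.

Definition loc_comp (X Y Z : C) (f : loc_hom X Y) (g : loc_hom Y Z) :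
  loc_hom X Z := loc_pi (zz_comp (crepr f) (crepr g)).

Lemma loc_piP X Y (f g : zigzag X Y) : loc_pi f = loc_pi g <-> zz_eq f g.
Proof.
split; first by apply: cpi_inj; exact: zz_refl.
by apply: cpi_eq; [exact: zz_sym|exact: zz_trans].
Qed.

Lemma loc_pi_comp X Y Z (f : zigzag X Y) (g : zigzag Y Z) :
  loc_comp (loc_pi f) (loc_pi g) = loc_pi (zz_comp f g).
Proof. by apply/loc_piP/zz_cong; apply: crepr_pi; exact: zz_refl. Qed.

Lemma loc_ind X Y (P : loc_hom X Y -> Prop) :
  (forall f, P (loc_pi f)) -> forall f, P f.
Proof. by move=> Pf f; rewrite -(creprK f); exact: Pf. Qed.

Fact loc_comp1f X Y (f : loc_hom X Y) :
  loc_comp (loc_pi (zz_of (idm X))) f = f.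
Proof.
by elim/loc_ind: f => f; rewrite loc_pi_comp; apply/loc_piP/zz_idl.
Qed.

Fact loc_compf1 X Y (f : loc_hom X Y) :
  loc_comp f (loc_pi (zz_of (idm Y))) = f.
Proof.
by elim/loc_ind: f => f; rewrite loc_pi_comp; apply/loc_piP/zz_idr.
Qed.

Fact loc_compA X Y Z T (f : loc_hom X Y) (g : loc_hom Y Z) (h : loc_hom Z T) :
  loc_comp f (loc_comp g h) = loc_comp (loc_comp f g) h.
Proof.
elim/loc_ind: f => f; elim/loc_ind: g => g; elim/loc_ind: h => h.
by rewrite !loc_pi_comp; apply/loc_piP/zz_assoc.
Qed.

Definition localization : category :=
  @Category C loc_hom (fun X => loc_pi (zz_of (idm X))) loc_comp
    loc_comp1f loc_compf1 loc_compA.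
End Localization.

(* The quotient of an abelian category C by a Serre subcategory S, realized as
   the localization of C at the morphisms whose kernel and cokernel lie in S. *)
Definition Serre_quotient (C : category) (S : C -> Prop) : category :=
  localization (@Serre_iso C S).

Record functor (C D : category) := Functor {
  fob :> C -> D;
  fhom : forall X Y : C, Hom X Y -> Hom (fob X) (fob Y);
  fhom1 : forall X : C, fhom (idm X) = idm (fob X);
  fhomM : forall (X Y Z : C) (f : Hom X Y) (g : Hom Y Z),
    fhom (f ;; g) = fhom f ;; fhom g
}.

Section InverseEquivalences.
Variable C : category.

(* a natural isomorphism from G \o F to the identity *)
Definition retraction_data (F G : functor C C) : Prop :=
  exists (a : forall X : C, Hom (G (F X)) X) (b : forall X : C, Hom X (G (F X))),
  [/\ forall X, a X ;; b X = idm _, forall X, b X ;; a X = idm _ &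
      forall X Y (f : Hom X Y), fhom G (fhom F f) ;; a Y = a X ;; f].

Lemma retraction_faithful F G : retraction_data F G ->
  forall X Y (f g : Hom X Y), fhom F f = fhom F g -> f = g.
Proof.
case=> a [b [ab ba nat]] X Y f g /(congr1 (fun h => b X ;; (fhom G h ;; a Y))).
by rewrite !nat !hcompA !ba !hcomp1f.
Qed.

Lemma retraction_full F G : retraction_data F G -> retraction_data G F ->
  forall X Y (h : Hom (F X) (F Y)), exists f : Hom X Y, fhom F f = h.
Proof.
case=> a [b [ab ba nat]] GF X Y h; exists (b X ;; fhom G h ;; a Y).
apply: (retraction_faithful GF); set f := (_ ;; _ ;; _).
have := nat _ _ f; rewrite /f !hcompA ab hcomp1f.
move=> /(congr1 (fun h => h ;; b Y)); by rewrite -!hcompA !ab !hcompf1.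
Qed.

Variables (F G : functor C C).
Hypotheses (FG : retraction_data F G) (GF : retraction_data G F).

Lemma equiv_zero_object Z : zero_object Z -> zero_object (F Z).
Proof.
have full := retraction_full FG GF.
case: GF => a [b [ab ba _]] [Zt Zi]; split=> X.
  have [f fP] := Zt (G X); exists (b X ;; fhom F f) => g.
  have [h hE] := full _ _ (a X ;; g).
  by rewrite -(fP h) hE hcompA ba hcomp1f.
have [f fP] := Zi (G X); exists (fhom F f ;; a X) => g.
have [h hE] := full _ _ (g ;; b X).
by rewrite -(fP h) hE -hcompA ba hcompf1.
Qed.

Lemma equiv_zero_morphism X Y (f : Hom X Y) :
  zero_morphism f -> zero_morphism (fhom F f).
Proof.
case=> Z [a [b [Z0 ->]]]; exists (F Z), (fhom F a), (fhom F b).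
by rewrite fhomM; split=> //; exact: equiv_zero_object.
Qed.
End InverseEquivalences.

Lemma equiv_zero_morphism_inv C (F G : functor C C)
    (FG : retraction_data F G) (GF : retraction_data G F) (X Y : C) (f : Hom X Y) :
  zero_morphism (fhom F f) -> zero_morphism f.
Proof.
move=> /(equiv_zero_morphism GF FG); case: FG => a [b [ab ba nat]] f0.
have := zero_morphism_compl (b X) (zero_morphism_compr (a Y) f0).
by rewrite nat hcompA ba hcomp1f.
Qed.

Lemma equiv_kernel C (F G : functor C C)
    (FG : retraction_data F G) (GF : retraction_data G F)
    (K X Y : C) (i : Hom K X) (f : Hom X Y) :
  is_kernel i f -> is_kernel (fhom F i) (fhom F f).
Proof.
have full := retraction_full FG GF.
have faithful := retraction_faithful FG.
case=> if0 iP; split.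
  by rewrite -fhomM; exact: (equiv_zero_morphism FG GF).
move=> T h; have zinv := @equiv_zero_morphism_inv C F G FG GF.
case: GF => a [b [ab ba nat]] hf0.
have [h' h'E] := full _ _ (a T ;; h).
have : zero_morphism (h' ;; f).
  by apply: zinv; rewrite fhomM h'E -hcompA; exact: zero_morphism_compl.
move=> /iP [u [uE u_uniq]]; exists (b T ;; fhom F u); split.
  by rewrite -hcompA -fhomM uE h'E hcompA ba hcomp1f.
move=> v vE; have [v' v'E] := full _ _ (a T ;; v).
have -> : u = v'.
  by apply: u_uniq; apply: faithful; rewrite fhomM v'E -hcompA vE h'E.
by rewrite v'E hcompA ba hcomp1f.
Qed.

Lemma equiv_cokernel C (F G : functor C C)
    (FG : retraction_data F G) (GF : retraction_data G F)
    (X Y Q : C) (f : Hom X Y) (p : Hom Y Q) :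
  is_cokernel f p -> is_cokernel (fhom F f) (fhom F p).
Proof.
have full := retraction_full FG GF.
have faithful := retraction_faithful FG.
case=> fp0 pP; split.
  by rewrite -fhomM; exact: (equiv_zero_morphism FG GF).
move=> T h; have zinv := @equiv_zero_morphism_inv C F G FG GF.
case: GF => a [b [ab ba nat]] fh0.
have [h' h'E] := full _ _ (h ;; b T).
have : zero_morphism (f ;; h').
  by apply: zinv; rewrite fhomM h'E hcompA; exact: zero_morphism_compr.
move=> /pP [u [uE u_uniq]]; exists (fhom F u ;; a T); split.
  by rewrite hcompA -fhomM uE h'E -hcompA ba hcompf1.
move=> v vE; have [v' v'E] := full _ _ (v ;; b T).
have -> : u = v'.
  by apply: u_uniq; apply: faithful; rewrite fhomM v'E hcompA vE h'E.
by rewrite v'E -hcompA ba hcompf1.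
Qed.

Lemma equiv_short_exact C (F G : functor C C)
    (FG : retraction_data F G) (GF : retraction_data G F)
    (X' X X'' : C) (f : Hom X' X) (g : Hom X X'') :
  short_exact f g -> short_exact (fhom F f) (fhom F g).
Proof. by case=> fg gf; split; [apply: equiv_kernel|apply: equiv_cokernel]; eauto. Qed.

Section LocalizationFunctor.
Variables (C : category) (W : forall X Y : C, Hom X Y -> Prop).

Definition loc_of (X Y : C) (f : Hom X Y) : @Hom (localization W) X Y :=
  loc_pi (zz_of W f).

Fact loc_of1 (X : C) : loc_of (idm X) = @idm (localization W) X.
Proof. by []. Qed.

Fact loc_ofM (X Y Z : C) (f : Hom X Y) (g : Hom Y Z) :
  loc_of (f ;; g) = loc_of f ;; loc_of g.
Proof. by rewrite /= loc_pi_comp; apply/loc_piP/zz_funct. Qed.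

Definition loc_functor : functor C (localization W) :=
  @Functor C (localization W) (fun X => X) loc_of loc_of1 loc_ofM.
End LocalizationFunctor.

Section LocalizedFunctor.
Variables (C : category) (W : forall X Y : C, Hom X Y -> Prop).
Variables (F : functor C C).
Hypothesis FW : forall X Y (s : Hom X Y), W s -> W (fhom F s).

Fixpoint zz_map X Y (f : zigzag W X Y) : zigzag W (F X) (F Y) :=
  match f with
  | zz_of X Y f => zz_of W (fhom F f)
  | zz_inv X Y s Ws => zz_inv (FW Ws)
  | zz_comp X Y Z f g => zz_comp (zz_map f) (zz_map g)
  end.

Lemma zz_map_eq X Y (f g : zigzag W X Y) :
  zz_eq f g -> zz_eq (zz_map f) (zz_map g).
Proof.
elim=> {X Y f g} /=.
- by move=> *; exact: zz_refl.
- by move=> *; exact: zz_sym.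
- by move=> X Y f g h _ fg _ gh; exact: zz_trans fg gh.
- by move=> *; exact: zz_cong.
- by move=> *; exact: zz_assoc.
- by move=> *; rewrite fhom1; exact: zz_idl.
- by move=> *; rewrite fhom1; exact: zz_idr.
- by move=> *; rewrite fhomM; exact: zz_funct.
- by move=> *; rewrite fhom1; exact: zz_invr.
- by move=> *; rewrite fhom1; exact: zz_invl.
Qed.

Definition loc_map X Y (f : loc_hom W X Y) : loc_hom W (F X) (F Y) :=
  loc_pi (zz_map (crepr f)).

Lemma loc_map_pi X Y (f : zigzag W X Y) : loc_map (loc_pi f) = loc_pi (zz_map f).
Proof.
by apply/loc_piP/zz_map_eq; apply: crepr_pi; exact: zz_refl.
Qed.

Fact loc_map1 X : loc_map (@idm (localization W) X) = @idm (localization W) (F X).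
Proof. by rewrite [LHS]loc_map_pi /= fhom1. Qed.

Fact loc_mapM X Y Z (f : @Hom (localization W) X Y) (g : @Hom (localization W) Y Z) :
  loc_map (f ;; g) =
  @hcomp (localization W) (F X) (F Y) (F Z) (loc_map f) (loc_map g).
Proof.
elim/loc_ind: f => f; elim/loc_ind: g => g /=.
by rewrite loc_pi_comp !loc_map_pi loc_pi_comp.
Qed.

Definition localized : functor (localization W) (localization W) :=
  @Functor (localization W) (localization W) F loc_map loc_map1 loc_mapM.
End LocalizedFunctor.

Lemma localized_retraction (C : category) (W : forall X Y : C, Hom X Y -> Prop)
    (F G : functor C C)
    (FW : forall X Y (s : Hom X Y), W _ _ s -> W _ _ (fhom F s))
    (GW : forall X Y (s : Hom X Y), W _ _ s -> W _ _ (fhom G s)) :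
  retraction_data F G -> retraction_data (localized FW) (localized GW).
Proof.
case=> a [b [ab ba nat]].
pose L := localization W.
pose inc (X Y : C) (f : Hom X Y) : @Hom L X Y := loc_pi (zz_of W f).
have incM (X Y Z : C) (f : Hom X Y) (g : Hom Y Z) : inc _ _ (f ;; g) = inc _ _ f ;; inc _ _ g.
  by rewrite /= loc_pi_comp; apply/loc_piP/zz_funct.
pose T X Y (f : @Hom L X Y) : @Hom L (G (F X)) (G (F Y)) :=
  fhom (localized GW) (fhom (localized FW) f).
have TM X Y Z (f : @Hom L X Y) (g : @Hom L Y Z) : T _ _ (f ;; g) = T _ _ f ;; T _ _ g.
  by rewrite /T !fhomM.
have Tinc (X Y : C) (f : Hom X Y) : T _ _ (inc _ _ f) = inc _ _ (fhom G (fhom F f)).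
  exact: etrans (congr1 (loc_map GW (Y := _)) (loc_map_pi FW _)) (loc_map_pi GW _).
exists (fun X => inc _ _ (a X)), (fun X => inc _ _ (b X)).
split=> [X|X|X Y].
- by apply: etrans (esym (incM _ _ _ _ _)) _; rewrite ab.
- by apply: etrans (esym (incM _ _ _ _ _)) _; rewrite ba.
elim/loc_ind=> z; elim: z => {X Y} [X Y f|X Y s Ws|X Y Z f IHf g IHg].
- rewrite -/(T _ _ _) -/(inc _ _ f) Tinc; apply: etrans (esym (incM _ _ _ _ _)) _.
  by rewrite nat; exact: incM.
- set t : @Hom L Y X := loc_pi _; pose s' : @Hom L X Y := inc _ _ s.
  have st : s' ;; t = idm _ by rewrite /= loc_pi_comp; apply/loc_piP/zz_invr.
  have ts : t ;; s' = idm _ by rewrite /= loc_pi_comp; apply/loc_piP/zz_invl.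
  have sE : T _ _ s' ;; inc _ _ (a Y) = inc _ _ (a X) ;; s'.
    rewrite Tinc; apply: etrans (esym (incM _ _ _ _ _)) _.
    by rewrite nat; exact: incM.
  rewrite -[LHS]hcompf1 -st hcompA -[_ ;; _ ;; s']hcompA -sE.
  by rewrite hcompA -TM ts /T !fhom1 hcomp1f.
- have -> : loc_pi (zz_comp f g) = @hcomp L _ _ _ (loc_pi f) (loc_pi g).
    by rewrite /= loc_pi_comp.
  by rewrite !fhomM -hcompA IHg !hcompA IHf.
Qed.

(* A set of basis elements closed under a partial product; pone is the list of
   idempotents whose sum is the unit of the algebra it spans. *)
HB.mixin Record isPartialMonoid S of Choice S := {
  pmul : S -> S -> option S;
  pone : seq S;
  pmulA : forall x y z,
    obind (pmul x) (pmul y z) = obind (fun u => pmul u z) (pmul x y);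
  pmul1l : forall x, pmap (fun e => pmul e x) pone = [:: x];
  pmul1r : forall x, pmap (pmul x) pone = [:: x];
  pone_uniq : uniq pone;
  pone_neq : pone != [::]
}.

#[short(type="pmonoidType")]
HB.structure Definition PartialMonoid :=
  { S of Choice S & isPartialMonoid S }.

(* The algebra over R with basis S, a product of basis elements being zero
   when it is undefined. *)
Definition pmalg (R : comNzRingType) (S : pmonoidType) : Type := {malg R[S]}.

Section PmAlg.
Variables (R : comNzRingType) (S : pmonoidType).

HB.instance Definition _ := GRing.Lmodule.on (pmalg R S).

Implicit Types f g h : pmalg R S.

Definition pmU (c : R) (o : option S) : pmalg R S :=
  oapp (fun k => << c *g k >>) 0 o.

Definition pm_one : pmalg R S := \sum_(e <- pone) << 1 *g e >>.

Definition pm_mul f g : pmalg R S :=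
  \sum_(k1 <- msupp f) \sum_(k2 <- msupp g) pmU (f@_k1 * g@_k2) (pmul k1 k2).

Lemma pmU0 o : pmU 0 o = 0.
Proof. by case: o => //= k; rewrite monalgU0. Qed.

Lemma pmUD o c d : pmU (c + d) o = pmU c o + pmU d o.
Proof. by case: o => [k|] /=; rewrite ?addr0 // monalgUD. Qed.

Lemma pm_mulw (d1 d2 : {fset S}) f g :
  (msupp f `<=` d1)%fset -> (msupp g `<=` d2)%fset -> pm_mul f g =
  \sum_(k1 <- d1) \sum_(k2 <- d2) pmU (f@_k1 * g@_k2) (pmul k1 k2).
Proof.
move=> le1 le2; rewrite /pm_mul (big_fset_incl _ le1) /=; last first.
  move=> k _ /mcoeff_outdom fk.
  by rewrite big1 // => k' _; rewrite fk mul0r pmU0.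
apply: eq_bigr => k1 _; apply: big_fset_incl => // k _ /mcoeff_outdom ->.
by rewrite mulr0 pmU0.
Qed.

Lemma pm_mulDl : left_distributive pm_mul +%R.
Proof.
move=> f g h; have le0 := fsubset_refl (msupp h).
rewrite (pm_mulw (msuppD_le f g) le0) (pm_mulw (fsubsetUl _ (msupp g)) le0).
rewrite (pm_mulw (fsubsetUr (msupp f) _) le0) -big_split; apply: eq_bigr => i _.
by rewrite -big_split; apply: eq_bigr => j _; rewrite mcoeffD mulrDl pmUD.
Qed.

Lemma pm_mulDr : right_distributive pm_mul +%R.
Proof.
move=> h f g; have le0 := fsubset_refl (msupp h).
rewrite (pm_mulw le0 (msuppD_le f g)) (pm_mulw le0 (fsubsetUl _ (msupp g))).
rewrite (pm_mulw le0 (fsubsetUr (msupp f) _)) -big_split; apply: eq_bigr => i _.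
by rewrite -big_split; apply: eq_bigr => j _; rewrite mcoeffD mulrDr pmUD.
Qed.

Lemma pm_mul0l f : pm_mul 0 f = 0.
Proof. by rewrite /pm_mul msupp0 big_seq_fset0. Qed.

Lemma pm_mul0r f : pm_mul f 0 = 0.
Proof.
by rewrite /pm_mul big1 // => k _; rewrite msupp0 big_seq_fset0.
Qed.

Lemma pm_mul_suml I (r : seq I) (F : I -> pmalg R S) g :
  pm_mul (\sum_(i <- r) F i) g = \sum_(i <- r) pm_mul (F i) g.
Proof.
exact: (big_morph (pm_mul^~ g) (fun f h => pm_mulDl f h g) (pm_mul0l g)).
Qed.

Lemma pm_mul_sumr I (r : seq I) (F : I -> pmalg R S) g :
  pm_mul g (\sum_(i <- r) F i) = \sum_(i <- r) pm_mul g (F i).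
Proof. exact: (big_morph (pm_mul g) (pm_mulDr g) (pm_mul0r g)). Qed.

Lemma pm_mulUU c d k l :
  pm_mul << c *g k >> << d *g l >> = pmU (c * d) (pmul k l).
Proof.
by rewrite (pm_mulw msuppU_le msuppU_le) !big_seq_fset1 !mcoeffUU.
Qed.

Lemma pm_mulUp c d k o :
  pm_mul << c *g k >> (pmU d o) = pmU (c * d) (obind (pmul k) o).
Proof. by case: o => [l|] /=; rewrite ?pm_mul0r // pm_mulUU. Qed.

Lemma pm_mulpU c d k o :
  pm_mul (pmU c o) << d *g k >> = pmU (c * d) (obind (fun u => pmul u k) o).
Proof. by case: o => [l|] /=; rewrite ?pm_mul0l // pm_mulUU. Qed.

Lemma pm_ind (P : pmalg R S -> Prop) :
  P 0 -> (forall f g, P f -> P g -> P (f + g)) ->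
  (forall c k, P << c *g k >>) -> forall f, P f.
Proof.
move=> P0 PD PU f; rewrite [f]monalgE.
by elim/big_ind: _ => [//|x y|k _]; [exact: PD|exact: PU].
Qed.

Fact pm_mulA : associative pm_mul.
Proof.
move=> f g h; elim/pm_ind: f => [|f f' IH IH'|c k].
- by rewrite !pm_mul0l.
- by rewrite !pm_mulDl IH IH'.
elim/pm_ind: g => [|g g' IH IH'|d l].
- by rewrite pm_mul0l !pm_mul0r pm_mul0l.
- by rewrite pm_mulDr !pm_mulDl pm_mulDr IH IH'.
elim/pm_ind: h => [|h h' IH IH'|e m].
- by rewrite !pm_mul0r.
- by rewrite !pm_mulDr IH IH'.
by rewrite !pm_mulUU pm_mulUp pm_mulpU pmulA mulrA.
Qed.

Fact pm_mul1l : left_id pm_one pm_mul.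
Proof.
move=> f; elim/pm_ind: f => [|f f' IH IH'|c k]; first exact: pm_mul0r.
  by rewrite pm_mulDr IH IH'.
rewrite pm_mul_suml; transitivity
  (\sum_(z <- pmap (fun e => pmul e k) pone) (<< c *g z >> : pmalg R S)).
  by rewrite big_pmap; apply: eq_bigr => e _; rewrite pm_mulUU mul1r.
by rewrite pmul1l big_seq1.
Qed.

Fact pm_mul1r : right_id pm_one pm_mul.
Proof.
move=> f; elim/pm_ind: f => [|f f' IH IH'|c k]; first exact: pm_mul0l.
  by rewrite pm_mulDl IH IH'.
rewrite pm_mul_sumr; transitivity
  (\sum_(z <- pmap (pmul k) pone) (<< c *g z >> : pmalg R S)).
  by rewrite big_pmap; apply: eq_bigr => e _; rewrite pm_mulUU mulr1.
by rewrite pmul1r big_seq1.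
Qed.

Fact pm_one_neq0 : pm_one != 0.
Proof.
have := @pone_neq S; have := @pone_uniq S; rewrite /pm_one.
case: (@pone S) => // e s /andP[es _] _; apply/eqP => /malgP /(_ e).
rewrite big_cons mcoeffD mcoeffUU raddf_sum big1_seq ?addr0 ?mcoeff0.
  by apply/eqP/oner_neq0.
move=> i /andP[_ si]; rewrite /= mcoeffU; case: eqP => // ie.
by rewrite -ie si in es.
Qed.

HB.instance Definition _ := GRing.Zmodule_isNzRing.Build (pmalg R S)
  pm_mulA pm_mul1l pm_mul1r pm_mulDl pm_mulDr pm_one_neq0.

Lemma pm_mulE (f g : pmalg R S) : f * g = pm_mul f g.
Proof. by []. Qed.

Lemma pm_scaleU (c d : R) (k : S) :
  c *: (<< d *g k >> : pmalg R S) = << c * d *g k >>.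
Proof. by apply/malgP => l; rewrite mcoeffZ !mcoeffU mulrnAr. Qed.

Lemma pm_scalepU (c d : R) (o : option S) : c *: pmU d o = pmU (c * d) o.
Proof. by case: o => [k|] /=; rewrite ?scaler0 // pm_scaleU. Qed.

Fact pm_scaleAl (c : R) f g : c *: (f * g) = (c *: f) * g.
Proof.
elim/pm_ind: f => [|f f' IH IH'|d k]; first by rewrite scaler0 !mul0r scaler0.
  by rewrite mulrDl !scalerDr IH IH' mulrDl.
elim/pm_ind: g => [|g g' IH IH'|e l]; first by rewrite !mulr0 scaler0.
  by rewrite !mulrDr !scalerDr IH IH'.
by rewrite pm_scaleU !pm_mulE !pm_mulUU pm_scalepU mulrA.
Qed.

HB.instance Definition _ :=
  GRing.Lmodule_isLalgebra.Build R (pmalg R S) pm_scaleAl.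

Fact pm_scaleAr (c : R) f g : c *: (f * g) = f * (c *: g).
Proof.
elim/pm_ind: f => [|f f' IH IH'|d k]; first by rewrite !mul0r scaler0.
  by rewrite !mulrDl !scalerDr IH IH'.
elim/pm_ind: g => [|g g' IH IH'|e l]; first by rewrite scaler0 !mulr0 scaler0.
  by rewrite mulrDr !scalerDr IH IH' mulrDr.
by rewrite pm_scaleU !pm_mulE !pm_mulUU pm_scalepU mulrCA.
Qed.

HB.instance Definition _ :=
  GRing.Lalgebra_isAlgebra.Build R (pmalg R S) pm_scaleAr.
End PmAlg.

Definition zexp : Type := int.

HB.instance Definition _ := Choice.on zexp.

Definition zexp_mul (m n : zexp) : option zexp := Some ((m : int) + n).

Fact zexp_mulA (x y z : zexp) : obind (zexp_mul x) (zexp_mul y z) =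
  obind (fun u => zexp_mul u z) (zexp_mul x y).
Proof. by rewrite /= /zexp_mul addrA. Qed.

Fact zexp_mul1l x : pmap (fun e => zexp_mul e x) [:: 0 : int] = [:: x].
Proof. by rewrite /= add0r. Qed.

Fact zexp_mul1r x : pmap (zexp_mul x) [:: 0 : int] = [:: x].
Proof. by rewrite /= addr0. Qed.

HB.instance Definition _ := isPartialMonoid.Build zexp
  zexp_mulA zexp_mul1l zexp_mul1r erefl erefl.

(* Z[t, t^-1], as the group ring of Z *)
Definition laurent : Type := pmalg int zexp.

HB.instance Definition _ := GRing.Algebra.on laurent.
Definition laurent_t : laurent := << 1 *g (1 : int) >>.

Fact laurent_mulC : commutative ( *%R : laurent -> laurent -> laurent).
Proof.
move=> f g; elim/pm_ind: f => [|f f' IH IH'|c k]; first by rewrite mul0r mulr0.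
  by rewrite mulrDl mulrDr IH IH'.
elim/pm_ind: g => [|g g' IH IH'|d l]; first by rewrite mul0r mulr0.
  by rewrite mulrDl mulrDr IH IH'.
rewrite !pm_mulE !pm_mulUU mulrC; congr (pmU _ _).
by congr Some; exact: addrC.
Qed.
HB.instance Definition _ :=
  GRing.PzRing_hasCommutativeMul.Build laurent laurent_mulC.

(* Left modules over R whose carrier may live in an arbitrarily high universe.
   K_0 below is a quotient of formal sums of graded modules, whose own carriers
   are of type lmodType, so that K_0 itself cannot be an lmodType. *)
Record bigmod (R : pzRingType) := BigMod {
  mcar :> Type;
  m0 : mcar;
  madd : mcar -> mcar -> mcar;
  mopp : mcar -> mcar;
  mscale : R -> mcar -> mcar;
  maddA : associative madd;
  maddC : commutative madd;
  madd0 : left_id m0 madd;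
  maddN : left_inverse m0 mopp madd;
  mscaleA : forall a b x, mscale a (mscale b x) = mscale (a * b) x;
  mscale1 : left_id 1 mscale;
  mscaleDr : forall a x y,
    mscale a (madd x y) = madd (mscale a x) (mscale a y);
  mscaleDl : forall x a b,
    mscale (a + b) x = madd (mscale a x) (mscale b x)
}.

Definition bigmod_of_lmod (R : pzRingType) (V : lmodType R) : bigmod R :=
  BigMod (@addrA V) (@addrC V) (@add0r V) (@addNr V)
    (@scalerA R V) (@scale1r R V) (@scalerDr R V) (@scalerDl R V).

Definition bigmod_iso (R : pzRingType) (U V : bigmod R) (f : U -> V) : Prop :=
  [/\ bijective f,
      forall x y, f (madd x y) = madd (f x) (f y) &
      forall a x, f (mscale a x) = mscale a (f x)].

Definition finite_support (T : Type) (f : T -> int) : Prop :=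
  exists (I : finType) (v : I -> T), forall x, f x <> 0 -> exists i, v i = x.

Record fsum (T : Type) := FSum {
  fcoef :> T -> int;
  fsum_fin : finite_support fcoef
}.

Definition fdelta (T : Type) (x y : T) : int := (`[< x = y >] : nat)%:Z.

Section FSum.
Variable T : Type.
Implicit Types (f g : fsum T).

Fact fsum0_fin : finite_support (fun _ : T => 0).
Proof. by exists void, (@of_void T). Qed.
Definition fsum0 : fsum T := FSum fsum0_fin.

Fact fsum_add_fin f g : finite_support (fun x => f x + g x).
Proof.
case: f g => f [I [v vP]] [g [J [w wP]]] /=.
exists (I + J)%type, (fun k => match k with inl i => v i | inr j => w j end).
move=> x fg0; have [fx0|/vP [i <-]] := EM (f x = 0); last by exists (inl i).
have /wP [j <-] : g x <> 0 by move=> gx0; apply: fg0; rewrite fx0 gx0.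
by exists (inr j).
Qed.
Definition fsum_add f g : fsum T := FSum (fsum_add_fin f g).

Fact fsum_opp_fin f : finite_support (fun x => - f x).
Proof.
case: f => f [I [v vP]] /=; exists I, v => x fx0; apply: vP => fx.
by apply: fx0; rewrite fx.
Qed.
Definition fsum_opp f : fsum T := FSum (fsum_opp_fin f).

Fact fdelta_fin (x : T) : finite_support (fdelta x).
Proof.
exists unit, (fun=> x) => y; rewrite /fdelta.
by case: asboolP => // -> _; exists tt.
Qed.
Definition fsum_delta x : fsum T := FSum (fdelta_fin x).
End FSum.

Section GrothendieckGroup.
Variable C : category.

Inductive K0_rel : (C -> int) -> Prop :=
| K0_rel0 : K0_rel (fun=> 0)
| K0_relB f g : K0_rel f -> K0_rel g -> K0_rel (fun X => f X - g X)
| K0_rel_exact X' X X'' (f : Hom X' X) (g : Hom X X'') : short_exact f g ->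
    K0_rel (fun Y => fdelta X Y - (fdelta X' Y + fdelta X'' Y)).

Definition K0_equiv (f g : fsum C) : Prop := K0_rel (fun X => f X - g X).

(* the free abelian group on the objects of C modulo the relations
   [X] = [X'] + [X''] *)
Definition K0 : Type := cquot K0_equiv.

Definition K0_pi (f : fsum C) : K0 := cpi _ f.

Definition K0_class (X : C) : K0 := K0_pi (fsum_delta X).

Lemma K0_relN f : K0_rel f -> K0_rel (fun X => - f X).
Proof.
move=> /(K0_relB K0_rel0); congr K0_rel.
by apply/funext => X; rewrite sub0r.
Qed.

Lemma K0_relD f g : K0_rel f -> K0_rel g -> K0_rel (fun X => f X + g X).
Proof.
move=> rf /K0_relN rg; have := K0_relB rf rg; congr K0_rel.
by apply/funext => X; rewrite opprK.
Qed.

Lemma K0_relMz f n : K0_rel f -> K0_rel (fun X => n * f X).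
Proof.
move=> rf; have nat_case m : K0_rel (fun X => m%:Z * f X).
  elim: m => [|m IH].
    by have := K0_rel0; congr K0_rel; apply/funext => X; rewrite mul0r.
  have := K0_relD rf IH; congr K0_rel; apply/funext => X.
  by rewrite -[in RHS]add1n PoszD mulrDl mul1r.
case: (intP n) => [|m|m]; [exact: nat_case 0|exact: nat_case|].
have := K0_relN (nat_case m.+1); congr K0_rel.
by apply/funext => X; rewrite mulNr.
Qed.

Lemma K0_rel_sum I (r : seq I) (F : I -> C -> int) :
  (forall i, K0_rel (F i)) -> K0_rel (fun X => \sum_(i <- r) F i X).
Proof.
move=> rF; elim: r => [|i r IH].
  by have := K0_rel0; congr K0_rel; apply/funext => X; rewrite big_nil.
have := K0_relD (rF i) IH; congr K0_rel.
by apply/funext => X; rewrite big_cons.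
Qed.

Implicit Types f g h : fsum C.

Lemma K0_equivP f g : K0_pi f = K0_pi g <-> K0_equiv f g.
Proof.
split; first apply: cpi_inj; last apply: cpi_eq; rewrite /K0_equiv.
- move=> x; have := K0_rel0; congr K0_rel.
  by apply/funext => X; rewrite subrr.
- move=> x y /K0_relN; congr K0_rel.
  by apply/funext => X; rewrite opprB.
- move=> x y z xy yz; have := K0_relD xy yz; congr K0_rel.
  by apply/funext => X; rewrite addrA subrK.
Qed.

Lemma K0_eq f g : (forall X, f X = g X) -> K0_pi f = K0_pi g.
Proof.
move=> fg; apply/K0_equivP; have := K0_rel0; congr K0_rel.
by apply/funext => X; rewrite fg subrr.
Qed.

Lemma K0_ind (P : K0 -> Prop) : (forall f, P (K0_pi f)) -> forall x, P x.
Proof. by move=> Pf x; rewrite -(creprK x); exact: Pf. Qed.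

Lemma K0_reprP f : K0_equiv (crepr (K0_pi f)) f.
Proof. by apply/K0_equivP; rewrite [LHS]creprK. Qed.

Definition K0_add (x y : K0) : K0 := K0_pi (fsum_add (crepr x) (crepr y)).
Definition K0_opp (x : K0) : K0 := K0_pi (fsum_opp (crepr x)).

Lemma K0_addE f g : K0_add (K0_pi f) (K0_pi g) = K0_pi (fsum_add f g).
Proof.
apply/K0_equivP; have := K0_relD (K0_reprP f) (K0_reprP g).
by congr K0_rel; apply/funext => X /=; rewrite opprD addrACA.
Qed.

Lemma K0_oppE f : K0_opp (K0_pi f) = K0_pi (fsum_opp f).
Proof.
apply/K0_equivP; have := K0_relN (K0_reprP f).
by congr K0_rel; apply/funext => X /=; rewrite opprD.
Qed.

Fact K0_addA : associative K0_add.
Proof.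
elim/K0_ind=> f; elim/K0_ind=> g; elim/K0_ind=> h.
by rewrite !K0_addE; apply: K0_eq => X /=; rewrite addrA.
Qed.

Fact K0_addC : commutative K0_add.
Proof.
elim/K0_ind=> f; elim/K0_ind=> g.
by rewrite !K0_addE; apply: K0_eq => X /=; rewrite addrC.
Qed.

Fact K0_add0 : left_id (K0_pi (fsum0 C)) K0_add.
Proof. by elim/K0_ind=> f; rewrite K0_addE; apply: K0_eq => X /=; rewrite add0r. Qed.

Fact K0_addN : left_inverse (K0_pi (fsum0 C)) K0_opp K0_add.
Proof.
elim/K0_ind=> f; rewrite K0_oppE K0_addE.
by apply: K0_eq => X /=; rewrite addNr.
Qed.
End GrothendieckGroup.

(* a category with exact autoequivalences X |-> X(n) composing strictly *)
Record twisted_category := TwistedCategory {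
  tcat :> category;
  twist : int -> tcat -> tcat;
  twist0 : forall X, twist 0 X = X;
  twistD : forall m n X, twist m (twist n X) = twist (m + n) X;
  twist_exact : forall n (X' X X'' : tcat) (f : Hom X' X) (g : Hom X X''),
    short_exact f g ->
    exists (f' : Hom (twist n X') (twist n X))
           (g' : Hom (twist n X) (twist n X'')), short_exact f' g'
}.

Section TwistedK0.
Variable C : twisted_category.
Implicit Types (p q : laurent) (f g : fsum C).

(* t acts by [X] |-> [X(-1)], hence on the coefficient functions of formal sums
   by precomposition with the twist (1). *)
Definition K0_act p (f : C -> int) (X : C) : int :=
  \sum_(i <- msupp p) p@_i * f (twist i X).

Lemma K0_actE p f X : K0_act p f X = mmap idfun (fun i => f (twist i X)) p.
Proof. by []. Qed.

Fact K0_act_fin p f : finite_support (K0_act p f).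
Proof.
case: f => f [I [v vP]] /=.
exists (I * 'I_(size (msupp p)))%type,
  (fun ij : I * 'I_(size (msupp p)) =>
    twist (- ((msupp p)`_(ij.2 : nat))) (v ij.1)) => X pfX.
have [[i ip /vP [j vj]]|none] := EM (exists2 i, i \in msupp p & f (twist i X) <> 0).
  move: (ip); rewrite -index_mem => lti; exists (j, Ordinal lti) => /=.
  by rewrite nth_index // vj twistD addNr twist0.
case: pfX; rewrite /K0_act big1_seq // => i /andP[_ ip].
have [->|fX] := EM (f (twist i X) = 0); first by rewrite mulr0.
by case: none; exists i.
Qed.

Definition fsum_act p f : fsum C := FSum (K0_act_fin p f).

Definition K0_scale p (x : K0 C) : K0 C := K0_pi (fsum_act p (crepr x)).

Lemma K0_rel_twist n (f : C -> int) : K0_rel f -> K0_rel (fun X => f (twist n X)).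
Proof.
elim=> [|{}f g _ rf _ rg|X' X X'' {}f g fg]; first exact: K0_rel0.
  exact: K0_relB.
have [f' [g' /K0_rel_exact]] := twist_exact (- n) fg.
congr K0_rel; apply/funext => Y.
have dE (Z : C) : fdelta (twist (- n) Z) Y = fdelta Z (twist n Y).
  rewrite /fdelta (_ : `[< _ >] = `[< Z = twist n Y >]) //.
  apply: asbool_equiv_eq; split=> [<-|->].
    by rewrite twistD addrN twist0.
  by rewrite twistD addNr twist0.
by rewrite !dE.
Qed.

Lemma K0_scaleE p f : K0_scale p (K0_pi f) = K0_pi (fsum_act p f).
Proof.
apply/K0_equivP; have := @K0_rel_sum C _ (msupp p)
  (fun i X => p@_i * (crepr (K0_pi f) (twist i X) - f (twist i X))).
rewrite /K0_equiv /= /K0_act => H.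
have /H : forall i, K0_rel (fun X =>
    p@_i * (crepr (K0_pi f) (twist i X) - f (twist i X))).
  by move=> i; apply/K0_relMz; apply: (K0_rel_twist i (K0_reprP f)).
congr K0_rel; apply/funext => X; rewrite -sumrB.
by apply: eq_bigr => i _; rewrite mulrBr.
Qed.

Fact K0_scaleA p q x : K0_scale p (K0_scale q x) = K0_scale (p * q) x.
Proof.
elim/K0_ind: x => f; rewrite !K0_scaleE; apply: K0_eq => X /=.
have act_lin (F : zexp -> int) (u v : laurent) : mmap idfun F (u * v) =
    mmap idfun (fun i => mmap idfun (fun j => F ((i : int) + j)) v) u.
  elim/pm_ind: u => [|u u' IH IH'|c k]; first by rewrite mul0r !raddf0.
    by rewrite mulrDl !raddfD /= IH IH'.
  elim/pm_ind: v => [|v v' IH IH'|d l]; first by rewrite mulr0 mmapU !raddf0 mulr0.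
    move: IH IH'; rewrite !mmapU /= => IH IH'.
    by rewrite mulrDr !raddfD /= IH IH' mulrDr.
  by rewrite pm_mulE pm_mulUU /= !mmapU /= mulrA.
rewrite !K0_actE act_lin /mmap; apply: eq_bigr => i _; congr (_ * _).
by rewrite /K0_act; apply: eq_bigr => j _; rewrite twistD addrC.
Qed.

Fact K0_scale1 : left_id 1 K0_scale.
Proof.
elim/K0_ind=> f; rewrite K0_scaleE; apply: K0_eq => X /=.
have -> : (1 : laurent) = << 1 *g (0 : int) >>.
  by rewrite /1%R /= /pm_one big_seq1.
by rewrite K0_actE mmapU /= twist0 mul1r.
Qed.

Fact K0_scaleDr p x y :
  K0_scale p (K0_add x y) = K0_add (K0_scale p x) (K0_scale p y).
Proof.
elim/K0_ind: x => f; elim/K0_ind: y => g.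
rewrite !(K0_addE, K0_scaleE); apply: K0_eq => X /=.
by rewrite /K0_act -big_split; apply: eq_bigr => i _; rewrite mulrDr.
Qed.

Fact K0_scaleDl x p q :
  K0_scale (p + q) x = K0_add (K0_scale p x) (K0_scale q x).
Proof.
elim/K0_ind: x => f; rewrite !(K0_addE, K0_scaleE); apply: K0_eq => X /=.
by rewrite !K0_actE raddfD.
Qed.

Lemma K0_scale_t (X : C) :
  K0_scale laurent_t (K0_class X) = K0_class (twist (-1) X).
Proof.
rewrite /K0_class K0_scaleE; apply: K0_eq => Y.
rewrite [LHS](K0_actE laurent_t) [LHS]mmapU [LHS]mul1r /=.
rewrite /fdelta (_ : `[< _ >] = `[< twist (-1) X = Y >]) //.
apply: asbool_equiv_eq; split=> [->|<-].
  by rewrite twistD addNr twist0.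
by rewrite twistD addrN twist0.
Qed.

Definition K0_module : bigmod laurent :=
  BigMod (@K0_addA C) (@K0_addC C) (@K0_add0 C) (@K0_addN C)
    K0_scaleA K0_scale1 K0_scaleDr K0_scaleDl.
End TwistedK0.

Record submodule (R : pzRingType) (V : lmodType R) := Submodule {
  submod :> V -> Prop;
  submod0 : submod 0;
  submodD : forall x y, submod x -> submod y -> submod (x + y);
  submodZ : forall a x, submod x -> submod (a *: x)
}.

Section QuotientModule.
Variables (R : pzRingType) (V : lmodType R) (U : submodule V).

Definition submod_pred : {pred V} := fun x => `[< U x >].

Fact submod_pred_closed : submod_closed submod_pred.
Proof.
split=> [|a x y /asboolP Ux /asboolP Uy]; apply/asboolP; first exact: submod0.
by apply: submodD => //; exact: submodZ.
Qed.

HB.instance Definition _ :=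
  GRing.isSubmodClosed.Build R V submod_pred submod_pred_closed.

Definition quot_mod : Type := Quotient.quot submod_pred.

HB.instance Definition _ := GRing.Zmodule.on quot_mod.

Definition quot_pi (x : V) : quot_mod := (\pi_(Quotient.quot submod_pred) x)%qT.
Definition quot_repr (x : quot_mod) : V := repr (x : Quotient.quot submod_pred).

Lemma quot_reprK x : quot_pi (quot_repr x) = x.
Proof. exact: reprK. Qed.

Lemma quot_piP x y : quot_pi x = quot_pi y <-> U (x - y).
Proof.
split=> [/eqP|Uxy]; last apply/eqP; rewrite -Quotient.idealrBE; last exact/asboolP.
by move/asboolP.
Qed.

Lemma quot_piD x y : quot_pi (x + y) = quot_pi x + quot_pi y.
Proof. exact: raddfD. Qed.

Lemma quot_ind (P : quot_mod -> Prop) :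
  (forall x, P (quot_pi x)) -> forall x, P x.
Proof. by move=> Px x; rewrite -(quot_reprK x); exact: Px. Qed.

Lemma quot_reprP x : U (quot_repr (quot_pi x) - x).
Proof. by apply/quot_piP; rewrite quot_reprK. Qed.

Definition quot_scale (a : R) (x : quot_mod) : quot_mod :=
  quot_pi (a *: quot_repr x).

Lemma quot_scaleE a x : quot_scale a (quot_pi x) = quot_pi (a *: x).
Proof. by apply/quot_piP; rewrite -scalerBr; apply/submodZ/quot_reprP. Qed.

Fact quot_scaleA a b x : quot_scale a (quot_scale b x) = quot_scale (a * b) x.
Proof. by elim/quot_ind: x => x; rewrite !quot_scaleE scalerA. Qed.
Fact quot_scale1 : left_id 1 quot_scale.
Proof. by elim/quot_ind=> x; rewrite quot_scaleE scale1r. Qed.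
Fact quot_scaleDr : right_distributive quot_scale +%R.
Proof.
move=> a; elim/quot_ind=> x; elim/quot_ind=> y.
by rewrite -quot_piD !quot_scaleE scalerDr quot_piD.
Qed.
Fact quot_scaleDl x : {morph quot_scale^~ x : a b / a + b}.
Proof.
by move=> a b; elim/quot_ind: x => x; rewrite !quot_scaleE scalerDl quot_piD.
Qed.

HB.instance Definition _ := GRing.Zmodule_isLmodule.Build R quot_mod
  quot_scaleA quot_scale1 quot_scaleDr quot_scaleDl.

Lemma quot_piZ a x : quot_pi (a *: x) = a *: quot_pi x.
Proof. by rewrite -quot_scaleE. Qed.
End QuotientModule.

Record two_sided_ideal (R : comNzRingType) (A : algType R) := TwoSidedIdeal {
  ideal_sub :> submodule A;
  idealMl : forall a x, ideal_sub x -> ideal_sub (a * x);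
  idealMr : forall a x, ideal_sub x -> ideal_sub (x * a);
  ideal1 : ~ ideal_sub 1
}.

Definition quot_alg (R : comNzRingType) (A : algType R) (I : two_sided_ideal A)
  : Type := quot_mod I.

Section QuotientAlgebra.
Variables (R : comNzRingType) (A : algType R) (I : two_sided_ideal A).

HB.instance Definition _ := GRing.Lmodule.on (quot_alg I).

Definition quot_mul (x y : quot_alg I) : quot_alg I :=
  quot_pi I (quot_repr x * quot_repr y).

Lemma quot_mulE x y : quot_mul (quot_pi I x) (quot_pi I y) = quot_pi I (x * y).
Proof.
apply/quot_piP; set x' := quot_repr _; set y' := quot_repr _.
rewrite -(subrK (x' * y) (x' * y')) -addrA -mulrBr -mulrBl.
by apply: submodD; [apply: idealMl|apply: idealMr]; exact: quot_reprP.
Qed.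

Fact quot_mulA : associative quot_mul.
Proof.
elim/quot_ind=> x; elim/quot_ind=> y; elim/quot_ind=> z.
by rewrite !quot_mulE mulrA.
Qed.
Fact quot_mul1l : left_id (quot_pi I 1) quot_mul.
Proof. by elim/quot_ind=> x; rewrite quot_mulE mul1r. Qed.
Fact quot_mul1r : right_id (quot_pi I 1) quot_mul.
Proof. by elim/quot_ind=> x; rewrite quot_mulE mulr1. Qed.
Fact quot_mulDl : left_distributive quot_mul +%R.
Proof.
elim/quot_ind=> x; elim/quot_ind=> y; elim/quot_ind=> z.
by rewrite -quot_piD !quot_mulE mulrDl quot_piD.
Qed.
Fact quot_mulDr : right_distributive quot_mul +%R.
Proof.
elim/quot_ind=> x; elim/quot_ind=> y; elim/quot_ind=> z.
by rewrite -quot_piD !quot_mulE mulrDr quot_piD.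
Qed.
Fact quot_one_neq0 : quot_pi I 1 != 0 :> quot_alg I.
Proof.
apply/eqP; rewrite -(raddf0 (\pi_(Quotient.quot (submod_pred I))))%qT => /quot_piP.
by rewrite subr0; exact: ideal1.
Qed.

HB.instance Definition _ := GRing.Zmodule_isNzRing.Build (quot_alg I)
  quot_mulA quot_mul1l quot_mul1r quot_mulDl quot_mulDr quot_one_neq0.

Definition alg_pi (x : A) : quot_alg I := quot_pi I x.

Lemma alg_piM x y : alg_pi (x * y) = alg_pi x * alg_pi y.
Proof. exact: esym (quot_mulE x y). Qed.

Lemma alg_piZ c x : alg_pi (c *: x) = c *: alg_pi x.
Proof. exact: quot_piZ. Qed.

Fact quot_scaleAl (c : R) (x y : quot_alg I) : c *: (x * y) = (c *: x) * y.
Proof.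
elim/quot_ind: x => x; elim/quot_ind: y => y.
rewrite -/(alg_pi x) -/(alg_pi y) -alg_piM -!alg_piZ -alg_piM.
by rewrite scalerAl.
Qed.
HB.instance Definition _ :=
  GRing.Lmodule_isLalgebra.Build R (quot_alg I) quot_scaleAl.

Fact quot_scaleAr (c : R) (x y : quot_alg I) : c *: (x * y) = x * (c *: y).
Proof.
elim/quot_ind: x => x; elim/quot_ind: y => y.
rewrite -/(alg_pi x) -/(alg_pi y) -alg_piM -!alg_piZ -alg_piM.
by rewrite scalerAr.
Qed.
HB.instance Definition _ :=
  GRing.Lalgebra_isAlgebra.Build R (quot_alg I) quot_scaleAr.
End QuotientAlgebra.

(* V is the internal direct sum of the subgroups G i, i in Z *)
Definition is_grading (V : zmodType) (G : int -> V -> Prop) : Prop :=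
  [/\ forall i, G i 0,
      forall i x y, G i x -> G i y -> G i (x - y),
      forall x, exists (s : seq int) (F : int -> V),
        [/\ uniq s, forall i, G i (F i) & x = \sum_(i <- s) F i] &
      forall (s : seq int) (F : int -> V), uniq s -> (forall i, G i (F i)) ->
        \sum_(i <- s) F i = 0 -> forall i, i \in s -> F i = 0].

Lemma is_grading_shift (V : zmodType) (G : int -> V -> Prop) (n : int) :
  is_grading G -> is_grading (fun i => G (n + i)).
Proof.
case=> G0 GB Gex Guniq; split=> // [i x y|x|s F us GF F0 i si]; first exact: GB.
  have [s [F [us GF xE]]] := Gex x.
  exists [seq i - n | i <- s], (fun i => F (n + i)); split=> //.
    by rewrite map_inj_uniq // => i j /addIr.
  rewrite xE big_map; apply: eq_bigr => i _; congr F.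
  by rewrite addrCA subrr addr0.
have := Guniq [seq n + i | i <- s] (fun i => F (i - n)).
rewrite big_map map_inj_uniq => [H|j l /addrI //].
have nK j : n + j - n = j by rewrite addrAC subrr add0r.
have := H us _ _ (n + i); rewrite nK; apply.
- by move=> j; have := GF (j - n); rewrite addrCA subrr addr0.
- by rewrite -[RHS]F0; apply: eq_bigr => j _; rewrite nK.
by rewrite mem_map // => j l /addrI.
Qed.

Record graded_algebra (k : fieldType) := GradedAlgebra {
  galg :> algType k;
  gdeg : int -> galg -> Prop;
  gdegP : is_grading gdeg;
  gdegZ : forall i c a, gdeg i a -> gdeg i (c *: a);
  gdeg1 : gdeg 0 1;
  gdegM : forall i j a b, gdeg i a -> gdeg j b -> gdeg (i + j) (a * b)
}.

Section GradedModules.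
Variables (k : fieldType) (D : graded_algebra k).

Definition is_graded_module (M : lmodType D) (G : int -> M -> Prop) : Prop :=
  is_grading G /\
  forall i j (a : D) (x : M), gdeg i a -> G j x -> G (i + j) (a *: x).

Record gmod := GMod {
  gcar :> lmodType D;
  gmdeg : int -> gcar -> Prop;
  gmodP : is_graded_module gmdeg
}.

(* a presentation (+)_j D(-b j) -> (+)_i D(-a i) -> M -> 0 with finitely many
   summands, given by the images x i of the generators and the matrix s *)
Definition finitely_presented (M : gmod) : Prop :=
  exists (n : nat) (a : 'I_n -> int) (x : 'I_n -> M)
         (m : nat) (b : 'I_m -> int) (s : 'I_m -> 'I_n -> D),
  [/\ forall i, gmdeg (a i) (x i),
      forall j i, gdeg (b j - a i) (s j i),
      forall y : M, exists c : 'I_n -> D, y = \sum_(i < n) c i *: x i &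
      forall c : 'I_n -> D, \sum_(i < n) c i *: x i = 0 <->
        exists d : 'I_m -> D, forall i, c i = \sum_(j < m) d j * s j i].

Definition finite_dimensional (M : gmod) : Prop :=
  exists (n : nat) (x : 'I_n -> M), forall y : M,
  exists c : 'I_n -> k, y = \sum_(i < n) (c i)%:A *: x i.

Record grobj := GrObj { grmod :> gmod; grmodP : finitely_presented grmod }.

Definition is_ghom (M N : gmod) (f : M -> N) : Prop :=
  (forall (a : D) x y, f (a *: x + y) = a *: f x + f y) /\
  (forall i x, gmdeg i x -> gmdeg i (f x)).

Definition ghom (M N : gmod) : Type := {f : M -> N | is_ghom f}.

Lemma ghom_eq (M N : gmod) (f g : ghom M N) : sval f =1 sval g -> f = g.
Proof.
by case: f g => f fP [g gP] /= /funext fg; apply: eq_exist.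
Qed.

Fact ghom_idP (M : gmod) : @is_ghom M M id.
Proof. by []. Qed.
Definition ghom_id (M : gmod) : ghom M M := exist _ id (ghom_idP M).

Fact ghom_compP (M N P : gmod) (f : ghom M N) (g : ghom N P) :
  is_ghom (sval g \o sval f).
Proof.
case: f g => f [fl fd] [g [gl gd]] /=; split=> [a x y|i x xi] /=.
  by rewrite fl gl.
by apply/gd/fd.
Qed.
Definition ghom_comp (M N P : gmod) (f : ghom M N) (g : ghom N P) : ghom M P :=
  exist _ _ (ghom_compP f g).

Fact ghom_comp1f (M N : grobj) (f : ghom M N) : ghom_comp (ghom_id M) f = f.
Proof. exact: ghom_eq. Qed.
Fact ghom_compf1 (M N : grobj) (f : ghom M N) : ghom_comp f (ghom_id N) = f.
Proof. exact: ghom_eq. Qed.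
Fact ghom_compA (M N P T : grobj) (f : ghom M N) (g : ghom N P) (h : ghom P T) :
  ghom_comp f (ghom_comp g h) = ghom_comp (ghom_comp f g) h.
Proof. exact: ghom_eq. Qed.

Definition gr : category :=
  @Category grobj (fun M N => ghom M N) (fun M => ghom_id M)
    (fun M N P f g => ghom_comp f g) ghom_comp1f ghom_compf1 ghom_compA.

Definition fdim (M : gr) : Prop := finite_dimensional M.

(* the twist M(n), with M(n)_i = M_(n + i) *)
Fact gshiftP (n : int) (M : gmod) :
  @is_graded_module M (fun i x => gmdeg (n + i) x).
Proof.
case: (gmodP M) => Mg MD; split; first exact: is_grading_shift.
by move=> i j a x ai xj; rewrite addrCA; exact: MD.
Qed.
Definition gshift (n : int) (M : gmod) : gmod := GMod (gshiftP n M).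

Fact gshift_fp (n : int) (M : gmod) :
  finitely_presented M -> finitely_presented (gshift n M).
Proof.
case=> l [a [x [m [b [s [xa sb xgen xrel]]]]]].
exists l, (fun i => a i - n), x, m, (fun j => b j - n), s; split=> //= [i|j i].
  by rewrite addrCA subrr addr0.
by rewrite opprB addrA subrK.
Qed.

Definition gr_shift (n : int) (M : gr) : gr :=
  GrObj (gshift_fp n (grmodP M)).

Lemma gr_shift_eq (M : gr) (G : int -> M -> Prop) (GP : is_graded_module G)
    (fpG : finitely_presented (GMod GP)) :
  (forall i x, gmdeg i x <-> G i x) -> GrObj fpG = M.
Proof.
case: M G GP fpG => [[M H HP] fpM] /= G GP fpG HG.
have {HG} HG : H = G.
  by apply/funext => i; apply/funext => x; apply/propext/HG.
case: _ / HG in GP fpG *; rewrite (Prop_irrelevance GP HP) in fpG *.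
by rewrite (Prop_irrelevance fpG fpM).
Qed.

Lemma gr_shift0 M : gr_shift 0 M = M.
Proof. by apply: gr_shift_eq => i x; rewrite add0r. Qed.

Lemma gr_shiftD m n M : gr_shift m (gr_shift n M) = gr_shift (m + n) M.
Proof.
apply: (@gr_shift_eq (gr_shift (m + n) M)) => i x /=.
by rewrite addrA (addrC m).
Qed.

Fact gshift_homP n (M N : gmod) (f : ghom M N) :
  @is_ghom (gshift n M) (gshift n N) (sval f).
Proof. by case: f => f [fl fd]; split=> //= i x; exact: fd. Qed.
Definition gshift_hom n (M N : gmod) (f : ghom M N) :
  ghom (gshift n M) (gshift n N) := exist _ _ (gshift_homP n f).

Definition gr_shift_functor (n : int) : functor gr gr.
Proof.
apply: (@Functor gr gr (gr_shift n) (fun M N f => gshift_hom n f)).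
  by move=> M; exact: ghom_eq.
by move=> M N P f g; exact: ghom_eq.
Defined.

Lemma gr_shift_retraction n m : m + n = 0 ->
  retraction_data (gr_shift_functor n) (gr_shift_functor m).
Proof.
move=> mn0.
have aP (M : gr) : @is_ghom (gr_shift m (gr_shift n M)) M id.
  by split=> //= i x; rewrite addrA (addrC n) mn0 add0r.
have bP (M : gr) : @is_ghom M (gr_shift m (gr_shift n M)) id.
  by split=> //= i x; rewrite addrA (addrC n) mn0 add0r.
exists (fun M => exist _ id (aP M)), (fun M => exist _ id (bP M)).
by split=> *; exact: ghom_eq.
Qed.

Lemma gr_shift_Serre_iso n (M N : gr) (f : Hom M N) :
  Serre_iso fdim f -> Serre_iso fdim (fhom (gr_shift_functor n) f).
Proof.
have FG := gr_shift_retraction (addNr n); have GF := gr_shift_retraction (addrN n).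
case=> -[K [i [iK fK]]] [Q [p [pQ fQ]]]; split.
  by exists (gr_shift n K), (fhom (gr_shift_functor n) i); split=> //;
     exact: (equiv_kernel FG GF).
by exists (gr_shift n Q), (fhom (gr_shift_functor n) p); split=> //;
   exact: (equiv_cokernel FG GF).
Qed.

Fact qgr_shift_exact n (M' M M'' : Serre_quotient fdim) (f : Hom M' M)
    (g : Hom M M'') : short_exact f g ->
  exists (f' : @Hom (Serre_quotient fdim) (gr_shift n M') (gr_shift n M))
         (g' : @Hom (Serre_quotient fdim) (gr_shift n M) (gr_shift n M'')),
    short_exact f' g'.
Proof.
pose F := localized (@gr_shift_Serre_iso n).
pose G := localized (@gr_shift_Serre_iso (- n)).
have FG : retraction_data F G.
  exact/localized_retraction/gr_shift_retraction/addNr.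
have GF : retraction_data G F.
  exact/localized_retraction/gr_shift_retraction/addrN.
move=> fg; exists (fhom F f), (fhom F g).
exact: (equiv_short_exact FG GF).
Qed.

(* qgr D = gr D / fdim D; its objects are those of gr D, and the quotient functor
   loc_functor is the identity on objects. *)
Definition qgr : twisted_category :=
  @TwistedCategory (Serre_quotient fdim) gr_shift gr_shift0 gr_shiftD
    qgr_shift_exact.

Fact regular_gmodP : @is_graded_module (D^o : lmodType D) (@gdeg k D).
Proof. by split; [exact: gdegP|exact: gdegM]. Qed.
Definition regular_gmod : gmod := GMod regular_gmodP.

Fact regular_fp : finitely_presented regular_gmod.
Proof.
exists 1%N, (fun=> 0), (fun=> 1 : D^o), 0%N, (fun=> 0), (fun _ _ => 0).
split=> [i|[] //|y|c]; first exact: gdeg1.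
  by exists (fun=> y); rewrite big_ord1; exact: esym (mulr1 y).
rewrite big_ord1; split=> [c0|[d dP]].
  exists (fun=> 0) => i; rewrite big_ord0 (ord1 i) -c0.
  exact: esym (mulr1 _).
by rewrite dP big_ord0 scale0r.
Qed.

(* the image O in qgr D of the left module D *)
Definition structure_sheaf : qgr := GrObj regular_fp.
End GradedModules.

Section MalgGrading.
Variables (K : choiceType) (R : nzRingType) (d : K -> int).
Implicit Types (f g : {malg R[K]}).

Definition mhomog (n : int) g : Prop := forall w, w \in msupp g -> d w = n.

Definition mpart (n : int) g : {malg R[K]} :=
  \sum_(w <- msupp g | d w == n) << g@_w *g w >>.

Lemma mcoeff_part n g w : (mpart n g)@_w = if d w == n then g@_w else 0.
Proof.
rewrite /mpart raddf_sum /=; case: (msuppP g w) => [wg|wg].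
  rewrite -big_filter (eq_bigr (fun v => g@_v *+ (v == w))); last first.
    by move=> v _; rewrite mcoeffU.
  case: ifP => dw.
    rewrite (bigD1_seq w) ?mem_filter ?dw ?filter_uniq ?fset_uniq //=.
    by rewrite eqxx big1 ?addr0 // => v /negbTE ->.
  rewrite big_seq big1 // => v; rewrite mem_filter => /andP[dv _].
  by case: eqP => // vw; rewrite -vw dv in dw.
rewrite if_same big1_seq // => v /andP[_ vg]; rewrite mcoeffU.
by case: eqP => // vw; rewrite -vw vg in wg.
Qed.

Lemma mpartD n f g : mpart n (f + g) = mpart n f + mpart n g.
Proof.
apply/malgP => w; rewrite mcoeffD !mcoeff_part mcoeffD.
by case: ifP; rewrite ?addr0.
Qed.

Lemma mpartZ n c g : mpart n (c *: g) = c *: mpart n g.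
Proof.
apply/malgP => w; rewrite mcoeffZ !mcoeff_part mcoeffZ.
by case: ifP; rewrite ?mulr0.
Qed.

Lemma mpart0 n : mpart n 0 = 0.
Proof. by apply/malgP => w; rewrite mcoeff_part mcoeff0 if_same. Qed.

Lemma mhomogP n g : mhomog n g <-> (forall w, d w != n -> g@_w = 0).
Proof.
split=> [H w|H w].
  by move=> dw; apply/mcoeff_outdom; exact: contra_neqN (@H w) dw.
rewrite -mcoeff_neq0 => gw; apply/eqP; case: eqVneq => // /H gw0.
by rewrite gw0 eqxx in gw.
Qed.

Lemma mhomog_part n g : mhomog n (mpart n g).
Proof. by apply/mhomogP => w; rewrite mcoeff_part => /negbTE ->. Qed.

Lemma mpart_homog n m g : mhomog n g -> mpart m g = if m == n then g else 0.
Proof.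
move/mhomogP => H; apply/malgP => w; rewrite mcoeff_part.
case: (eqVneq m n) => [->|mn]; case: eqVneq => // dw.
- by rewrite H.
- by rewrite H ?mcoeff0 // dw.
- by rewrite mcoeff0.
Qed.

Lemma mpart_sum n I (r : seq I) (F : I -> {malg R[K]}) :
  mpart n (\sum_(i <- r) F i) = \sum_(i <- r) mpart n (F i).
Proof. exact: (big_morph (mpart n) (mpartD n) (mpart0 n)). Qed.

Lemma mparts g : exists s, [/\ uniq s & g = \sum_(i <- s) mpart i g].
Proof.
exists (undup [seq d w | w <- msupp g]); split; first exact: undup_uniq.
apply/malgP => w; rewrite raddf_sum /=; case: (msuppP g w) => [wg|wg].
  rewrite (bigD1_seq (d w)) ?undup_uniq //=; last first.
    by rewrite mem_undup; apply: map_f.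
  rewrite mcoeff_part eqxx big1 ?addr0 // => n dn.
  by rewrite mcoeff_part eq_sym (negbTE dn).
rewrite big1 // => n _; rewrite mcoeff_part.
by rewrite (mcoeff_outdom wg) if_same.
Qed.

Lemma mhomog_grading : is_grading mhomog.
Proof.
split=> [n w|n f g /mhomogP fn /mhomogP gn|g|s F us FG F0 n sn].
- by rewrite msupp0.
- by apply/mhomogP => w dw; rewrite mcoeffB fn // gn // subrr.
- by have [s [us gE]] := mparts g; exists s, (mpart^~ g); split=> //;
     move=> n; exact: mhomog_part.
have := mpart_sum n s F; rewrite F0 mpart0 (bigD1_seq n) //=.
rewrite (mpart_homog _ (FG n)) eqxx big1 ?addr0 // => m mn.
by rewrite (mpart_homog _ (FG m)) eq_sym (negbTE mn).
Qed.

Variable U : submodule {malg R[K]}.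
Hypothesis Upart : forall n g, U g -> U (mpart n g).

Definition qhomog (n : int) (y : quot_mod U) : Prop :=
  exists2 g, mhomog n g & y = quot_pi U g.

Lemma qhomog_grading : is_grading qhomog.
Proof.
have [h0 hB _ _] := mhomog_grading.
have pi_sum := raddf_sum (\pi_(Quotient.quot (submod_pred U)))%qT.
split=> [n|n _ _ [f fn ->] [g gn ->]|y|s F us FG F0 n sn].
- by exists 0; [exact: h0|rewrite /quot_pi raddf0].
- by exists (f - g); [exact: hB|rewrite /quot_pi raddfB].
- elim/quot_ind: y => g; have [s [us gE]] := mparts g.
  exists s, (fun i => quot_pi U (mpart i g)); split=> //.
    by move=> i; exists (mpart i g) => //; exact: mhomog_part.
  by rewrite [in LHS]gE; exact: pi_sum.
have FG' i : exists g, mhomog i g /\ F i = quot_pi U g.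
  by have [g] := FG i; exists g.
have [f fP] := choice FG'.
have : U (\sum_(i <- s) f i).
  rewrite -[X in submod _ X]subr0; apply/quot_piP.
  rewrite [RHS](_ : _ = 0); last by rewrite /quot_pi raddf0.
  by rewrite -F0 [LHS]pi_sum; apply: eq_bigr => i _; case: (fP i).
move=> /(Upart n); rewrite mpart_sum (bigD1_seq n) //=.
have fn i : mhomog i (f i) by case: (fP i).
rewrite (mpart_homog _ (fn n)) eqxx big1 ?addr0 => [Un|m mn]; last first.
  by rewrite (mpart_homog _ (fn m)) eq_sym (negbTE mn).
have [_ ->] := fP n; have -> : 0 = quot_pi U 0 by rewrite /quot_pi raddf0.
by apply/quot_piP; rewrite subr0.
Qed.
End MalgGrading.

Section PrincipalIdeal.
Variables (R : comNzRingType) (A : algType R) (g : A).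

(* the smallest two-sided ideal containing g *)
Definition in_ideal (x : A) : Prop :=
  forall J : submodule A, (forall a z, J z -> J (a * z)) ->
    (forall a z, J z -> J (z * a)) -> J g -> J x.

Fact in_ideal0 : in_ideal 0.
Proof. by move=> J *; exact: submod0. Qed.
Fact in_idealD x y : in_ideal x -> in_ideal y -> in_ideal (x + y).
Proof. by move=> xI yI J Jl Jr Jg; apply: submodD; [exact: xI|exact: yI]. Qed.
Fact in_idealZ a x : in_ideal x -> in_ideal (a *: x).
Proof. by move=> xI J Jl Jr Jg; apply: submodZ; exact: xI. Qed.
Definition principal_sub : submodule A :=
  Submodule in_ideal0 in_idealD in_idealZ.

Lemma in_idealMl a x : in_ideal x -> in_ideal (a * x).
Proof. by move=> xI J Jl Jr Jg; apply: (Jl a); exact: xI. Qed.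
Lemma in_idealMr a x : in_ideal x -> in_ideal (x * a).
Proof. by move=> xI J Jl Jr Jg; apply: (Jr a); exact: xI. Qed.
Lemma in_ideal_gen : in_ideal g.
Proof. by []. Qed.

Definition principal_ideal (proper : ~ in_ideal 1) : two_sided_ideal A :=
  @TwoSidedIdeal R A principal_sub in_idealMl in_idealMr proper.
End PrincipalIdeal.

(* the free algebra k<x, y>, the two letters being false and true *)
Definition freealg2 (k : fieldType) : Type := {malg k[{fmonom bool}]}.

Section AlgebraB.
Variables (k : fieldType).

HB.instance Definition _ := GRing.Lalgebra.on (freealg2 k).

Lemma free_ind (P : freealg2 k -> Prop) :
  P 0 -> (forall f g, P f -> P g -> P (f + g)) ->
  (forall c w, P << c *g w >>) -> forall f, P f.
Proof.
move=> P0 PD PU f; rewrite [f]monalgE.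
by elim/big_ind: _ => [//|x y|w _]; [exact: PD|exact: PU].
Qed.

Lemma free_mulUU (c d : k) (v w : {fmonom bool}) :
  (<< c *g v >> : freealg2 k) * << d *g w >> = << c * d *g (mmul v w) >>.
Proof. exact: fgmulUU. Qed.

Lemma free_scaleU (c d : k) (w : {fmonom bool}) :
  c *: (<< d *g w >> : freealg2 k) = << c * d *g w >>.
Proof. by apply/malgP => l; rewrite mcoeffZ !mcoeffU mulrnAr. Qed.

Fact free_scaleAr (c : k) (f g : freealg2 k) : c *: (f * g) = f * (c *: g).
Proof.
elim/free_ind: f => [|f f' IH IH'|d v]; first by rewrite !mul0r scaler0.
  by rewrite !mulrDl !scalerDr IH IH'.
elim/free_ind: g => [|g g' IH IH'|e w]; first by rewrite scaler0 !mulr0 scaler0.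
  by rewrite mulrDr !scalerDr IH IH' mulrDr.
by rewrite free_scaleU !free_mulUU free_scaleU mulrCA.
Qed.
HB.instance Definition _ :=
  GRing.Lalgebra_isAlgebra.Build k (freealg2 k) free_scaleAr.

Definition free_x : freealg2 k := << fmu false >>.
Definition free_y : freealg2 k := << fmu true >>.

Definition word_deg (w : {fmonom bool}) : int := (fdeg w)%:Z.

Lemma word_degM v w : word_deg (mmul v w) = word_deg v + word_deg w.
Proof. by rewrite /word_deg fdegM PoszD. Qed.

Lemma word_deg1 : word_deg mone = 0.
Proof. by rewrite /word_deg fdeg1. Qed.

Lemma free_homogM i j (f g : freealg2 k) :
  mhomog word_deg i f -> mhomog word_deg j g -> mhomog word_deg (i + j) (f * g).
Proof.
move=> fi gj w /msuppM_le [v [u [/fi <- /gj <- ->]]]; exact: word_degM.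
Qed.

Lemma free_homog1 : mhomog word_deg 0 (1 : freealg2 k).
Proof. by move=> w; rewrite msuppU1 inE => /eqP ->; exact: word_deg1. Qed.

Lemma free_homogy : mhomog word_deg 1 free_y.
Proof. by move=> w; rewrite msuppU1 inE => /eqP ->; rewrite /word_deg fdegU. Qed.

Lemma free_homogX i (f : freealg2 k) n :
  mhomog word_deg i f -> mhomog word_deg (i *+ n) (f ^+ n).
Proof.
move=> fi; elim: n => [|n IH]; first exact: free_homog1.
by rewrite exprS mulrS; exact: free_homogM.
Qed.

Lemma free_part_Ul n c v (g : freealg2 k) :
  mpart word_deg n (<< c *g v >> * g : freealg2 k) =
  (<< c *g v >> : freealg2 k) * mpart word_deg (n - word_deg v) g.
Proof.
elim/free_ind: g => [|f g IH IH'|d w]; first by rewrite mpart0 mulr0 mpart0.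
  by rewrite mulrDr !mpartD IH IH' mulrDr.
have hU (e : k) (u : {fmonom bool}) : mhomog word_deg (word_deg u) << e *g u >>.
  by move=> z /(fsubsetP msuppU_le); rewrite inE => /eqP ->.
rewrite free_mulUU !(mpart_homog _ (hU _ _)) word_degM.
by rewrite subr_eq addrC eq_sym; case: eqP => _; rewrite ?mulr0 ?free_mulUU.
Qed.

Lemma free_part_Ur n c v (g : freealg2 k) :
  mpart word_deg n (g * << c *g v >> : freealg2 k) =
  mpart word_deg (n - word_deg v) g * (<< c *g v >> : freealg2 k).
Proof.
elim/free_ind: g => [|f g IH IH'|d w]; first by rewrite mpart0 mul0r mpart0.
  by rewrite mulrDl !mpartD IH IH' mulrDl.
have hU (e : k) (u : {fmonom bool}) : mhomog word_deg (word_deg u) << e *g u >>.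
  by move=> z /(fsubsetP msuppU_le); rewrite inE => /eqP ->.
rewrite free_mulUU !(mpart_homog _ (hU _ _)) word_degM.
by rewrite subr_eq eq_sym; case: eqP => _; rewrite ?mul0r ?free_mulUU.
Qed.

Lemma ideal_part (g : freealg2 k) d : mhomog word_deg d g ->
  forall n x, in_ideal g x -> in_ideal g (mpart word_deg n x).
Proof.
move=> gd n x xI.
pose J (x : freealg2 k) := forall n, in_ideal g (mpart word_deg n x).
have J0 : J 0 by move=> m; rewrite mpart0; exact: in_ideal0.
have JD f h : J f -> J h -> J (f + h).
  by move=> Jf Jh m; rewrite mpartD; exact: in_idealD.
have JZ a f : J f -> J (a *: f).
  by move=> Jf m; rewrite mpartZ; exact: in_idealZ.
have Jr a z : J z -> J (z * a).
  move=> Jz; elim/free_ind: a => [|f h IH IH'|c v]; first by rewrite mulr0.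
    by rewrite mulrDr; exact: JD.
  by move=> m; rewrite free_part_Ur; exact: in_idealMr.
have Jl a z : J z -> J (a * z).
  move=> Jz; elim/free_ind: a => [|f h IH IH'|c v]; first by rewrite mul0r.
    by rewrite mulrDl; exact: JD.
  by move=> m; rewrite free_part_Ul; exact: in_idealMl.
have Jg : J g.
  move=> m; rewrite (mpart_homog _ gd); case: eqP => _; last exact: in_ideal0.
  exact: in_ideal_gen.
exact: (xI (Submodule J0 JD JZ) Jl Jr Jg n).
Qed.

Variable r : nat.

Definition B_rel : freealg2 k := free_y ^+ r.+1.

Lemma B_rel_homog : mhomog word_deg r.+1 B_rel.
Proof. by have := free_homogX (n := r.+1) free_homogy; rewrite natz. Qed.

Fact B_proper : ~ in_ideal B_rel 1.
Proof.
pose J (x : freealg2 k) := x@_mone = 0.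
have J0 : J 0 by rewrite /J mcoeff0.
have JD f h : J f -> J h -> J (f + h) by rewrite /J mcoeffD => -> ->; exact: addr0.
have JZ a f : J f -> J (a *: f) by rewrite /J mcoeffZ => ->; exact: mulr0.
have Jm (f h : freealg2 k) : (f * h)@_mone = f@_mone * h@_mone.
  exact: (rmorphM (mcoeff mone)).
have Jl a z : J z -> J (a * z) by rewrite /J Jm => ->; exact: mulr0.
have Jr a z : J z -> J (z * a) by rewrite /J Jm => ->; exact: mul0r.
have Jg : J B_rel.
  rewrite /J /B_rel exprS Jm [X in X * _](_ : _ = 0) ?mul0r //.
  by have /mhomogP -> := free_homogy; rewrite // word_deg1.
move=> /(_ (Submodule J0 JD JZ) Jl Jr Jg) /= /eqP.
by rewrite mcoeff1 eqxx oner_eq0.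
Qed.

(* k<x, y>/(y^(r+1)) *)
Definition B_alg : Type := quot_alg (principal_ideal B_proper).
HB.instance Definition _ := GRing.Algebra.on B_alg.

Definition B_deg (n : int) (b : B_alg) : Prop :=
  exists2 g, mhomog word_deg n g & b = quot_pi _ g.

Fact B_degP : is_grading B_deg.
Proof.
exact: (@qhomog_grading _ _ _ (principal_sub B_rel) (ideal_part B_rel_homog)).
Qed.
Fact B_degZ i (c : k) b : B_deg i b -> B_deg i (c *: b).
Proof.
case=> g gi ->; exists (c *: g); last exact: esym (quot_piZ _ _ _).
move/mhomogP: gi => gi; apply/mhomogP => w dw.
by rewrite mcoeffZ gi ?mulr0.
Qed.
Fact B_deg1 : B_deg 0 1.
Proof. by exists 1 => //; exact: free_homog1. Qed.
Fact B_degM i j a b : B_deg i a -> B_deg j b -> B_deg (i + j) (a * b).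
Proof.
case=> f fi -> [g gj ->]; exists (f * g); first exact: free_homogM.
exact: esym (alg_piM (principal_ideal B_proper) f g).
Qed.

Definition B : graded_algebra k :=
  GradedAlgebra B_degP B_degZ B_deg1 B_degM.
End AlgebraB.

Record quiver := Quiver {
  qvert : finType;
  qarrow : finType;
  qsrc : qarrow -> qvert;
  qtgt : qarrow -> qvert;
  qvert_gt0 : (0 < #|qvert|)%N
}.

Section PathAlgebra.
Variable Q : quiver.

Fixpoint is_walk (v : qvert Q) (s : seq (qarrow Q)) : bool :=
  if s is a :: s' then (qsrc a == v) && is_walk (qtgt a) s' else true.

Definition walk_end (v : qvert Q) (s : seq (qarrow Q)) : qvert Q :=
  last v [seq qtgt a | a <- s].

(* a path is given by its starting vertex and the sequence of its arrows in the
   order in which they are traversed *)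
Record qpath := QPath {
  pdata : qvert Q * seq (qarrow Q);
  pwalk : is_walk pdata.1 pdata.2
}.
HB.instance Definition _ := [isSub for pdata].
HB.instance Definition _ := [Choice of qpath by <:].

Definition pstart (p : qpath) : qvert Q := (pdata p).1.
Definition parrows (p : qpath) : seq (qarrow Q) := (pdata p).2.
Definition pend (p : qpath) : qvert Q := walk_end (pstart p) (parrows p).

Definition trivial_path (v : qvert Q) : qpath := @QPath (v, [::]) isT.

Lemma is_walk_cat v s s' :
  is_walk v (s ++ s') = is_walk v s && is_walk (walk_end v s) s'.
Proof. by elim: s v => //= a s IH v; rewrite IH andbA. Qed.

Lemma walk_end_cat v s s' :
  walk_end v (s ++ s') = walk_end (walk_end v s) s'.
Proof. by rewrite /walk_end map_cat last_cat. Qed.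

(* pq is "first p, then q" *)
Definition path_mul (p q : qpath) : option qpath :=
  if pend p == pstart q then insub (pstart p, parrows p ++ parrows q) else None.

Lemma path_mulP p q : pend p = pstart q ->
  exists u : qpath, [/\ path_mul p q = Some u, pstart u = pstart p,
    parrows u = parrows p ++ parrows q & pend u = pend q].
Proof.
move=> pq; have wpq : is_walk (pstart p) (parrows p ++ parrows q).
  by rewrite is_walk_cat (pwalk p) -/(pend p) pq (pwalk q).
exists (@QPath (_, _) wpq).
split=> //; first by rewrite /path_mul pq eqxx insubT.
by rewrite /pend /= [parrows _]/= [pstart _]/= walk_end_cat -/(pend p) pq.
Qed.

Lemma path_mul_size p q u : path_mul p q = Some u ->
  size (parrows u) = (size (parrows p) + size (parrows q))%N.
Proof.
have [pq|/negbTE pq] := eqVneq (pend p) (pstart q); last first.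
  by rewrite /path_mul pq.
have [w [+ _ wE _]] := path_mulP pq => -> [<-].
by rewrite wE size_cat.
Qed.

Lemma qpath_eq (p q : qpath) :
  pstart p = pstart q -> parrows p = parrows q -> p = q.
Proof.
move=> ps pa; apply: val_inj; move: ps pa; rewrite /pstart /parrows /=.
by case: (pdata p) => ? ?; case: (pdata q) => ? ? /= -> ->.
Qed.

Fact path_mulA (x y z : qpath) : obind (path_mul x) (path_mul y z) =
  obind (fun u => path_mul u z) (path_mul x y).
Proof.
have noneP (p q : qpath) : pend p != pstart q -> path_mul p q = None.
  by rewrite /path_mul => /negbTE ->.
have [xy|xy] := eqVneq (pend x) (pstart y); last first.
  rewrite (noneP _ _ xy) /=; have [yz|yz] := eqVneq (pend y) (pstart z).
    have [u [-> us _ _]] := path_mulP yz; rewrite /= noneP // us.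
    exact: xy.
  by rewrite (noneP _ _ yz).
have [u [-> us ua ue]] := path_mulP xy; rewrite /=.
have [yz|yz] := eqVneq (pend y) (pstart z); last first.
  by rewrite !noneP // ue.
have [v [-> vs va ve]] := path_mulP yz; rewrite /=.
have [] : pend x = pstart v by rewrite vs.
move=> /path_mulP [w [-> ws wa _]].
have : pend u = pstart z by rewrite ue.
move=> /path_mulP [w' [-> ws' wa' _]]; congr Some; apply: qpath_eq.
  by rewrite ws ws'.
by rewrite wa wa' va ua catA.
Qed.

Definition path_one : seq qpath := [seq trivial_path v | v <- enum (qvert Q)].

Lemma path_mul_triviall v (x : qpath) :
  path_mul (trivial_path v) x = if v == pstart x then Some x else None.
Proof.
rewrite {1}/path_mul; case: eqP => // vx.
have [u [+ us ua _]] := @path_mulP (trivial_path v) x vx.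
rewrite /path_mul vx eqxx => ->; congr Some; apply: qpath_eq => //.
by rewrite us -vx.
Qed.

Lemma path_mul_trivialr v (x : qpath) :
  path_mul x (trivial_path v) = if v == pend x then Some x else None.
Proof.
rewrite {1}/path_mul eq_sym; case: eqP => // vx.
have [u [+ us ua _]] := @path_mulP x (trivial_path v) (esym vx).
rewrite /path_mul vx eqxx => ->; congr Some; apply: qpath_eq => //.
by rewrite ua cats0.
Qed.

Lemma pmap_if_eq (v : qvert Q) (x : qpath) (s : seq (qvert Q)) : uniq s ->
  v \in s -> pmap (fun w => if w == v then Some x else None) s = [:: x].
Proof.
have none u : v \notin u -> pmap (fun w => if w == v then Some x else None) u = [::].
  elim: u => //= w u IH; rewrite inE negb_or eq_sym => /andP[/negbTE -> /IH].
  by [].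
elim: s => //= w s IH /andP[ws us]; rewrite inE eq_sym.
by case: eqVneq => [wv _|_ /IH ->] //=; rewrite none // -wv.
Qed.

Fact path_mul1l x : pmap (fun e => path_mul e x) path_one = [:: x].
Proof.
rewrite /path_one -(@pmap_if_eq (pstart x) x (enum (qvert Q))) ?enum_uniq ?mem_enum //.
by elim: (enum _) => //= v s ->; rewrite path_mul_triviall.
Qed.
Fact path_mul1r x : pmap (path_mul x) path_one = [:: x].
Proof.
rewrite /path_one -(@pmap_if_eq (pend x) x (enum (qvert Q))) ?enum_uniq ?mem_enum //.
by elim: (enum _) => //= v s ->; rewrite path_mul_trivialr.
Qed.
Fact path_one_uniq : uniq path_one.
Proof. by rewrite map_inj_uniq ?enum_uniq // => v w [->]. Qed.
Fact path_one_neq : path_one != [::].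
Proof. by rewrite -size_eq0 size_map -cardE -lt0n qvert_gt0. Qed.

HB.instance Definition _ := isPartialMonoid.Build qpath
  path_mulA path_mul1l path_mul1r path_one_uniq path_one_neq.

Variable k : fieldType.

Definition path_deg (p : qpath) : int := (size (parrows p))%:Z.

Definition path_homog (n : int) (f : pmalg k qpath) : Prop :=
  mhomog path_deg n f.

Fact path_homogP : is_grading path_homog.
Proof. exact: mhomog_grading. Qed.
Fact path_homogZ i (c : k) f : path_homog i f -> path_homog i (c *: f).
Proof.
move/mhomogP => fi; apply/mhomogP => w dw; by rewrite mcoeffZ fi ?mulr0.
Qed.

Lemma path_homog_sum I (s : seq I) (P : I -> bool) n (F : I -> pmalg k qpath) :
  (forall i, P i -> path_homog n (F i)) -> path_homog n (\sum_(i <- s | P i) F i).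
Proof.
have [h0 hB _ _] := path_homogP.
move=> FH; elim/big_rec: _ => [|i f Pi fn]; first exact: h0.
rewrite -[f]opprK -[- f]sub0r; apply: (hB n); first exact: FH.
by apply: hB => //; exact: h0.
Qed.

Lemma path_homogU (c : k) (p : qpath) :
  path_homog (path_deg p) (<< c *g p >> : pmalg k qpath).
Proof. by move=> z /(fsubsetP msuppU_le); rewrite inE => /eqP ->. Qed.

Fact path_homog1 : path_homog 0 1.
Proof.
rewrite /1%R /= /pm_one /pone /= big_map; apply: path_homog_sum => v _.
exact: path_homogU.
Qed.
Fact path_homogM i j f g :
  path_homog i f -> path_homog j g -> path_homog (i + j) (f * g).
Proof.
move=> fi gj; rewrite pm_mulE /pm_mul big_seq.
apply: path_homog_sum => p /fi <-; rewrite big_seq.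
apply: path_homog_sum => q /gj <-.
have [h0 _ _ _] := path_homogP.
case E: (pmul p q) => [u|] /=; last exact: h0.
have <- : path_deg u = path_deg p + path_deg q.
  by rewrite /path_deg (path_mul_size E) PoszD.
exact: path_homogU.
Qed.

(* the path algebra kQ, graded by path length *)
Definition path_algebra : graded_algebra k :=
  GradedAlgebra path_homogP path_homogZ path_homog1 path_homogM.
End PathAlgebra.

Section QuiverQ.
Variable r : nat.

(* the vertices 1, ..., r+1 are numbered from 0 here; inl i is the arrow x_i
   and inr i is the arrow y_i *)
Definition Q_arrow : finType := ('I_r.+1 + 'I_r)%type.

Definition Q_src (a : Q_arrow) : 'I_r.+1 :=
  match a with inl i => i | inr i => widen_ord (leqnSn r) i end.

Definition Q_tgt (a : Q_arrow) : 'I_r.+1 :=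
  match a with inl _ => ord0 | inr i => lift ord0 i end.

Fact Q_vert_gt0 : (0 < #|'I_r.+1|)%N.
Proof. by rewrite card_ord. Qed.

Definition Q : quiver := @Quiver 'I_r.+1 Q_arrow Q_src Q_tgt Q_vert_gt0.
End QuiverQ.

Section LaurentQuotient.
Variable f : laurent.

Definition multiple_of (g : laurent) : Prop := exists h : laurent, g = h * f.

Fact multiple_of0 : multiple_of 0.
Proof. by exists 0; rewrite mul0r. Qed.
Fact multiple_ofD g h : multiple_of g -> multiple_of h -> multiple_of (g + h).
Proof. by case=> a -> [b ->]; exists (a + b); rewrite mulrDl. Qed.
Fact multiple_ofZ (a g : laurent) : multiple_of g -> multiple_of (a * g).
Proof. by case=> b ->; exists (a * b); rewrite mulrA. Qed.

(* the ideal (f) of Z[t, t^-1] *)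
Definition laurent_ideal : submodule (laurent^o : lmodType laurent) :=
  @Submodule laurent laurent^o multiple_of multiple_of0 multiple_ofD
    multiple_ofZ.

Definition laurent_quot : bigmod laurent :=
  bigmod_of_lmod (quot_mod laurent_ideal).

Definition laurent_class (g : laurent) : laurent_quot :=
  quot_pi laurent_ideal g.
End LaurentQuotient.

(* 1 - t - ... - t^(r+1) *)
Definition f_poly (r : nat) : laurent :=
  1 - \sum_(1 <= i < r.+2) laurent_t ^+ i.

(* Main.v *)
From HB Require Import structures.
From mathcomp Require Import all_boot all_order all_algebra finmap zify ring.
From mathcomp.classical Require Import boolp.
From mathcomp.multinomials Require Import monalg.
Require Import Defs.

(** Both Grothendieck groups are computed, by the same argument. Put
    [f = 1 - t - ... - t^(r+1)]. In [B] let [e = 1] and [w_i = y^i]; in [kQ] let [e]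
    be the trivial path at the first vertex, [x] the sum of all arrows [x_j], and
    [w_i] the path made of the first [i] arrows [y]. In either algebra [D] the
    products [w_i x], for [0 <= i <= r], generate a free algebra [C], in which
    [w_i x] has degree [i + 1], so that [C] has Hilbert series [1/f]; and [e D] is
    a free left [C]-module on [w_0, ..., w_r]. The record [tail_data] isolates
    these properties, and everything up to [K0_qgr_iso] is derived from it;
    [B_tail_data] and [Q_tail_data] verify it on words and on paths.

    In high degrees a finitely presented module [M] inherits the freeness: [e M]
    is there a free [C]-module ([fp_tail]). If the [u_s] form a basis of it, then
    the [x u_s] generate a free [D]-submodule of finite codimension in [M]
    ([frame_inj], [frame_span]), because the [e]-part of [D x u_s] is the sum of
    the [C w_i x u_s]. Hence every object of [qgr D] is a finite sum of twists of
    the structure sheaf [O] ([free_resolution]), and its class is a multiple of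
    that of [O] ([K0_cyclic]). For [M = D] and the basis [w_0, ..., w_r] this
    reads [[O] = (t + ... + t^(r+1)) [O]], so that [f] annihilates [[O]]
    ([K0_relation]).

    There are no further relations, because of the additive invariant [chi]. The
    dimensions [d n] of the [e]-parts [e M_n] satisfy
    [d n = d (n-1) + ... + d (n-r-1)] for large [n], so that the series of
    [d n t^n] from a large degree on is a Laurent polynomial divided by [f]. This
    polynomial modulo [f] is independent of the starting degree, and [chi M] is
    [t] times it; then [chi O = 1] ([chi_structure_sheaf]).

    Additivity of [chi] concerns exact sequences of the localization
    ([chi_additive]). A zigzag defines a linear relation between the degree [n]
    parts of its ends, which for large [n] is a map that only depends on the
    morphism of [qgr D] ([zz_rel_sound]) and determines it ([loc_faithful]). The
    latter holds since a zigzag that starts at a free module with generators in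
    high degrees equals an honest morphism ([zz_lift]). Kernels and cokernels of
    [qgr D] can thus be examined in high degrees. *)

Set Implicit Arguments.
Unset Strict Implicit.
Unset Printing Implicit Defensive.

Import GRing.Theory Order.TTheory Num.Theory.

Local Open Scope ring_scope.

(** * Homogeneous components *)

Section Grading.
Variables (V : zmodType) (G : int -> V -> Prop) (GP : is_grading G).

Lemma gr0 i : G i 0. Proof. by case: GP. Qed.
Lemma grB i x y : G i x -> G i y -> G i (x - y).
Proof. by case: GP => _ + _ _; exact. Qed.
Lemma grN i x : G i x -> G i (- x).
Proof. by rewrite -sub0r; apply: grB; exact: gr0. Qed.
Lemma grD i x y : G i x -> G i y -> G i (x + y).
Proof. by move=> xi /grN; rewrite -{2}[y]opprK; exact: grB. Qed.
Lemma gr_sum i I (s : seq I) (P : pred I) (F : I -> V) :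
  (forall j, P j -> G i (F j)) -> G i (\sum_(j <- s | P j) F j).
Proof. by move=> GF; elim/big_rec: _ => [|j x Pj]; [exact: gr0|apply/grD/GF]. Qed.

Fact hpart_ex x : exists sF : seq int * (int -> V),
  [/\ uniq sF.1, forall i, G i (sF.2 i) & x = \sum_(i <- sF.1) sF.2 i].
Proof. by case: GP => _ _ /(_ x) [s [F sFP]] _; exists (s, F). Qed.

Definition hpart (i : int) (x : V) : V :=
  let sF := sval (cid (hpart_ex x)) in if i \in sF.1 then sF.2 i else 0.

Lemma hpart_homog i x : G i (hpart i x).
Proof.
by rewrite /hpart; case: cid => -[s F] /= [_ GF _]; case: ifP => // _; exact: gr0.
Qed.

Definition covers (s : seq int) (x : V) :=
  uniq s /\ forall i, i \notin s -> hpart i x = 0.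

Lemma sum_supp (s t : seq int) (F : int -> V) : uniq s -> uniq t ->
  {subset s <= t} -> (forall i, i \notin s -> F i = 0) ->
  \sum_(i <- t) F i = \sum_(i <- s) F i.
Proof.
move=> us ut st F0; rewrite (bigID (fun i => i \in s)) /= [X in _ + X]big1 ?addr0 //.
rewrite -big_filter; apply/perm_big/uniq_perm; rewrite ?filter_uniq // => i.
by rewrite mem_filter; case: (boolP (i \in s)) => // /st ->.
Qed.

Lemma covers_sum s x : covers s x -> x = \sum_(i <- s) hpart i x.
Proof.
case=> us s0; rewrite {1}(_ : x = \sum_(i <- undup
  ((sval (cid (hpart_ex x))).1 ++ s)) hpart i x).
  apply: sum_supp => //; first exact: undup_uniq.
  by move=> i si; rewrite mem_undup mem_cat si orbT.
rewrite /hpart; case: cid => -[t F] /= [ut GF xE]; rewrite {1}xE.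
rewrite (@sum_supp t _ _ ut (undup_uniq (t ++ s))).
- by apply: eq_big_seq => i ->.
- by move=> i ti; rewrite mem_undup mem_cat ti.
- by move=> i /negbTE ->.
Qed.

Lemma covers_ex x : exists s, covers s x.
Proof.
exists (sval (cid (hpart_ex x))).1; rewrite /covers /hpart.
by case: cid => -[s F] /= [us _ _]; split=> // i /negbTE ->.
Qed.

Lemma covers_sub s t x : covers s x -> uniq t -> {subset s <= t} -> covers t x.
Proof. by case=> us s0 ut st; split=> // i it; apply: s0; apply: contra it; exact: st. Qed.

(** The parts are chosen classically; this makes them independent of the choice. *)
Lemma hpart_uniq (s : seq int) (F : int -> V) x i : uniq s ->
  (forall j, G j (F j)) -> (forall j, j \notin s -> F j = 0) ->
  x = \sum_(j <- s) F j -> hpart i x = F i.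
Proof.
move=> us GF F0 xE; have [t tx] := covers_ex x.
set u := undup (s ++ t).
have uu : uniq u by exact: undup_uniq.
have su : {subset s <= u} by move=> j; rewrite mem_undup mem_cat => ->.
have tu : {subset t <= u} by move=> j; rewrite mem_undup mem_cat orbC => ->.
have ux : covers u x by exact: covers_sub tx _ _.
have e0 : \sum_(j <- u) (hpart j x - F j) = 0.
  by rewrite sumrB -(covers_sum ux) (sum_supp us) // -xE subrr.
have [iu|iu] := boolP (i \in u); last first.
  by case: ux => _ -> //; rewrite F0 //; apply: contra iu; exact: su.
case: GP => _ _ _ /(_ u _ uu) /(_ _ e0 i iu) H; apply/subr0_eq/H => j.
by apply: grB => //; exact: hpart_homog.
Qed.

Lemma hpartD i x y : hpart i (x + y) = hpart i x + hpart i y.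
Proof.
have [s sx] := covers_ex x; have [t ty] := covers_ex y.
set u := undup (s ++ t).
have uu : uniq u by exact: undup_uniq.
have ux : covers u x.
  by apply: covers_sub sx _ _ => // j; rewrite mem_undup mem_cat => ->.
have uy : covers u y.
  by apply: covers_sub ty _ _ => // j; rewrite mem_undup mem_cat orbC => ->.
apply: (@hpart_uniq u (fun j => hpart j x + hpart j y)) => //.
- by move=> j; apply: grD; exact: hpart_homog.
- by move=> j ju; case: ux uy => _ -> // [_ ->]; rewrite ?addr0.
- by rewrite big_split /= -!covers_sum.
Qed.

Lemma hpart_id i j x : G j x -> hpart i x = if i == j then x else 0.
Proof.
move=> xj; apply: (@hpart_uniq [:: j] (fun i => if i == j then x else 0)) => //.
- by move=> l; case: eqP => [->|_] //; exact: gr0.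
- by move=> l; rewrite inE => /negbTE ->.
- by rewrite big_seq1 eqxx.
Qed.

Lemma hpart0 i : hpart i 0 = 0.
Proof. by rewrite (hpart_id i (gr0 i)) eqxx. Qed.

Lemma hpart_sum i I (s : seq I) (P : pred I) (F : I -> V) :
  hpart i (\sum_(j <- s | P j) F j) = \sum_(j <- s | P j) hpart i (F j).
Proof. exact: (big_morph (hpart i) (hpartD i) (hpart0 i)). Qed.

Lemma hpart_eq0 x : (forall i, hpart i x = 0) -> x = 0.
Proof.
by move=> x0; have [s /covers_sum ->] := covers_ex x; rewrite big1.
Qed.
End Grading.

(** Acting by a homogeneous scalar, acting on a homogeneous vector and applying a
    morphism are all homogeneous additive maps, so they commute with taking parts. *)
Lemma hpart_morph (V W : zmodType) (G : int -> V -> Prop) (H : int -> W -> Prop)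
    (GP : is_grading G) (HP : is_grading H) (d : int) (f : V -> W) :
  {morph f : x y / x + y} -> (forall i x, G i x -> H (d + i) (f x)) ->
  forall i x, hpart HP (d + i) (f x) = f (hpart GP i x).
Proof.
move=> fD fG i x; have f0 : f 0 = 0 by apply: (addrI (f 0)); rewrite -fD !addr0.
have [s sx] := covers_ex GP x; rewrite {1}(covers_sum sx).
rewrite (big_morph f fD f0) hpart_sum.
under eq_bigr => j _ do rewrite (hpart_id HP _ (fG _ _ (hpart_homog GP j x))).
have [us s0] := sx; have [si|si] := boolP (i \in s).
  rewrite (bigD1_seq i) //= eqxx big1 ?addr0 // => j ji.
  by case: eqP => // /addrI ij; rewrite ij eqxx in ji.
rewrite s0 // f0 big1_seq // => j /= sj; case: eqP => // /addrI ij.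
by rewrite ij sj in si.
Qed.

(** * Dimensions of subspaces *)

Section Dim.
Variables (k : fieldType) (D : algType k) (M : lmodType D).
Implicit Types (x y : M) (P Q : M -> Prop).

Definition kscale (c : k) x : M := (c%:A : D) *: x.

Lemma kscaleDr c x y : kscale c (x + y) = kscale c x + kscale c y. Proof. exact: scalerDr. Qed.
Lemma kscaleDl c d x : kscale (c + d) x = kscale c x + kscale d x.
Proof. by rewrite /kscale scalerDl scalerDl. Qed.
Lemma kscaleA c d x : kscale c (kscale d x) = kscale (c * d) x.
Proof. by rewrite /kscale scalerA -scalerAl mul1r scalerA. Qed.
Lemma kscale1 x : kscale 1 x = x. Proof. by rewrite /kscale !scale1r. Qed.
Lemma kscale0 c : kscale c 0 = 0. Proof. exact: scaler0. Qed.
Lemma kscale0l x : kscale 0 x = 0. Proof. by rewrite /kscale !scale0r. Qed.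
Lemma kscaleN1 x : kscale (-1) x = - x.
Proof. by rewrite /kscale scaleN1r scaleNr scale1r. Qed.
Lemma kscale_sumr c I (s : seq I) (R : pred I) (F : I -> M) :
  kscale c (\sum_(i <- s | R i) F i) = \sum_(i <- s | R i) kscale c (F i).
Proof. exact: (big_morph (kscale c) (kscaleDr c) (kscale0 c)). Qed.
Lemma kscale_suml x I (s : seq I) (R : pred I) (F : I -> k) :
  kscale (\sum_(i <- s | R i) F i) x = \sum_(i <- s | R i) kscale (F i) x.
Proof. exact: (big_morph (kscale^~ x) (fun a b => kscaleDl a b x) (kscale0l x)). Qed.
Lemma kscale_scale c (a : D) x : kscale c (a *: x) = a *: kscale c x.
Proof. by rewrite /kscale !scalerA -scalerAl mul1r -scalerAr mulr1. Qed.
Lemma scale_kscale c (a : D) x : (c *: a) *: x = a *: kscale c x.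
Proof. by rewrite /kscale scalerA -scalerAr mulr1. Qed.

Definition subspace P := P 0 /\ forall c x y, P x -> P y -> P (kscale c x + y).

Lemma subspace_sum P I (s : seq I) (R : pred I) (c : I -> k) (F : I -> M) :
  subspace P -> (forall i, R i -> P (F i)) ->
  P (\sum_(i <- s | R i) kscale (c i) (F i)).
Proof.
by case=> P0 PD PF; elim/big_rec: _ => [//|i x Ri]; apply: PD; exact: PF.
Qed.

Definition kindep (I : finType) (b : I -> M) :=
  forall c : I -> k, \sum_i kscale (c i) (b i) = 0 -> forall i, c i = 0.

Definition kbasis P (I : finType) (b : I -> M) :=
  (forall x, P x <-> exists c : I -> k, x = \sum_i kscale (c i) (b i)) /\ kindep b.

Definition kdim P (n : nat) :=
  exists (I : finType) (b : I -> M), kbasis P b /\ #|I| = n.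

Lemma kbasis_in P (I : finType) (b : I -> M) i : kbasis P b -> P (b i).
Proof.
case=> bP _; apply/bP; exists (fun j => (j == i)%:R).
rewrite (bigD1 i) //= eqxx kscale1 big1 ?addr0 // => j /negbTE ->.
exact: kscale0l.
Qed.

(** The coordinate matrix of an independent family has no row kernel, so its rank
    is its number of rows, which is at most its number of columns. *)
Lemma kindep_le (I J : finType) (b : I -> M) (b' : J -> M) : kindep b ->
  (forall i, exists c : J -> k, b i = \sum_j kscale (c j) (b' j)) -> (#|I| <= #|J|)%N.
Proof.
move=> bI /choice [A bE].
pose B := \matrix_(i < #|I|, j < #|J|) A (enum_val i) (enum_val j).
suff /eqP <- : row_free B by exact: rank_leq_col.
rewrite -kermx_eq0; apply/eqP/row_matrixP => l; rewrite row0.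
set u := row l _; have uB : u *m B = 0 by rewrite -row_mul mulmx_ker row0.
apply/rowP => i; rewrite [RHS]mxE -[i]enum_valK.
apply: (bI (fun i => u ord0 (enum_rank i))).
under eq_bigr => s _.
  rewrite bE kscale_sumr; under eq_bigr => j _ do rewrite kscaleA.
  over.
rewrite exchange_big big1 // => j _; rewrite -kscale_suml.
rewrite [X in kscale X](_ : _ = (u *m B) ord0 (enum_rank j)); first by rewrite uB mxE kscale0l.
rewrite mxE (reindex (@enum_val I predT)) /=; last first.
  by exists enum_rank => s _; rewrite ?enum_valK ?enum_rankK.
by apply: eq_bigr => s _; rewrite !mxE enum_valK enum_rankK.
Qed.

Lemma kdim_uniq P m n : kdim P m -> kdim P n -> m = n.
Proof.
case=> I [b [bP <-]] [J [b' [b'P <-]]]; apply/eqP; rewrite eqn_leq.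
apply/andP; split; [apply: (kindep_le bP.2)|apply: (kindep_le b'P.2)] => i.
  by apply/b'P.1; exact: kbasis_in bP.
by apply/bP.1; exact: kbasis_in b'P.
Qed.

Lemma kdim_ext P Q n : (forall x, P x <-> Q x) -> kdim P n -> kdim Q n.
Proof.
move=> PQ [I [b [[bP bI] In]]]; exists I, b; split=> //; split=> // x.
by rewrite -PQ.
Qed.

Lemma kdim0 : kdim (fun x => x = 0) 0.
Proof.
exists void, (of_void _); split; last by rewrite card_void.
split=> [x|c _ []]; split=> [->|[c ->]].
  by exists (of_void _); rewrite big1 // => -[].
by rewrite big1 // => -[].
Qed.

Lemma kdim_line x : x <> 0 -> kdim (fun y => exists c, y = kscale c x) 1.
Proof.
move=> x0; exists unit, (fun=> x); split; last by rewrite card_unit.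
split=> [y|c]; last first.
  rewrite (big_pred1 tt) => [|[] //] cx [].
  case: (eqVneq (c tt) 0) => // c0; case: x0.
  by rewrite -[x]kscale1 -(mulVf c0) -kscaleA cx kscale0.
split=> [[c ->]|[c ->]]; first by exists (fun=> c); rewrite (big_pred1 tt) => // -[].
by exists (c tt); rewrite (big_pred1 tt) => // -[].
Qed.

(** Greedy choice: an element is kept unless it lies in the span of the elements
    kept so far. Working modulo [Z] serves to find generators of a free module as
    a basis modulo the decomposable elements. *)
Lemma extract_basis (Z : M -> Prop) (L : seq M) : subspace Z ->
  exists (n : nat) (b : 'I_n -> M),
  [/\ forall i, b i \in L,
      forall x, x \in L -> exists c z, Z z /\ x = z + \sum_i kscale (c i) (b i) &
      forall c : 'I_n -> k, Z (\sum_i kscale (c i) (b i)) -> forall i, c i = 0].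
Proof.
move=> ZS; elim: L => [|a L [n [b [bL Lb bI]]]].
  by exists 0%N, (fun=> 0); split=> // [[]|c _ []].
have [[c [z [Zz aE]]]|aI] :=
    EM (exists c z, Z z /\ a = z + \sum_i kscale (c i) (b i)).
  exists n, b; split=> [i|x|//]; first by rewrite inE bL orbT.
  by rewrite inE => /orP[/eqP ->|/Lb //]; exists c, z.
exists n.+1, (fun i => oapp b a (unlift ord0 i)); split=> [i|x|c].
- by case: unliftP => [j|] _ /=; rewrite inE ?eqxx // bL orbT.
- have E c : \sum_i kscale (c i) (oapp b a (unlift ord0 i)) =
      kscale (c ord0) a + \sum_i kscale (c (lift ord0 i)) (b i).
    rewrite big_ord_recl unlift_none /=; congr (_ + _).
    by apply: eq_bigr => i _; rewrite liftK.
  rewrite inE => /orP[/eqP ->|/Lb [c [z [Zz ->]]]].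
    exists (fun i => (i == ord0)%:R), 0; split; first by case: ZS.
    by rewrite E eqxx kscale1 big1 ?addr0 ?add0r // => i _; rewrite kscale0l.
  exists (fun i => oapp c 0 (unlift ord0 i)), z; split=> //.
  rewrite E unlift_none /= kscale0l add0r; congr (_ + _).
  by apply: eq_bigr => i _; rewrite liftK.
rewrite big_ord_recl unlift_none /=.
under eq_bigr => i _ do rewrite liftK /=.
have [c0|c0] := eqVneq (c ord0) 0; last first.
  move=> Zc; case: aI; pose d := - (c ord0)^-1.
  exists (fun i => d * c (lift ord0 i)), (kscale (- d) (kscale (c ord0) a +
    \sum_(i < n) kscale (c (lift ord0 i)) (b i))); split.
    by rewrite -[kscale _ _]addr0; case: ZS => Z0; apply.
  rewrite kscaleDr kscaleA /d opprK mulVf // kscale1 kscale_sumr -addrA -big_split /=.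
  rewrite big1 ?addr0 // => i _.
  by rewrite !kscaleA -kscaleDl -mulrDl addrN mul0r kscale0l.
rewrite c0 kscale0l add0r => /bI H i.
by case: (unliftP ord0 i) => [j ->|->].
Qed.

Lemma kdim_ex P (L : seq M) : subspace P -> (forall x, x \in L -> P x) ->
  (forall x, P x -> exists c : nat -> k, x = \sum_(i < size L) kscale (c i) L`_i) ->
  exists n, kdim P n.
Proof.
move=> PS LP PL; have ZS : subspace (fun x => x = 0).
  by split=> // c x y -> ->; rewrite kscale0 addr0.
have [n [b [bL Lb bI]]] := extract_basis L ZS.
exists n, 'I_n, b; split; last by rewrite card_ord.
split=> // x; split=> [/PL [c ->]|[c ->]]; last first.
  by apply: subspace_sum => // i _; exact: LP.
have /choice [d dP] (i : 'I_(size L)) : exists d, L`_i = \sum_j kscale (d j) (b j).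
  have /Lb [d [z [-> E]]] : L`_i \in L by exact: mem_nth.
  by exists d; rewrite E add0r.
exists (fun j => \sum_(i < size L) c i * d i j).
under eq_bigr => i _ do rewrite dP kscale_sumr.
rewrite exchange_big; apply: eq_bigr => j _; rewrite kscale_suml.
by apply: eq_bigr => i _; rewrite kscaleA.
Qed.

(** With [a j = w_j x] this expresses the dimension of [e M] in a high degree by
    the dimensions in the [r + 1] preceding degrees. *)
Lemma kdim_dsum (J : finType) (Q : J -> M -> Prop) (a : J -> D) (n : J -> nat) P :
  (forall j, kdim (Q j) (n j)) ->
  (forall y, P y <-> exists u, (forall j, Q j (u j)) /\ y = \sum_j a j *: u j) ->
  (forall u, (forall j, Q j (u j)) -> \sum_j a j *: u j = 0 -> forall j, u j = 0) ->
  kdim P (\sum_j n j).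
Proof.
move=> Qn PE Pinj.
have bex (j : J) : exists b : 'I_(n j) -> M, kbasis (Q j) b.
  have [I [b [[bP bI] <-]]] := Qn j; exists (fun i => b (enum_val i)).
  have R (F : I -> M) : \sum_i F i = \sum_(i < #|I|) F (enum_val i).
    rewrite (reindex (@enum_val I predT)) //=.
    by exists enum_rank => s _; rewrite ?enum_valK ?enum_rankK.
  split=> [x|c c0 i].
    rewrite bP; split=> [[c ->]|[c ->]].
      by exists (fun i => c (enum_val i)); rewrite R.
    exists (fun i => c (enum_rank i)); rewrite R.
    by apply: eq_bigr => i _; rewrite enum_valK.
  rewrite -[i]enum_valK; apply: (bI (fun i => c (enum_rank i))).
  by rewrite R -{}[RHS]c0; apply: eq_bigr => l _; rewrite enum_valK.
pose b j := sval (cid (bex j)); have bP j : kbasis (Q j) (b j) by exact: svalP (cid (bex j)).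
pose T := {j : J & 'I_(n j)}; pose tg j i : T := existT _ j i.
have sumT (F : T -> M) : \sum_(t : T) F t = \sum_j \sum_(i < n j) F (tg _ i).
  by rewrite sig_big_dep; apply: eq_bigr => -[].
exists T, (fun t => a (tag t) *: b (tag t) (tagged t)); split; last first.
  by rewrite card_tagged sumnE big_map big_enum; apply: eq_bigr => j _; rewrite card_ord.
have E c : \sum_(t : T) kscale (c t) (a (tag t) *: b (tag t) (tagged t)) =
    \sum_j a j *: \sum_(i < n j) kscale (c (tg _ i)) (b j i).
  rewrite sumT; apply: eq_bigr => j _; rewrite scaler_sumr.
  by apply: eq_bigr => i _; rewrite kscale_scale.
split=> [y|c]; last first.
  rewrite E => /Pinj c0 [j i].
  apply: ((bP j).2 (fun i => c (tg j i)) _ i); apply: c0 => l.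
  by apply/(bP l).1; exists (fun i => c (tg _ i)).
rewrite PE; split=> [[u [uQ ->]]|[c ->]].
  have cex (j : J) : exists c : 'I_(n j) -> k, u j = \sum_i kscale (c i) (b j i).
    exact/(bP j).1.
  pose c j := sval (cid (cex j)).
  have cP j : u j = \sum_i kscale (c j i) (b j i) by exact: svalP (cid (cex j)).
  exists (fun t : T => c (tag t) (tagged t)); rewrite E.
  by apply: eq_bigr => j _; rewrite cP.
exists (fun j => \sum_(i < n j) kscale (c (tg _ i)) (b j i)); split=> // j.
by apply/(bP j).1; exists (fun i => c (tg _ i)).
Qed.
End Dim.

(** Short exact sequences of spaces are given by relations, because morphisms of
    a localization are only functional in high degrees. *)
Lemma kdim_exact (k : fieldType) (D : algType k) (M' M M'' : lmodType D)
    (P' : M' -> Prop) (P : M -> Prop) (P'' : M'' -> Prop)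
    (F : M' -> M -> Prop) (G : M -> M'' -> Prop) (n' n'' : nat) :
  kdim P' n' -> kdim P'' n'' -> subspace P ->
  F 0 0 -> (forall c x x' y y', F x y -> F x' y' -> F (kscale c x + x') (kscale c y + y')) ->
  G 0 0 -> (forall c x x' y y', G x y -> G x' y' -> G (kscale c x + x') (kscale c y + y')) ->
  (forall x, P' x -> exists2 y, P y & F x y) ->
  (forall x, P' x -> F x 0 -> x = 0) ->
  (forall x y y', P' x -> F x y -> F x y' -> y = y') ->
  (forall x, P x -> exists2 y, P'' y & G x y) ->
  (forall x y y', P x -> G x y -> G x y' -> y = y') ->
  (forall y, P'' y -> exists2 x, P x & G x y) ->
  (forall x y, P' x -> F x y -> G y 0) ->
  (forall y, P y -> G y 0 -> exists2 x, P' x & F x y) ->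
  kdim P (n' + n'').
Proof.
move=> [I [b [bP <-]]] [J [d [dP <-]]] PS F0 FD G0 GD Ft Finj Ff Gt Gf Gs FG Gex.
have /choice [f fP] i : exists y, P y /\ F (b i) y.
  by have [y Py Fy] := Ft _ (kbasis_in i bP); exists y.
have /choice [g gP] j : exists y, P y /\ G y (d j).
  by have [y Py Gy] := Gs _ (kbasis_in j dP); exists y.
have sumF (c : I -> k) : F (\sum_i kscale (c i) (b i)) (\sum_i kscale (c i) (f i)).
  by elim/big_rec2: _ => // i x y _ xy; apply: FD => //; case: (fP i).
have sumG (c : J -> k) : G (\sum_i kscale (c i) (g i)) (\sum_i kscale (c i) (d i)).
  by elim/big_rec2: _ => // i x y _ xy; apply: GD => //; case: (gP i).
have GB x x' y y' : G x y -> G x' y' -> G (x - x') (y - y').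
  by move=> xy xy'; have := GD (-1) _ _ _ _ xy' xy; rewrite !kscaleN1 ![- _ + _]addrC.
have Psum (K : finType) (h : K -> M) (c : K -> k) :
    (forall i, P (h i)) -> P (\sum_i kscale (c i) (h i)).
  by move=> hP; exact: subspace_sum.
have P'sum (c : I -> k) : P' (\sum_i kscale (c i) (b i)) by apply/bP.1; exists c.
exists (I + J)%type, (fun t => match t with inl i => f i | inr j => g j end).
split; last by rewrite card_sum.
split=> [y|c]; last first.
  rewrite big_sumType /= => c0.
  have cJ j : c (inr j) = 0.
    apply: (dP.2 (fun j => c (inr j))); apply: (Gf _ _ 0) (sumG _) _.
      by apply: Psum => j'; case: (gP j').
    move: c0 => /(canRL (addKr _)) ->; rewrite addr0.
    have := FG _ _ (P'sum _) (sumF (fun i => c (inl i))).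
    by move=> /(GB _ _ _ _ G0); rewrite !sub0r oppr0.
  case=> [i|//]; apply: (bP.2 (fun i => c (inl i))); apply: Finj => //.
  move: c0; rewrite [X in _ + X]big1 ?addr0 => [c0|j _]; last by rewrite cJ kscale0l.
  by rewrite -c0; exact: sumF.
split=> [Py|[c ->]]; last first.
  by apply: Psum => -[i|j]; [case: (fP i)|case: (gP j)].
have [z /dP.1 [c ->] Gy] := Gt _ Py.
have := GB _ _ _ _ Gy (sumG c); rewrite subrr.
have Pg : P (\sum_i kscale (c i) (g i)) by apply: Psum => j; case: (gP j).
have PB : P (y - \sum_i kscale (c i) (g i)).
  by case: PS => _ /(_ (-1) _ _ Pg Py); rewrite kscaleN1 addrC.
move=> /(Gex _ PB) [x /bP.1 [e ->] Fx].
exists (fun t => match t with inl i => e i | inr j => c j end).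
rewrite big_sumType /= -(Ff _ _ _ (P'sum e) Fx (sumF e)).
by rewrite subrK.
Qed.

(** * Graded modules, free modules and cokernels *)

Section GradedModuleTheory.
Variables (k : fieldType) (D : graded_algebra k).

Definition gpart (M : gmod D) (i : int) (x : M) : M := hpart (gmodP M).1 i x.
Definition dpart (i : int) (a : D) : D := hpart (@gdegP k D) i a.

Section Module.
Variable M : gmod D.
Implicit Types (x y : M) (a : D).

Lemma gmdeg0 i : gmdeg i (0 : M). Proof. exact: gr0 (gmodP M).1 i. Qed.
Lemma gmdegD i x y : gmdeg i x -> gmdeg i y -> gmdeg i (x + y).
Proof. exact: grD (gmodP M).1 i x y. Qed.
Lemma gmdegB i x y : gmdeg i x -> gmdeg i y -> gmdeg i (x - y).
Proof. exact: grB (gmodP M).1 i x y. Qed.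
Lemma gmdeg_sum i I (s : seq I) (P : pred I) (F : I -> M) :
  (forall j, P j -> gmdeg i (F j)) -> gmdeg i (\sum_(j <- s | P j) F j).
Proof. exact: gr_sum (gmodP M).1 i I s P F. Qed.
Lemma gmdegZ i j a x : gdeg i a -> gmdeg j x -> gmdeg (i + j) (a *: x).
Proof. exact: (gmodP M).2. Qed.
Lemma gmdeg_kscale i c x : gmdeg i x -> gmdeg i (kscale c x).
Proof. by move=> xi; rewrite -[i]add0r; apply: gmdegZ => //; apply/gdegZ/gdeg1. Qed.

Lemma gpart_homog i x : gmdeg i (gpart i x). Proof. exact: hpart_homog. Qed.
Lemma gpartD i x y : gpart i (x + y) = gpart i x + gpart i y. Proof. exact: hpartD. Qed.
Lemma gpart0 i : gpart i (0 : M) = 0. Proof. exact: hpart0. Qed.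
Lemma gpart_sum i I (s : seq I) (P : pred I) (F : I -> M) :
  gpart i (\sum_(j <- s | P j) F j) = \sum_(j <- s | P j) gpart i (F j).
Proof. exact: hpart_sum. Qed.
Lemma gpart_id i x : gmdeg i x -> gpart i x = x.
Proof. by move=> xi; rewrite /gpart (hpart_id _ _ xi) eqxx. Qed.
Lemma gpart_neq i j x : gmdeg j x -> i != j -> gpart i x = 0.
Proof. by move=> xj /negbTE ij; rewrite /gpart (hpart_id _ _ xj) ij. Qed.
Lemma gpartB i x y : gpart i (x - y) = gpart i x - gpart i y.
Proof. by apply: (addIr (gpart i y)); rewrite -gpartD !subrK. Qed.
Lemma gpart_gpart i j x : gpart i (gpart j x) = if i == j then gpart j x else 0.
Proof. exact: hpart_id (gpart_homog j x). Qed.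
Lemma gpart_sumE x : exists s : seq int, x = \sum_(i <- s) gpart i x.
Proof. by have [s /covers_sum sx] := covers_ex (gmodP M).1 x; exists s. Qed.

Lemma gpartZ i j a x : gdeg i a -> gpart (i + j) (a *: x) = a *: gpart j x.
Proof.
move=> ai; apply: (@hpart_morph _ _ _ _ (gmodP M).1 (gmodP M).1 i ( *:%R a)).
  by move=> y z; exact: scalerDr.
by move=> l y; exact: gmdegZ.
Qed.

Lemma gpartZl i j a x : gmdeg j x -> gpart (i + j) (a *: x) = dpart i a *: x.
Proof.
move=> xj; rewrite addrC.
apply: (@hpart_morph _ _ _ _ (@gdegP k D) (gmodP M).1 j ( *:%R^~ x)).
  by move=> b c; exact: scalerDl.
by move=> l b bl; rewrite addrC; exact: gmdegZ.
Qed.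

Lemma dpart_homog i a : gdeg i (dpart i a). Proof. exact: hpart_homog. Qed.
Lemma dpart_id i a : gdeg i a -> dpart i a = a.
Proof. by move=> ai; rewrite /dpart (hpart_id _ _ ai) eqxx. Qed.
Lemma dpart_eq0 a : (forall i, dpart i a = 0) -> a = 0. Proof. exact: hpart_eq0. Qed.

Lemma gmdeg_cmb n (c : 'I_n -> D) (u : 'I_n -> M) (a : 'I_n -> int) m :
  (forall i, gdeg (m - a i) (c i)) -> (forall i, gmdeg (a i) (u i)) ->
  gmdeg m (\sum_i c i *: u i).
Proof.
move=> cm ua; apply: gmdeg_sum => i _; rewrite -[m](subrK (a i)).
exact: gmdegZ.
Qed.

Lemma gpart_cmb n (c : 'I_n -> D) (u : 'I_n -> M) (a : 'I_n -> int) m :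
  (forall i, gmdeg (a i) (u i)) ->
  gpart m (\sum_i c i *: u i) = \sum_i dpart (m - a i) (c i) *: u i.
Proof.
move=> ua; rewrite gpart_sum; apply: eq_bigr => i _.
by rewrite -{1}[m](subrK (a i)) gpartZl.
Qed.

(** It suffices to take the homogeneous parts of any coefficients. *)
Lemma homog_cmb n (u : 'I_n -> M) (a : 'I_n -> int) m x :
  (forall i, gmdeg (a i) (u i)) -> gmdeg m x ->
  (exists c : 'I_n -> D, x = \sum_i c i *: u i) ->
  exists2 c : 'I_n -> D, forall i, gdeg (m - a i) (c i) & x = \sum_i c i *: u i.
Proof.
move=> ua xm [c xE]; exists (fun i => dpart (m - a i) (c i)).
  by move=> i; exact: dpart_homog.
by rewrite -gpart_cmb // -xE gpart_id.
Qed.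

End Module.

Lemma gdegN i (a : D) : gdeg i a -> gdeg i (- a).
Proof. exact: grN (@gdegP k D) i a. Qed.
Lemma gdegD i (a b : D) : gdeg i a -> gdeg i b -> gdeg i (a + b).
Proof. exact: grD (@gdegP k D) i a b. Qed.
Lemma gdegB i (a b : D) : gdeg i a -> gdeg i b -> gdeg i (a - b).
Proof. exact: grB (@gdegP k D) i a b. Qed.
Lemma gdeg0 i : gdeg i (0 : D). Proof. exact: gr0 (@gdegP k D) i. Qed.
Lemma gdeg_sum i I (s : seq I) (P : pred I) (F : I -> D) :
  (forall j, P j -> gdeg i (F j)) -> gdeg i (\sum_(j <- s | P j) F j).
Proof. exact: gr_sum (@gdegP k D) i I s P F. Qed.

Lemma dpartM i j (a b : D) : gdeg j b -> dpart (i + j) (a * b) = dpart i a * b.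
Proof.
move=> bj; rewrite addrC.
apply: (@hpart_morph _ _ _ _ (@gdegP k D) (@gdegP k D) j ( *%R^~ b)).
  by move=> c d; exact: mulrDl.
by move=> l c cl; rewrite addrC; exact: gdegM.
Qed.

Section Hom.
Variables (M N : gmod D) (f : ghom M N).
Local Notation F := (sval f).

Lemma ghom_deg i x : gmdeg i x -> gmdeg i (F x). Proof. by case: (svalP f) => _; exact. Qed.
Lemma ghomD x y : F (x + y) = F x + F y.
Proof. by have := (svalP f).1 1 x y; rewrite !scale1r. Qed.
Lemma ghom0 : F 0 = 0. Proof. by apply: (addrI (F 0)); rewrite -ghomD !addr0. Qed.
Lemma ghomZ a x : F (a *: x) = a *: F x.
Proof. by have := (svalP f).1 a x 0; rewrite !addr0 ghom0 addr0. Qed.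
Lemma ghomN x : F (- x) = - F x. Proof. by rewrite -scaleN1r ghomZ scaleN1r. Qed.
Lemma ghomB x y : F (x - y) = F x - F y. Proof. by rewrite ghomD ghomN. Qed.
Lemma ghom_sum I (s : seq I) (P : pred I) (G : I -> M) :
  F (\sum_(i <- s | P i) G i) = \sum_(i <- s | P i) F (G i).
Proof. exact: (big_morph F ghomD ghom0). Qed.
Lemma ghom_gpart i x : gpart i (F x) = F (gpart i x).
Proof.
rewrite -{1}[i]add0r; apply: (@hpart_morph _ _ _ _ (gmodP M).1 (gmodP N).1 0 F).
  exact: ghomD.
by move=> j y; rewrite add0r; exact: ghom_deg.
Qed.
End Hom.

Section Free.
Variables (n : nat) (a : 'I_n -> int).

Definition free_deg (i : int) (f : {ffun 'I_n -> D^o}) : Prop :=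
  forall s, gdeg (i - a s) (f s : D).

Fact free_gmodP : is_graded_module (M := {ffun 'I_n -> D^o} : lmodType D) free_deg.
Proof.
have GP s : is_grading (fun i => @gdeg k D (- a s + i)).
  by apply: is_grading_shift; exact: gdegP.
split; last first.
  by move=> i j b f bi fj s; rewrite ffunE -addrA; exact: (gdegM bi (fj s)).
split=> [i s|i f g fi gi s|f|t F ut FG F0 i it]; first by rewrite ffunE; exact: gdeg0.
- by rewrite !ffunE; apply: gdegB.
- have /choice [c cP] s := covers_ex (GP s) (f s).
  pose t := undup (flatten [seq c s | s : 'I_n]).
  exists t, (fun i => [ffun s => hpart (GP s) i (f s)]); split.
  + exact: undup_uniq.
  + by move=> i s; rewrite ffunE addrC; exact: (hpart_homog (GP s) i (f s)).
  apply/ffunP => s; rewrite sum_ffunE.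
  under eq_bigr => i _ do rewrite ffunE.
  apply: covers_sum; apply: covers_sub (cP s) (undup_uniq _) _ => i ci.
  rewrite mem_undup; apply/flattenP; exists (c s) => //.
  by apply: map_f; rewrite mem_enum.
apply/ffunP => s; rewrite ffunE.
have [_ _ _ /(_ t (fun i => F i s) ut)] := GP s; apply=> // [j|].
  by have := FG j s; rewrite addrC.
by have /ffunP /(_ s) := F0; rewrite sum_ffunE ffunE.
Qed.
Definition free_gmod : gmod D := GMod free_gmodP.

Definition fbas (s : 'I_n) : free_gmod := [ffun t => (t == s)%:R].

Lemma fbas_deg s : gmdeg (a s) (fbas s).
Proof.
move=> t; rewrite ffunE; case: eqP => [->|_]; last exact: gdeg0.
by rewrite subrr; exact: gdeg1.
Qed.

Lemma fbasE (d : 'I_n -> D) : \sum_s d s *: fbas s = finfun (d : 'I_n -> D^o).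
Proof.
apply/ffunP => t; rewrite sum_ffunE ffunE (bigD1 t) //= ffunE ffunE eqxx.
rewrite [_ *: _]mulr1 big1 ?addr0 // => s st.
by rewrite ffunE ffunE eq_sym (negbTE st) scaler0.
Qed.

Lemma fbas_gen (y : free_gmod) : y = \sum_s (y s : D) *: fbas s.
Proof. by rewrite fbasE; apply/ffunP => s; rewrite ffunE. Qed.

Fact free_fp : finitely_presented free_gmod.
Proof.
exists n, a, fbas, 0%N, (fun=> 0), (fun _ _ => 0); split=> [s|[] //|y|c].
- exact: fbas_deg.
- by exists (fun s => y s); exact: fbas_gen.
rewrite fbasE; split=> [/ffunP c0|[d dP]].
  by exists (fun=> 0) => i; have := c0 i; rewrite !ffunE big_ord0.
by apply/ffunP => s; rewrite !ffunE dP big_ord0.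
Qed.
Definition free_obj : gr D := GrObj free_fp.

Variables (Y : gmod D) (y : 'I_n -> Y) (ya : forall s, gmdeg (a s) (y s)).

Fact free_mapP : is_ghom (fun d : free_gmod => \sum_s (d s : D) *: y s).
Proof.
split=> [b d d'|i d di].
  rewrite scaler_sumr -big_split; apply: eq_bigr => s _.
  by rewrite !ffunE scalerDl scalerA.
by apply: gmdeg_cmb ya => s; exact: di.
Qed.
Definition free_map : ghom free_gmod Y := exist _ _ free_mapP.

Lemma free_map_bas s : sval free_map (fbas s) = y s.
Proof.
rewrite /= (bigD1 s) //= ffunE eqxx scale1r big1 ?addr0 // => t ts.
by rewrite ffunE (negbTE ts) scale0r.
Qed.
End Free.

Lemma free_ext n (a : 'I_n -> int) (Y : gmod D) (f g : ghom (free_gmod a) Y) :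
  (forall s, sval f (fbas a s) = sval g (fbas a s)) -> f = g.
Proof.
move=> fg; apply: ghom_eq => y; rewrite (fbas_gen y) !ghom_sum.
by apply: eq_bigr => s _; rewrite !ghomZ fg.
Qed.

(** ** Zero morphisms, kernels and cokernels of gr *)

Definition zero_gr : gr D := free_obj (fun i : 'I_0 => 0).

Lemma zero_gr0 (x : grmod zero_gr) : x = 0.
Proof. by apply/ffunP => -[]. Qed.

Fact zero_mapP (M N : gmod D) : is_ghom (fun _ : M => 0 : N).
Proof. by split=> [a x y|i x _]; [rewrite scaler0 addr0|exact: gmdeg0]. Qed.
Definition zero_map (M N : gmod D) : ghom M N := exist _ _ (zero_mapP M N).

Lemma gr_trivial_zero_object (Z : gr D) :
  (forall x : grmod Z, x = 0) -> zero_object Z.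
Proof.
move=> Z0; split=> X.
  by exists (zero_map X Z) => g; apply: ghom_eq => x; rewrite [LHS]Z0.
by exists (zero_map Z X) => g; apply: ghom_eq => x; rewrite (Z0 x) !ghom0.
Qed.

Lemma zero_gr_zero : zero_object zero_gr.
Proof. exact/gr_trivial_zero_object/zero_gr0. Qed.

(** On a zero object the identity equals the zero endomorphism, so a morphism that
    factors through it vanishes pointwise. *)
Lemma gr_zero_morphism (M N : gr D) (f : Hom M N) :
  zero_morphism f <-> forall x, sval (f : ghom M N) x = 0.
Proof.
split=> [[Z [a [b [[Z0 _] ->]]]] x|f0].
  have [z zP] := Z0 Z; rewrite /=.
  have : idm Z = zero_map Z Z :> ghom Z Z.
    by rewrite [LHS]zP [RHS](zP (zero_map Z Z)).
  move=> /(congr1 (fun h : ghom Z Z => sval h (sval (a : ghom M Z) x))) /= ->.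
  exact: ghom0.
exists zero_gr, (zero_map M zero_gr), (zero_map zero_gr N).
by split; [exact: zero_gr_zero|apply: ghom_eq].
Qed.

Lemma gr_injective_kernel (M N : gr D) (f : Hom M N) :
  (forall x, sval (f : ghom M N) x = 0 -> x = 0) ->
  is_kernel (zero_map zero_gr M : @Hom (gr D) _ _) f.
Proof.
move=> fI; split; first by apply/gr_zero_morphism => x; exact: ghom0.
move=> T h /gr_zero_morphism hf; exists (zero_map T zero_gr); split.
  by apply: ghom_eq => x; exact: esym (fI _ (hf x)).
  by move=> u _; apply: ghom_eq => x; exact: esym (zero_gr0 _).
Qed.

Section Cokernel.
Variables (X Y : gr D) (f : Hom X Y).
Local Notation F := (sval (f : ghom X Y)).

Definition gim (y : grmod Y) : Prop := exists x, y = F x.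
Fact gim0 : gim 0. Proof. by exists 0; rewrite [RHS](ghom0 f). Qed.
Fact gimD x y : gim x -> gim y -> gim (x + y).
Proof. by case=> u -> [v ->]; exists (u + v); rewrite [RHS](ghomD f). Qed.
Fact gimZ a x : gim x -> gim (a *: x).
Proof. by case=> u ->; exists (a *: u); rewrite [RHS](ghomZ f). Qed.
Definition gim_sub : submodule (gcar Y) := Submodule gim0 gimD gimZ.

Lemma gim_gpart i y : gim y -> gim (gpart i y).
Proof. by case=> x ->; exists (gpart i x); exact: ghom_gpart. Qed.

Definition coker_car : lmodType D := quot_mod gim_sub.
Definition coker_pi (y : grmod Y) : coker_car := quot_pi gim_sub y.
Definition coker_deg (i : int) (z : coker_car) : Prop :=
  exists2 y, gmdeg i y & z = coker_pi y.

Lemma coker_piD : {morph coker_pi : x y / x + y}.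
Proof. by move=> x y; exact: quot_piD. Qed.
Lemma coker_piZ a x : coker_pi (a *: x) = a *: coker_pi x.
Proof. exact: quot_piZ. Qed.
Lemma coker_pi0 : coker_pi 0 = 0.
Proof. by apply: (addrI (coker_pi 0)); rewrite -coker_piD !addr0. Qed.
Lemma coker_pi_eq0 y : coker_pi y = 0 <-> gim y.
Proof. by rewrite -coker_pi0; have := quot_piP gim_sub y 0; rewrite subr0. Qed.
Lemma coker_pi_sum I (s : seq I) (P : pred I) (G : I -> grmod Y) :
  coker_pi (\sum_(i <- s | P i) G i) = \sum_(i <- s | P i) coker_pi (G i).
Proof. exact: (big_morph coker_pi coker_piD coker_pi0). Qed.
Lemma coker_piN y : coker_pi (- y) = - coker_pi y.
Proof. by rewrite -scaleN1r coker_piZ scaleN1r. Qed.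

Fact coker_gmodP : is_graded_module coker_deg.
Proof.
split; last first.
  move=> i j a _ ai [y yj ->]; exists (a *: y); first exact: gmdegZ.
  by rewrite coker_piZ.
split=> [i|i _ _ [x xi ->] [y yi ->]|z|s G us GG G0 n sn].
- by exists 0; [exact: gmdeg0|rewrite coker_pi0].
- by exists (x - y); [exact: gmdegB|rewrite coker_piD coker_piN].
- elim/quot_ind: z => y; have [s [us s0]] := covers_ex (gmodP Y).1 y.
  exists s, (fun i => coker_pi (gpart i y)); split=> //.
    by move=> i; exists (gpart i y) => //; exact: gpart_homog.
  by rewrite -coker_pi_sum -covers_sum.
have /choice [g gP] i : exists g, gmdeg i g /\ G i = coker_pi g.
  by have [g] := GG i; exists g.
have : gim (\sum_(i <- s) g i).
  apply/coker_pi_eq0; rewrite -G0 coker_pi_sum.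
  by apply: eq_bigr => i _; case: (gP i).
move=> /(gim_gpart n); rewrite gpart_sum (bigD1_seq n) //= (gpart_id (gP n).1).
rewrite big1 => [|i ni]; last by apply: (gpart_neq (gP i).1); rewrite eq_sym.
by rewrite addr0 (gP n).2 => /coker_pi_eq0.
Qed.
Definition coker_gmod : gmod D := GMod coker_gmodP.

(** The relations of [Y], together with the coordinates of the images of the
    generators of [X], present the cokernel. *)
Fact coker_fp : finitely_presented coker_gmod.
Proof.
have [n [a [u [_ [_ [_ [ua _ ugen _]]]]]]] := grmodP X.
have [p [b [v [m [c [s [vb sc vgen vrel]]]]]]] := grmodP Y.
have /choice [q qP] l : exists q : 'I_p -> D,
    (forall i, gdeg (a l - b i) (q i)) /\ F (u l) = \sum_i q i *: v i.
  have := homog_cmb vb (ghom_deg f (ua l)) (vgen _).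
  by case=> q qd E; exists q.
exists p, b, (fun i => coker_pi (v i)), (m + n)%N,
  (fun j => match split j with inl j => c j | inr l => a l end),
  (fun j i => match split j with inl j => s j i | inr l => q l i end).
split=> [i|j i|z|e].
- by exists (v i).
- by case: split => l; [exact: sc|exact: (qP l).1].
- elim/quot_ind: z => y; have [e ->] := vgen y; exists e.
  by rewrite [LHS]coker_pi_sum; apply: eq_bigr => i _; rewrite coker_piZ.
have -> : (\sum_i e i *: coker_pi (v i) = 0 :> coker_car) <-> gim (\sum_i e i *: v i).
  rewrite -coker_pi_eq0 coker_pi_sum.
  by split=> E; rewrite -{}[RHS]E; apply: eq_bigr => i _; rewrite coker_piZ.
have splitE (d : 'I_(m + n) -> D) i : \sum_j d j *
     (match split j with inl j => s j i | inr l => q l i end) =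
    \sum_(j < m) d (lshift n j) * s j i + \sum_(l < n) d (rshift m l) * q l i.
  rewrite big_split_ord; congr (_ + _); apply: eq_bigr => j _.
    by rewrite (unsplitK (inl j)).
  by rewrite (unsplitK (inr j)).
have FE (d : 'I_n -> D) : F (\sum_l d l *: u l) =
    \sum_i (\sum_l d l * q l i) *: v i.
  rewrite ghom_sum; under [RHS]eq_bigr => i _ do rewrite scaler_suml.
  rewrite exchange_big; apply: eq_bigr => l _.
  rewrite ghomZ (qP l).2 scaler_sumr.
  by apply: eq_bigr => i _; rewrite scalerA.
split=> [[x]|[d dP]].
  have [d ->] := ugen x; rewrite FE => E.
  have /vrel [d' d'P] : \sum_i (e i - \sum_l d l * q l i) *: v i = 0.
    by under eq_bigr => i _ do rewrite scalerBl; rewrite sumrB E subrr.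
  exists (fun j => match split j with inl j => d' j | inr l => d l end) => i.
  rewrite splitE -[LHS](subrK (\sum_l d l * q l i)) d'P.
  congr (_ + _); apply: eq_bigr => j _; first by rewrite (unsplitK (inl j)).
  by rewrite (unsplitK (inr j)).
exists (\sum_l d (rshift m l) *: u l); rewrite FE; apply/eqP.
rewrite -subr_eq0 -sumrB; apply/eqP.
under eq_bigr => i _ do rewrite -scalerBl dP splitE addrK.
by apply/vrel; exists (fun j => d (lshift n j)).
Qed.
Definition coker_obj : gr D := GrObj coker_fp.

Fact coker_mapP : @is_ghom k D Y coker_gmod coker_pi.
Proof.
split=> [a x y|i x xi]; first by rewrite coker_piD coker_piZ.
by exists x.
Qed.
Definition coker_map : @Hom (gr D) Y coker_obj := exist _ _ coker_mapP.

Lemma coker_is_cokernel : is_cokernel f coker_map.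
Proof.
split.
  by apply/gr_zero_morphism => x; apply/coker_pi_eq0; exists x.
move=> T h /gr_zero_morphism fh.
pose H := sval (h : ghom Y T).
pose u (z : coker_car) := H (quot_repr z).
have uE y : u (coker_pi y) = H y.
  have [x E] := quot_reprP gim_sub y; apply/subr0_eq.
  by rewrite -[LHS](ghomB h) E; exact: fh.
have uP : @is_ghom k D coker_gmod T u.
  split=> [a|i _ [y yi ->]]; last by rewrite uE; exact: ghom_deg.
  elim/quot_ind=> x; elim/quot_ind=> y.
  rewrite -!/(coker_pi _) -coker_piZ -coker_piD !uE /H.
  by rewrite (ghomD h) (ghomZ h).
exists (exist _ u uP); split; first by apply: ghom_eq => y; exact: uE.
move=> v vE; apply: ghom_eq => z; elim/quot_ind: z => y.
by have := congr1 (fun g : ghom Y T => sval g y) vE => /= vy; exact: etrans (uE y) (esym vy).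
Qed.
End Cokernel.
End GradedModuleTheory.

(** * The structure of finitely presented modules in high degrees *)

(** The common structure of the two algebras. In [k<x, y>/(y^(r+1))] one takes
    [e = 1] and [w_n = y^n]; in the path algebra, [e] is the trivial path at the
    first vertex, [x] the sum of the arrows [x_j], and [w_n] the path made of the
    first [n] arrows [y]. The products [w_i x] generate a free algebra, and
    [td_gen] and [td_free] say, degree by degree, that [e D] is a free left module
    over it with basis [w_0, ..., w_r].

    By [td_x] every element of degree above [r] lies in [D x D], with right factors
    of degree smaller by at most [r + 1]; quantifying over a predicate that is
    closed under sums avoids naming such a decomposition. By [td_sep], [e D] acts
    faithfully on [D] from the left, which lets [e D] control all of [D]. *)
Record tail_data (k : fieldType) (D : graded_algebra k) (r : nat) := TailData {
  te : D;
  tx : D;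
  tw : nat -> D;
  td_neg : forall m (a : D), m < 0 -> gdeg m a -> a = 0;
  td_fin : forall m, exists L : seq D, forall a : D, gdeg m a ->
    exists c : nat -> k, a = \sum_(i < size L) c i *: L`_i;
  te_deg : gdeg 0 te;
  tx_deg : gdeg 1 tx;
  tw_deg : forall n : nat, gdeg n%:Z (tw n);
  tee : te * te = te;
  txe : tx * te = tx;
  tew : forall n, te * tw n = tw n;
  tw_big : forall n, (r < n)%N -> tw n = 0;
  tw_neq0 : forall n, (n <= r)%N -> tw n <> 0;
  td_gen : forall (n : nat) (a : D), gdeg n%:Z a ->
    exists (c : k) (d : 'I_r.+1 -> D),
      (forall i : 'I_r.+1, gdeg (n%:Z - i%:Z - 1) (d i)) /\
      te * a = c *: tw n + \sum_(i < r.+1) tw i * tx * d i;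
  td_free : forall (n : nat) (c : k) (u : 'I_r.+1 -> D),
    (forall i : 'I_r.+1, gdeg (n%:Z - i%:Z - 1) (u i)) ->
    c *: tw n + \sum_(i < r.+1) tw i * tx * u i = 0 ->
    c *: tw n = 0 /\ forall i, te * u i = 0;
  td_x : forall (n : nat) (a : D), (r < n)%N -> gdeg n%:Z a ->
    forall P : D -> Prop, P 0 -> (forall b c, P b -> P c -> P (b + c)) ->
    (forall (i : 'I_r.+1) b c, gdeg (n%:Z - i%:Z - 1) c -> P (b * tx * c)) -> P a;
  td_sep : forall a : D, (forall m (d : D), gdeg m d -> te * d * a = 0) -> a = 0
}.

Lemma int_bound n (a : 'I_n -> int) : exists K : int, forall i, a i <= K.
Proof.
elim: n a => [|n IH] a; first by exists 0 => -[].
have [K KP] := IH (fun i => a (lift ord0 i)).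
exists (Num.max K (a ord0)) => i; rewrite le_max.
by case: (unliftP ord0 i) => [j|] ->; rewrite ?KP // lexx orbT.
Qed.

Section Tail.
Variables (k : fieldType) (D : graded_algebra k) (r : nat) (T : tail_data D r).

Lemma tw_tx_deg (i : nat) m (a : D) : gdeg (m - i%:Z - 1) a -> gdeg m (tw T i * tx T * a).
Proof.
move=> ai; rewrite (_ : m = i%:Z + 1 + (m - i%:Z - 1)); last by lia.
by apply/gdegM/ai/gdegM/tx_deg/tw_deg.
Qed.

Lemma td_gen_int m (a : D) : gdeg m a ->
  exists (d : 'I_r.+1 -> D) (c : k),
    [/\ forall i : 'I_r.+1, gdeg (m - i%:Z - 1) (d i), forall i, te T * d i = d i,
        m < 0 -> c = 0 & te T * a = c *: tw T `|m| + \sum_(i < r.+1) tw T i * tx T * d i].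
Proof.
case: (ltrP m 0) => m0 am.
  exists (fun=> 0), 0; split=> // [i|i|]; rewrite ?mulr0 //; first exact: gdeg0.
  rewrite (td_neg T m0 am) mulr0 scale0r add0r big1 // => i _.
  by rewrite mulr0.
have [n mE] : exists n : nat, m = n%:Z by exists `|m|%N; lia.
rewrite {m}mE in m0 am *; have [c [d [dn aE]]] := td_gen T am.
exists (fun i => te T * d i), c; split=> [i|i|//|].
- by rewrite -[_ - 1]add0r; apply/gdegM/dn/te_deg.
- by rewrite mulrA tee.
rewrite aE /=; congr (_ + _); apply: eq_bigr => i _.
by rewrite mulrA -[_ * te T]mulrA txe.
Qed.

Lemma td_free_int m (u : 'I_r.+1 -> D) :
  (forall i : 'I_r.+1, gdeg (m - i%:Z - 1) (u i)) ->
  \sum_(i < r.+1) tw T i * tx T * u i = 0 -> forall i, te T * u i = 0.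
Proof.
case: (ltrP m 0) => m0 um E.
  by move=> i; rewrite (td_neg T _ (um i)) ?mulr0 //; lia.
have [n mE] : exists n : nat, m = n%:Z by exists `|m|%N; lia.
rewrite {m}mE in m0 um *.
by have [] := @td_free _ _ _ T n 0 u um; rewrite // scale0r add0r.
Qed.

Section Module.
Variable M : gmod D.
Implicit Types (v : M) (u : 'I_r.+1 -> M) (N m : int).

Definition zsum (u : 'I_r.+1 -> M) : M := \sum_(i < r.+1) (tw T i * tx T) *: u i.

(** In high degrees [e M] is generated, and by [tail_free] freely, by the operators
    [w_i x] acting on lower degrees. For [M = D] this holds from degree [r + 1] on,
    by [td_gen] and [td_free]; [fp_tail] extends it to finitely presented modules. *)
Definition tail_gen N := forall m v, N <= m -> gmdeg m v ->
  exists2 u : 'I_r.+1 -> M,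
    forall i : 'I_r.+1, gmdeg (m - i%:Z - 1) (u i) & te T *: v = zsum u.

Definition tail_free N := forall m u, N <= m ->
  (forall i : 'I_r.+1, gmdeg (m - i%:Z - 1) (u i)) ->
  zsum u = 0 -> forall i, te T *: u i = 0.

Lemma te_gmdeg m v : gmdeg m v -> gmdeg m (te T *: v).
Proof. by move=> vm; rewrite -[m]add0r; apply/gmdegZ/vm/te_deg. Qed.

Lemma zsum_te u : zsum u = zsum (fun i => te T *: u i).
Proof. by apply: eq_bigr => i _; rewrite scalerA -mulrA txe. Qed.

Lemma te_zsum u : te T *: zsum u = zsum u.
Proof.
rewrite scaler_sumr; apply: eq_bigr => i _.
by rewrite scalerA mulrA tew.
Qed.

Lemma zsumD u (v : 'I_r.+1 -> M) : zsum (fun i => u i + v i) = zsum u + zsum v.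
Proof. by rewrite -big_split; apply: eq_bigr => i _; rewrite scalerDr. Qed.

Lemma zsumZ c (u : 'I_r.+1 -> M) : zsum (fun i => kscale c (u i)) = kscale c (zsum u).
Proof. by rewrite kscale_sumr; apply: eq_bigr => i _; rewrite kscale_scale. Qed.

Lemma zsum0 : zsum (fun=> 0) = 0.
Proof. by rewrite /zsum big1 // => i _; rewrite scaler0. Qed.

Lemma zsum_sum n (u : 'I_n -> 'I_r.+1 -> M) :
  zsum (fun i => \sum_s u s i) = \sum_s zsum (u s).
Proof. by rewrite exchange_big; apply: eq_bigr => i _; rewrite scaler_sumr. Qed.

Lemma zsum_deg m u : (forall i : 'I_r.+1, gmdeg (m - i%:Z - 1) (u i)) -> gmdeg m (zsum u).
Proof.
move=> um; apply: gmdeg_sum => i _.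
rewrite (_ : m = i%:Z + 1 + (m - i%:Z - 1)); last by lia.
by apply/gmdegZ/um/gdegM/tx_deg/tw_deg.
Qed.

Definition edeg m v := gmdeg m v /\ te T *: v = v.

Lemma edeg_te m v : gmdeg m v -> edeg m (te T *: v).
Proof. by move=> vm; split; [exact: te_gmdeg|rewrite scalerA tee]. Qed.

Lemma edeg_subspace m : subspace (edeg m).
Proof.
split=> [|c u v [um ue] [vm ve]]; first by split; [exact: gmdeg0|rewrite scaler0].
split; first by apply: gmdegD => //; exact: gmdeg_kscale.
by rewrite scalerDr -kscale_scale ue ve.
Qed.

Hypothesis Mfp : finitely_presented M.

Lemma fp_bounded : exists A : int, forall m v, m < A -> gmdeg m v -> v = 0.
Proof.
case: Mfp => n [a [x [_ [_ [_ [xa _ xgen _]]]]]].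
have [K KP] := int_bound (fun i => - a i); exists (- K) => m v mK vm.
have [c cd ->] := homog_cmb xa vm (xgen v).
rewrite big1 // => i _; rewrite (td_neg T _ (cd i)) ?scale0r //.
by have := KP i; lia.
Qed.

Lemma fp_finite m : exists L : seq M, (forall v, v \in L -> gmdeg m v) /\
  forall v, gmdeg m v -> exists c : nat -> k, v = \sum_(i < size L) kscale (c i) L`_i.
Proof.
case: Mfp => n [a [x [_ [_ [_ [xa _ xgen _]]]]]].
have /choice [L LP] i := td_fin T (m - a i).
exists [seq gpart m (d *: x i) | i <- enum 'I_n, d <- L i]; split.
  by move=> v /allpairsPdep [i [d [_ _ ->]]]; exact: gpart_homog.
suff H (s : seq 'I_n) (c : 'I_n -> D) : (forall i, gdeg (m - a i) (c i)) ->
    exists e : nat -> k, \sum_(i <- s) c i *: x i =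
      \sum_(j < size [seq gpart m (d *: x i) | i <- s, d <- L i])
        kscale (e j) [seq gpart m (d *: x i) | i <- s, d <- L i]`_j.
  move=> v vm; have [c cd ->] := homog_cmb xa vm (xgen v).
  by have [e E] := H (enum 'I_n) c cd; exists e; rewrite -E big_enum.
move=> cd; elim: s => [|i s [e IH]]; first by exists (fun=> 0); rewrite big_nil big_ord0.
have [f fE] := LP i _ (cd i).
set A := [seq gpart m (d *: x i) | d <- L i].
set B := [seq gpart m (d *: x i) | i <- s, d <- L i] in IH *.
exists (fun j => if (j < size A)%N then f j else e (j - size A)%N).
rewrite big_cons /= -/A -/B IH size_cat big_split_ord /=; congr (_ + _).
  rewrite -[LHS](@gpart_id _ _ M m); last first.
    by rewrite -[m](subrK (a i)); apply: gmdegZ.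
  have sA : size A = size (L i) by rewrite size_map.
  rewrite {1}fE scaler_suml gpart_sum sA; apply: eq_bigr => j _.
  rewrite nth_cat sA ltn_ord (nth_map 0) ?ltn_ord //.
  by rewrite scale_kscale -kscale_scale {1}/kscale -[X in gpart X _]add0r gpartZ //; apply/gdegZ/gdeg1.
apply: eq_bigr => j _; rewrite nth_cat ltnNge leq_addr /=.
by rewrite addKn.
Qed.

Lemma edeg_kdim m : exists n, kdim (edeg m) n.
Proof.
have [L [Lm LP]] := fp_finite m.
apply: (@kdim_ex _ _ _ _ [seq te T *: v | v <- L]); first exact: edeg_subspace.
  by move=> _ /mapP [v vL ->]; apply/edeg_te/Lm.
move=> v [/LP [c vE] <-]; exists c; rewrite size_map {1}vE scaler_sumr.
by apply: eq_bigr => i _; rewrite (nth_map 0) // -kscale_scale.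
Qed.

(** Beyond the degrees of the generators and relations of [M], generation comes
    from expanding coefficients by [td_gen]. For freeness, a relation
    [sum_i w_i x u_i = 0] lifts to a combination of the relations of [M] in the free
    module; expanding its coefficients by [td_gen] and comparing with [td_free]
    shows that every [e u_i] is itself a combination of relations of [M]. *)
Lemma fp_tail : exists N, tail_gen N /\ tail_free N.
Proof.
case: Mfp => n [a [x [p [b [s [xa sb xgen xrel]]]]]].
have [K KP] := int_bound a; have [L LP] := int_bound b.
(* All coefficients below then have degree above [r], where [w_n = 0]. *)
exists (Num.max K L + r%:Z + 1); split=> [m v|m u]; rewrite maxEle => mN.
  move=> vm.
  have [c cd ->] := homog_cmb xa vm (xgen v).
  have /choice [d dP] i := td_gen_int (cd i).
  exists (fun l => \sum_i d i l *: x i) => [l|].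
    apply: gmdeg_cmb xa => i; have [e [H _ _ _]] := dP i.
    by rewrite (_ : _ - _ = m - a i - l%:Z - 1); [exact: H|lia].
  rewrite zsum_sum scaler_sumr; apply: eq_bigr => i _.
  have [e [_ _ _ E]] := dP i; rewrite scalerA E tw_big ?scaler0 ?add0r; last first.
    by have := KP i; case: ifP mN; lia.
  by rewrite scaler_suml; apply: eq_bigr => l _; rewrite scalerA.
move=> um uz; have /choice [c cP] (l : 'I_r.+1) : exists c : 'I_n -> D,
    (forall i, gdeg (m - l%:Z - 1 - a i) (c i)) /\ u l = \sum_i c i *: x i.
  by have [c] := homog_cmb xa (um l) (xgen _); exists c.
have [d0 d0P] : exists d : 'I_p -> D,
    forall i, \sum_(l < r.+1) tw T l * tx T * c l i = \sum_j d j * s j i.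
  apply/xrel; transitivity (zsum u) => //; rewrite /zsum.
  under eq_bigr => i _ do rewrite scaler_suml.
  rewrite exchange_big; apply: eq_bigr => l _; rewrite (cP l).2 scaler_sumr.
  by apply: eq_bigr => i _; rewrite scalerA.
pose d j := dpart (m - b j) (d0 j).
have dP i : \sum_(l < r.+1) tw T l * tx T * c l i = \sum_j te T * d j * s j i.
  have zE : \sum_(l < r.+1) tw T l * tx T * c l i = te T * \sum_(l < r.+1) tw T l * tx T * c l i.
    by rewrite mulr_sumr; apply: eq_bigr => l _; rewrite !mulrA tew.
  rewrite zE; under [RHS]eq_bigr => j _ do rewrite -mulrA.
  rewrite -mulr_sumr; congr (_ * _).
  rewrite -[LHS](@dpart_id _ _ (m - a i)); last first.
    apply: gdeg_sum => l _; apply: tw_tx_deg.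
    by rewrite (_ : _ - 1 = m - l%:Z - 1 - a i); [exact: (cP l).1|lia].
  rewrite d0P [LHS](@hpart_sum _ _ (@gdegP k D)); apply: eq_bigr => j _.
  rewrite /d (_ : m - a i = m - b j + (b j - a i)); last by lia.
  exact: dpartM.
have /choice [e eP] j := td_gen_int (dpart_homog (m - b j) (d0 j)).
have E i : \sum_(l < r.+1) tw T l * tx T * (c l i - \sum_j e j l * s j i) = 0.
  under eq_bigr => l _ do rewrite mulrBr.
  rewrite sumrB dP; apply/eqP; rewrite subr_eq0; apply/eqP.
  under [RHS]eq_bigr => l _ do rewrite mulr_sumr.
  rewrite exchange_big; apply: eq_bigr => j _.
  have [e' [_ _ _ ->]] := eP j; rewrite tw_big ?scaler0 ?add0r; last first.
    by have := LP j; case: ifP mN; lia.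
  by rewrite mulr_suml; apply: eq_bigr => l _; rewrite !mulrA.
have F l i : te T * c l i = \sum_j te T * e j l * s j i.
  have /td_free_int /(_ (E i) l) : forall l : 'I_r.+1,
      gdeg (m - a i - l%:Z - 1) (c l i - \sum_j e j l * s j i).
    move=> l'; apply: gdegB.
      by rewrite (_ : _ - 1 = m - l'%:Z - 1 - a i); [exact: (cP l').1|lia].
    apply: gdeg_sum => j _; have [e' [H _ _ _]] := eP j.
    rewrite (_ : _ - 1 = m - b j - l'%:Z - 1 + (b j - a i)); last by lia.
    by apply: gdegM.
  rewrite mulrBr => /eqP; rewrite subr_eq0 => /eqP ->.
  by rewrite mulr_sumr; apply: eq_bigr => j _; rewrite mulrA.
move=> l; rewrite (cP l).2 scaler_sumr.
under eq_bigr => i _ do rewrite scalerA F.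
by apply/xrel; exists (fun j => te T * e j l).
Qed.

End Module.
End Tail.

Section Frame.
Variables (k : fieldType) (D : graded_algebra k) (r : nat) (T : tail_data D r).
Variable M : gmod D.
Implicit Types (v : M) (N m : int).

(** For the free algebra [C] on the [w_i x], with augmentation ideal [C_+], this is
    the degree [m] part of [C_+ e M_(>= N)]; entries below degree [N] must vanish. *)
Definition decomposable N m v := exists a : 'I_r.+1 -> M,
  [/\ forall i : 'I_r.+1, gmdeg (m - i%:Z - 1) (a i),
      forall i : 'I_r.+1, m - i%:Z - 1 < N -> a i = 0 & v = zsum T a].

(** A homogeneous basis of the free [C]-module [e M_(>= N)], encoded as a basis
    modulo [C_+ e M_(>= N)], as in the graded form of Nakayama's lemma. *)
Definition frame N n (u : 'I_n -> M) (g : 'I_n -> int) :=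
  [/\ forall s, edeg T (g s) (u s), forall s, N <= g s,
      forall m (c : 'I_n -> k), (forall s, g s <> m -> c s = 0) ->
        decomposable N m (\sum_s kscale (c s) (u s)) -> forall s, c s = 0 &
      forall m v, N <= m -> gmdeg m v -> exists c : 'I_n -> k,
        (forall s, g s <> m -> c s = 0) /\
        decomposable N m (te T *: v - \sum_s kscale (c s) (u s))].

Lemma decomposable_subspace N m : subspace (decomposable N m).
Proof.
split=> [|c v w [a [ad a0 ->]] [b [bd b0 ->]]].
  by exists (fun=> 0); split=> // [i|]; [exact: gmdeg0|rewrite zsum0].
exists (fun i => kscale c (a i) + b i); split=> [i|i iN|].
- by apply: gmdegD => //; exact: gmdeg_kscale.
- by rewrite a0 // b0 // kscale0 addr0.
- by rewrite zsumD zsumZ.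
Qed.

Lemma zsum_pick p v : zsum T (fun i => if i%:Z == p then v else 0) =
  if 0 <= p then (tw T `|p| * tx T) *: v else 0.
Proof.
case: ifP => p0; last first.
  by rewrite /zsum big1 // => i _; case: eqP => ip; [lia|rewrite scaler0].
have [n ->] : exists n : nat, p = n%:Z by exists `|p|%N; lia.
have [nr|nr] := ltnP n r.+1.
  rewrite /zsum (bigD1 (Ordinal nr)) //= eqxx big1 ?addr0 // => i ni.
  case: eqP => [[E]|_]; last by rewrite scaler0.
  by case/eqP: ni; apply: val_inj.
rewrite tw_big //= mul0r scale0r /zsum big1 // => i _.
by case: eqP => [[E]|_]; [have := ltn_ord i; lia|rewrite scaler0].
Qed.

(** Expanding [d] by [td_gen] writes [d x v] as [sum_i w_i x v_i] where every [v_i]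
    is again of the form [d' x v], except for one scalar multiple of [v] itself.
    Inductions on the degree run on this expansion. *)
Lemma act_tx p (d : D) : gdeg p d -> te T * d = d ->
  exists (e : 'I_r.+1 -> D) (c : k),
    [/\ forall i : 'I_r.+1, gdeg (p - i%:Z - 1) (e i), forall i, te T * e i = e i,
        forall v, (d * tx T) *: v = zsum T (fun i =>
          (if i%:Z == p then kscale c v else 0) + (e i * tx T) *: v) &
        (forall i : 'I_r.+1, e i = 0) ->
        (forall i : 'I_r.+1, i%:Z = p -> c = 0) -> d = 0].
Proof.
move=> dp de; have [e [c [ed ee c0 E]]] := td_gen_int T dp.
exists e, c; split=> // [v|e0 cp].
  rewrite -{1}de E zsumD zsum_pick mulrDl scalerDl; congr (_ + _).
    case: ifP => p0; last by rewrite c0 ?scale0r ?mul0r ?scale0r //; lia.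
    by rewrite -scalerAl scale_kscale.
  rewrite mulr_suml scaler_suml; apply: eq_bigr => i _.
  by rewrite scalerA !mulrA.
rewrite -de E big1 ?addr0 => [|i _]; last by rewrite e0 mulr0.
case: (ltrP p 0) => p0; first by rewrite c0 // scale0r.
have [pr|pr] := leqP `|p|%N r; last by rewrite tw_big ?scaler0.
by rewrite (cp (Ordinal (pr : (`|p| < r.+1)%N))) ?scale0r //=; lia.
Qed.

Variables (N : int) (n : nat) (u : 'I_n -> M) (g : 'I_n -> int).
Hypotheses (MT : tail_free T M N) (uF : frame N u g).

Let ug s : gmdeg (g s) (u s). Proof. by case: uF => /(_ s) []. Qed.
Let ue s : te T *: u s = u s. Proof. by case: uF => /(_ s) []. Qed.
Let gN s : N <= g s. Proof. by case: uF. Qed.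

Lemma frame_decomposable p (d : D) s : gdeg p d -> te T * d = d ->
  decomposable N (p + 1 + g s) ((d * tx T) *: u s).
Proof.
move=> dp de; have [e [c [ed _ E _]]] := act_tx dp de.
eexists; split; last exact: E.
  move=> i /=; apply: gmdegD.
    case: eqP => [ip|_]; last exact: gmdeg0.
    by rewrite ip (_ : _ - 1 = g s); [exact: gmdeg_kscale|lia].
  rewrite (_ : _ - 1 = p - i%:Z - 1 + 1 + g s); last by lia.
  by apply/gmdegZ/ug/gdegM/tx_deg/ed.
move=> i iN /=; have gNs := gN s.
case: eqP => [ip|_]; first by lia.
by rewrite (td_neg T _ (ed i)) ?mul0r ?scale0r ?addr0 //; lia.
Qed.

(** The expansions of the [d_s x u_s] add up to zero, hence so do their entries by
    [tail_free]. Independence modulo decomposable elements kills the scalars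
    occurring there, and the induction hypothesis the rest. *)
Lemma frame_inj_e (q : nat) m (d : 'I_n -> D) : m <= N + q%:Z ->
  (forall s, gdeg (m - 1 - g s) (d s)) -> (forall s, te T * d s = d s) ->
  \sum_s (d s * tx T) *: u s = 0 -> forall s, d s = 0.
Proof.
elim: q m d => [|q IH] m d mq dg de d0.
  by move=> s; apply: (td_neg T _ (dg s)); have := gN s; lia.
have [mN|mN] := ltrP m N.
  by move=> s; apply: (td_neg T _ (dg s)); have := gN s; lia.
have /choice [e eP] s := act_tx (dg s) (de s).
have /choice [c cP] s := eP s => {eP}.
pose a (s : 'I_n) (i : 'I_r.+1) : M :=
  (if i%:Z == m - 1 - g s then kscale (c s) (u s) else 0) + (e s i * tx T) *: u s.
have aP (i : 'I_r.+1) : \sum_s a s i = 0.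
  have <- : te T *: (\sum_s a s i) = \sum_s a s i.
    rewrite scaler_sumr; apply: eq_bigr => s _; rewrite scalerDr scalerA mulrA.
    case: (cP s) => _ -> _ _; congr (_ + _).
    by case: ifP; rewrite ?scaler0 // -kscale_scale ue.
  apply: (MT (u := fun i => \sum_s a s i) mN) => [{}i|].
    apply: gmdeg_sum => s _; apply: gmdegD.
      case: eqP => [ip|_]; last exact: gmdeg0.
      by rewrite ip (_ : _ - 1 = g s); [exact: gmdeg_kscale|lia].
    rewrite (_ : m - i%:Z - 1 = m - 1 - g s - i%:Z - 1 + 1 + g s); last by lia.
    by case: (cP s) => ed _ _ _; apply/gmdegZ/ug/gdegM/tx_deg/ed.
  rewrite zsum_sum -[RHS]d0; apply: eq_bigr => s _.
  by case: (cP s) => _ _ -> _.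
have zsub m' := decomposable_subspace N m'.
have c0 (i : 'I_r.+1) s : i%:Z = m - 1 - g s -> c s = 0.
  move=> is_; case: (uF) => _ _ indep _.
  pose c' s := if i%:Z == m - 1 - g s then c s else 0.
  suff : c' s = 0 by rewrite /c' is_ eqxx.
  apply: (indep (m - i%:Z - 1)) => [t gt|].
    by rewrite /c'; case: eqP => // it; case: gt; lia.
  rewrite (_ : \sum_s _ = kscale (-1) (\sum_s kscale 1 ((e s i * tx T) *: u s)) + 0).
    apply: (zsub _).2; last exact: (zsub _).1.
    apply: subspace_sum => // t _.
    rewrite (_ : _ - 1 = m - 1 - g t - i%:Z - 1 + 1 + g t); last by lia.
    by case: (cP t) => ed ee _ _; apply: frame_decomposable.
  rewrite kscaleN1 addr0; apply/eqP; rewrite -addr_eq0 -big_split /=; apply/eqP.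
  rewrite -[RHS](aP i); apply: eq_bigr => t _; rewrite kscale1 /a /c'.
  by case: ifP; rewrite ?kscale0l.
move=> s; case: (cP s) => _ _ _; apply=> [i|i]; last exact: c0.
apply: (IH (m - i%:Z - 1) (fun s => e s i)); first by lia.
- move=> t; case: (cP t) => ed _ _ _.
  by rewrite (_ : _ - g t = m - 1 - g t - i%:Z - 1) //; lia.
- by move=> t; case: (cP t).
rewrite -[RHS](aP i); apply: eq_bigr => t _; rewrite /a.
case: eqP => [it|_]; last by rewrite add0r.
by rewrite (c0 i t it) kscale0l add0r.
Qed.

(** The submodule generated by the elements [x u_s] is free on them: after passing
    to homogeneous coefficients, [td_sep] reduces this to coefficients in [e D]. *)
Lemma frame_inj (d : 'I_n -> D) :
  \sum_s (d s * tx T) *: u s = 0 -> forall s, d s = 0.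
Proof.
move=> d0 s; apply: dpart_eq0 => j; apply: (@td_sep _ _ _ T) => q b bq.
set m := j + g s + 1.
have xu t : gmdeg (g t + 1) (tx T *: u t).
  by rewrite addrC; apply/gmdegZ/ug/tx_deg.
have h0 : \sum_t dpart (m - (g t + 1)) (d t) *: (tx T *: u t) = 0.
  transitivity (gpart m (\sum_t (d t * tx T) *: u t)); last by rewrite d0 gpart0.
  rewrite -(gpart_cmb _ _ xu); congr gpart.
  by apply: eq_bigr => t _; rewrite scalerA.
have b0 : \sum_t (te T * b * dpart (m - (g t + 1)) (d t) * tx T) *: u t = 0.
  transitivity ((te T * b) *: \sum_t dpart (m - (g t + 1)) (d t) *: (tx T *: u t)).
    by rewrite scaler_sumr; apply: eq_bigr => t _; rewrite !scalerA.
  by rewrite h0 scaler0.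
rewrite (_ : j = m - (g s + 1)); last by rewrite /m; lia.
pose q0 : nat := absz (q + m - N)%R.
apply: (@frame_inj_e q0 (q + m) _ _ _ _ b0) => [|t|t]; first by rewrite /q0; lia.
- rewrite (_ : _ - g t = 0 + q + (m - (g t + 1))); last by lia.
  by apply/gdegM/dpart_homog/gdegM/bq/te_deg.
- by rewrite !mulrA tee.
Qed.

Lemma frame_span_e (q : nat) m v : N <= m -> m <= N + q%:Z -> gmdeg m v ->
  exists (c : 'I_n -> k) (d : 'I_n -> D), (forall s, g s <> m -> c s = 0) /\
    te T *: v = \sum_s (kscale (c s) (u s) + (d s * tx T) *: u s).
Proof.
elim/ltn_ind: q m v => q IH m v mN mq vm.
case: (uF) => _ _ _ /(_ m v mN vm) [c [cm [a [ad a0 E]]]].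
have /choice [f fP] (i : 'I_r.+1) : exists f : 'I_n -> D,
    (tw T i * tx T) *: a i = \sum_s (f s * tx T) *: u s.
  have [iN|iN] := ltrP (m - i%:Z - 1) N.
    exists (fun=> 0); rewrite a0 // scaler0 big1 // => s _.
    by rewrite mul0r scale0r.
  have qq : (q.-1 < q)%N by lia.
  have mq' : m - i%:Z - 1 <= N + q.-1%:Z by lia.
  have [c' [d' [_ E']]] := IH _ qq _ _ iN mq' (ad i).
  exists (fun s => c' s *: tw T i + tw T i * tx T * d' s).
  rewrite -{1}(txe T) mulrA -scalerA E' scaler_sumr; apply: eq_bigr => s _.
  rewrite scalerDr mulrDl [RHS]scalerDl; congr (_ + _); last by rewrite scalerA !mulrA.
  by rewrite -scalerAl scale_kscale.
exists c, (fun s => \sum_i f i s); split=> //.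
apply/eqP; rewrite big_split /= [X in _ == X]addrC -subr_eq E; apply/eqP.
rewrite /zsum (eq_bigr _ (fun i _ => fP i)) exchange_big.
by apply: eq_bigr => s _; rewrite mulr_suml scaler_suml.
Qed.

(** It has finite codimension: coefficients of high degree factor through [x = x e]
    by [td_x], and [e M] in high degrees is reached by [frame_span_e]. *)
Lemma frame_span : finitely_presented M -> exists L, forall m v, L <= m ->
  gmdeg m v -> exists d : 'I_n -> D, v = \sum_s (d s * tx T) *: u s.
Proof.
move=> [p [b [y [_ [_ [_ [yb _ ygen _]]]]]]].
have [K KP] := int_bound g; have [B BP] := int_bound b.
(* After removing a left factor of degree at most [r + 1], the degree must still
   exceed [N] and all the degrees [g s]. *)
exists (`|N| + `|K| + `|B| + r%:Z + 2).
move=> m v mL vm; have [e ed ->] := homog_cmb yb vm (ygen v).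
suff /choice [d dP] l : exists d : 'I_n -> D,
    e l *: y l = \sum_s (d s * tx T) *: u s.
  exists (fun s => \sum_l d l s); rewrite (eq_bigr _ (fun l _ => dP l)) exchange_big.
  by apply: eq_bigr => s _; rewrite mulr_suml scaler_suml.
have bB := BP l; have [n' n'E] : exists n' : nat, m - b l = n'%:Z.
  by exists `|m - b l|%N; lia.
have el := ed l; rewrite n'E in el.
apply: (@td_x _ _ _ T n' _ _ el (fun a => exists d : 'I_n -> D,
    a *: y l = \sum_s (d s * tx T) *: u s)) => [||a a' [d E] [d' E']|i f c cd].
- by lia.
- by exists (fun=> 0); rewrite scale0r big1 // => s _; rewrite mul0r scale0r.
- exists (fun s => d s + d' s); rewrite scalerDl E E' -big_split.
  by apply: eq_bigr => s _; rewrite mulrDl scalerDl.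
have ir := ltn_ord i.
have [|||c' [d' [c0 E]]] := @frame_span_e (absz (m - N)%R) (m - i%:Z - 1) (c *: y l).
- by lia.
- by lia.
- rewrite (_ : m - i%:Z - 1 = n'%:Z - i%:Z - 1 + b l); last by lia.
  exact: gmdegZ.
exists (fun s => f * tx T * d' s).
rewrite -scalerA -{1}(txe T) mulrA -[LHS]scalerA E scaler_sumr.
apply: eq_bigr => s _; rewrite c0 ?kscale0l ?add0r ?scalerA ?mulrA ?txe //.
by have := KP s; lia.
Qed.
End Frame.

Section FrameExists.
Variables (k : fieldType) (D : graded_algebra k) (r : nat) (T : tail_data D r).

(** Decomposable elements are complemented by bases in degrees [N, ..., N + r];
    beyond these, [tail_gen] makes every element decomposable. *)
Lemma frame_ex (M : gmod D) N : finitely_presented M -> tail_gen T M N ->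
  exists (n : nat) (u : 'I_n -> M) (g : 'I_n -> int), frame T N u g.
Proof.
move=> Mfp MG; pose deg (i : 'I_r.+1) : int := N + i%:Z.
have LE i : exists L : seq M, (forall v, v \in L -> edeg T (deg i) v) /\
    forall v, gmdeg (deg i) v -> exists c : nat -> k,
      te T *: v = \sum_(j < size L) kscale (c j) L`_j.
  have [L [Lm LP]] := fp_finite T Mfp (deg i).
  exists [seq te T *: v | v <- L]; split.
    by move=> _ /mapP [v /Lm vm ->]; exact: edeg_te.
  move=> v /LP [c ->]; exists c; rewrite size_map scaler_sumr.
  by apply: eq_bigr => j _; rewrite (nth_map 0) // kscale_scale.
have /choice [L LP] := LE.
pose good i n (b : 'I_n -> M) := [/\ forall j, edeg T (deg i) (b j),
    forall v, gmdeg (deg i) v -> exists c : 'I_n -> k,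
      decomposable T N (deg i) (te T *: v - \sum_j kscale (c j) (b j)) &
    forall c : 'I_n -> k, decomposable T N (deg i) (\sum_j kscale (c j) (b j)) -> forall j, c j = 0].
have bE i : exists n (b : 'I_n -> M), good i n b.
  have [LI LS] := LP i; have ZS := decomposable_subspace T M N (deg i).
  have [n [b [bL Lb bI]]] := extract_basis (L i) ZS.
  exists n, b; split=> // [j|v /LS [c ->]]; first exact/LI/bL.
  have /choice [e eP] (j : 'I_(size (L i))) : exists e : 'I_n -> k,
      decomposable T N (deg i) ((L i)`_j - \sum_l kscale (e l) (b l)).
    have [|e [z [zZ ->]]] := Lb (L i)`_j; first exact: mem_nth.
    by exists e; rewrite addrK.
  exists (fun l => \sum_(j < size (L i)) c j * e j l).
  rewrite (_ : _ - _ = \sum_(j < size (L i))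
      kscale (c j) ((L i)`_j - \sum_l kscale (e j l) (b l))); first exact: subspace_sum.
  under [RHS]eq_bigr => j _ do rewrite kscaleDr -kscaleN1 kscaleA mulrC -kscaleA kscaleN1.
  rewrite sumrB; congr (_ - _).
  under [RHS]eq_bigr => j _ do rewrite kscale_sumr.
  rewrite exchange_big; apply: eq_bigr => l _; rewrite kscale_suml.
  by apply: eq_bigr => j _; rewrite kscaleA.
pose n i := sval (cid (bE i)).
have bE' i : exists b : 'I_(n i) -> M, good i (n i) b := svalP (cid (bE i)).
pose b i := sval (cid (bE' i)).
have bP i : good i (n i) (b i) := svalP (cid (bE' i)).
pose I : finType := {i : 'I_r.+1 & 'I_(n i)}.
pose tg i j : I := existT _ i j.
pose v (t : I) : M := b (tag t) (tagged t).
have R (F : I -> M) : \sum_(s < #|I|) F (enum_val s) = \sum_i \sum_j F (tg i j).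
  rewrite sig_big_dep /= (reindex (@enum_val I predT)) /=; last first.
    by exists enum_rank => s _; rewrite ?enum_valK ?enum_rankK.
  by apply: eq_bigr => s _; case: (enum_val s).
exists #|I|, (fun s => v (enum_val s)), (fun s => deg (tag (enum_val s))).
have sumI (c : I -> k) i : (forall t, tag t != i -> c t = 0) ->
    \sum_(s < #|I|) kscale (c (enum_val s)) (v (enum_val s)) =
    \sum_j kscale (c (tg i j)) (b i j).
  move=> c0; rewrite (R (fun t => kscale (c t) (v t))) (bigD1 i) //= [X in _ + X]big1 ?addr0 //.
  by move=> i' ii'; rewrite big1 // => j _; rewrite c0 ?kscale0l.
split=> [s|s|m c cm cZ s|m x mN xm].
- by case: (bP (tag (enum_val s))) => H _ _; exact: H.
- by rewrite /deg lerDl.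
- have [E|/cm //] := EM (deg (tag (enum_val s)) = m).
  rewrite -[s]enum_valK; case: (enum_val s) E => i j /= E.
  pose c' t := c (enum_rank t).
  have c'0 t : tag t != i -> c' t = 0.
    move=> ti; apply: cm; rewrite enum_rankK -E /deg => /addrI [].
    by move/val_inj/eqP; rewrite (negbTE ti).
  have := sumI c' i c'0; rewrite /c'.
  under eq_bigr => s' _ do rewrite enum_valK.
  by move=> E'; move: cZ; rewrite E' -E; case: (bP i) => _ _ /[apply] /(_ j).
have [mr|mr] := lerP m (N + r%:Z); last first.
  exists (fun=> 0); split=> //; rewrite big1 ?subr0 => [|s _]; last by rewrite kscale0l.
  have [u um uE] := MG _ _ mN xm; exists u; split=> // i iN.
  by have := ltn_ord i; lia.
have ilt : (absz (m - N)%R < r.+1)%N by lia.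
have mE : m = deg (Ordinal ilt) by rewrite /deg /=; lia.
set i := Ordinal ilt in mE; rewrite {}mE in mN mr xm *.
have [_ /(_ x xm) [c cP] _] := bP i.
have ce (t : I) : exists e : k, (forall j, t = tg i j -> e = c j) /\ (tag t != i -> e = 0).
  case: t => i' j; have [ii|ii] := eqVneq i' i; last first.
    by exists 0; split=> // j' E; case/eqP: ii; move: E => /(congr1 (@tag _ _)).
  move: j; rewrite ii => j; exists (c j); split=> [j' /eqP|]; last by move=> /eqP [].
  by rewrite eq_Tagged /= => /eqP ->.
have /choice [e eP] := ce.
exists (fun s => e (enum_val s)); split.
  move=> s sm; apply: (eP _).2; apply/eqP => E; apply: sm; rewrite E //.
rewrite (sumI e i) => [|t]; last exact: (eP t).2.
rewrite (eq_bigr (fun j => kscale (c j) (b i j))) // => j _.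
by rewrite ((eP (tg i j)).1 j erefl).
Qed.

Lemma regular_tail_free N : tail_free T (regular_gmod D) N.
Proof. by move=> m u _ um uz; exact: td_free_int um uz. Qed.

Lemma regular_kscale c (a : regular_gmod D) : kscale c a = c *: (a : D).
Proof. by transitivity ((c *: 1 : D) * (a : D)) => //; rewrite -scalerAl mul1r. Qed.

(** This frame starts at [N = 0], below the degrees where [tail_gen] holds: the
    elements [w_0, ..., w_r] make up for the difference. *)
Lemma regular_frame :
  frame T (M := regular_gmod D) 0 (fun s : 'I_r.+1 => tw T s : D^o) (fun s => (s : nat)%:Z).
Proof.
split=> [s|s|m c cm [a [ad a0 E]] s|m v m0 vm].
- by split; [exact: tw_deg|exact: tew].
- by [].
- have [sm|/cm //] := EM (s%:Z = m).
  have cs : \sum_t kscale (c t) (tw T t : regular_gmod D) = c s *: tw T s.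
    rewrite (bigD1 s) //= regular_kscale big1 ?addr0 // => t ts.
    rewrite cm ?kscale0l // => tm; case/eqP: ts; apply: val_inj.
    by move: tm; rewrite -sm => -[].
  move: E; rewrite {}cs => E.
  have [] := @td_free _ _ _ T s (c s) (fun i => - (a i : D)).
  + by move=> i; apply: gdegN; rewrite sm; exact: ad.
  + rewrite E /zsum; under [X in _ + X]eq_bigr => i _ do rewrite mulrN.
    by rewrite sumrN; exact: subrr.
  move=> cs _; apply/eqP; have := @tw_neq0 _ _ _ T s (ltn_ord s).
  by move: cs => /eqP; rewrite scaler_eq0 => /orP[// |/eqP].
have [d [c [dd _ c0 E]]] := td_gen_int T vm.
have [n mE] : exists n : nat, m = n%:Z by exists `|m|%N; lia.
exists (fun s : 'I_r.+1 => if s == n :> nat then c else 0); split=> [s|].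
  by case: eqP => // -> /=; rewrite mE.
exists d; split=> // [i im|]; first exact: (td_neg T im (dd i)).
apply/eqP; rewrite subr_eq addrC; apply/eqP; rewrite [LHS]E mE /=; congr (_ + _).
have [nr|nr] := ltnP n r.+1.
  rewrite (bigD1 (Ordinal nr)) //= eqxx regular_kscale big1 ?addr0 // => s sn.
  case: eqP => [En|_]; last by rewrite kscale0l.
  by case/eqP: sn; apply: val_inj.
rewrite tw_big // scaler0 big1 // => s _.
case: eqP => [En|_]; last by rewrite kscale0l.
by have := ltn_ord s; lia.
Qed.
End FrameExists.

(** * Isomorphisms up to finite dimensional modules *)

Section Serre.
Variables (k : fieldType) (D : graded_algebra k).

Lemma seq_bound (s : seq int) : exists K : int, forall i, i \in s -> i < K.
Proof.
elim: s => [|j s [K KP]]; first by exists 0.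
exists (Num.max K (j + 1)) => i; rewrite inE lt_max => /orP[/eqP ->|/KP -> //].
by rewrite orbC; apply/orP; left; lia.
Qed.

Lemma gpart_bounded (M : gmod D) (v : M) : exists L : int, forall m, L <= m -> gpart m v = 0.
Proof.
have [s [us s0]] := covers_ex (gmodP M).1 v; have [K KP] := seq_bound s.
exists K => m Km; apply: s0; apply/negP => /KP; lia.
Qed.

Lemma fdim_bounded (M : gmod D) : finite_dimensional M ->
  exists L : int, forall m (v : M), L <= m -> gmdeg m v -> v = 0.
Proof.
case=> n [x xP]; have /choice [L LP] i := gpart_bounded (x i).
have [K KP] := int_bound L; exists K => m v Km vm.
rewrite -(gpart_id vm); have [c ->] := xP v; rewrite gpart_sum big1 // => i _.
rewrite -[m]add0r gpartZ; last by apply/gdegZ/gdeg1.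
by rewrite LP ?scaler0 //; have := KP i; lia.
Qed.

(** A morphism whose categorical kernel and cokernel are finite dimensional is
    bijective in high degrees: test the kernel on the modules [D(-m)], and compare
    the cokernel with the set-theoretic one. *)
Lemma Serre_iso_bij (X Y : gr D) (s : Hom X Y) : Serre_iso (@fdim k D) s ->
  exists L : int, forall m, L <= m ->
    (forall x, gmdeg m x -> sval (s : ghom X Y) x = 0 -> x = 0) /\
    (forall y, gmdeg m y -> exists2 x, gmdeg m x & y = sval (s : ghom X Y) x).
Proof.
case=> -[K [i [[_ iP] /fdim_bounded [A AP]]]] [Q [p [[_ pP] /fdim_bounded [B BP]]]].
exists (Num.max A B) => m; rewrite ge_max => /andP[Am Bm]; split=> [x xm sx|y ym].
  pose h : @Hom (gr D) (free_obj D (fun _ : 'I_1 => m)) X := free_map (fun=> xm).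
  have /iP [u [uE _]] : zero_morphism (h ;; s).
    apply/gr_zero_morphism => d /=; rewrite ghom_sum big1 // => j _.
    by rewrite ghomZ sx scaler0.
  have := congr1 (fun g : ghom _ X => sval g (fbas D (fun _ : 'I_1 => m) ord0)) uE.
  rewrite free_map_bas /= (AP m (sval (u : ghom _ K) _) Am) ?ghom0 //.
  apply: (ghom_deg (u : ghom _ K)); exact: fbas_deg.
have [u [uE _]] := pP _ _ (coker_is_cokernel s).1.
have : coker_pi s y = 0.
  have := congr1 (fun g : ghom Y _ => sval g y) uE => /= E; rewrite -[LHS]E.
  rewrite (BP m (sval (p : ghom Y Q) y)) //; last exact: ghom_deg.
  exact: (ghom0 (u : ghom Q (coker_obj s))).
move=> /coker_pi_eq0 [x y_wordE]; exists (gpart m x); first exact: gpart_homog.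
by rewrite -ghom_gpart -y_wordE gpart_id.
Qed.

Definition kspan (M : gmod D) (L : seq M) (v : M) :=
  exists c : nat -> k, v = \sum_(i < size L) kscale (c i) L`_i.

Lemma kspan_cat (M : gmod D) (L L' : seq M) v v' :
  kspan L v -> kspan L' v' -> kspan (L ++ L') (v + v').
Proof.
case=> c -> [c' ->].
exists (fun j => if (j < size L)%N then c j else c' (j - size L)%N).
rewrite size_cat big_split_ord /=; congr (_ + _); apply: eq_bigr => j _.
  by rewrite nth_cat ltn_ord.
by rewrite nth_cat ltnNge leq_addr /= addKn.
Qed.

Lemma fdim_zero_gr : fdim (zero_gr D).
Proof.
exists 0%N, (fun=> 0) => y; exists (fun=> 0).
by rewrite big_ord0; exact: zero_gr0.
Qed.

Variables (r : nat) (T : tail_data D r).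

(** A finitely presented module is bounded below with finite dimensional parts, so
    only finitely many degrees contribute to the quotient. *)
Lemma coker_fdim (X Y : gr D) (f : Hom X Y) L :
  (forall m y, L <= m -> gmdeg m y -> gim f y) -> fdim (coker_obj f).
Proof.
move=> fL; have [A AP] := fp_bounded T (grmodP Y).
pose t := [seq A + i%:Z | i <- iota 0 `|L - A|].
have tP m : A <= m -> m < L -> m \in t.
  move=> Am mL; apply/mapP; exists `|m - A|%N; last by lia.
  by rewrite mem_iota; lia.
have ut : uniq t by rewrite map_inj_uniq ?iota_uniq // => i j /addrI [].
have [S SP] : exists S, forall y : grmod Y, kspan S (\sum_(m <- t) gpart m y).
  elim: t {tP ut} => [|m t [S IH]].
    by exists [::] => y; exists (fun=> 0); rewrite big_nil big_ord0.
  have [S' [_ S'P]] := fp_finite T (grmodP Y) m.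
  exists (S' ++ S) => y; rewrite big_cons; apply: kspan_cat => //.
  exact/S'P/gpart_homog.
exists (size S), (fun i => coker_pi f S`_i).
elim/quot_ind=> y; have [c y_wordE] := SP y; exists c.
have -> : quot_pi (gim_sub f) y = coker_pi f (\sum_(m <- t) gpart m y).
  apply/subr0_eq; rewrite -/(coker_pi f y) -coker_piN -coker_piD.
  apply/coker_pi_eq0; set w := y - _.
  have wE m : gpart m w = if m \in t then 0 else gpart m y.
    rewrite /w gpartB gpart_sum (eq_bigr _ (fun j _ => gpart_gpart m j y)).
    case: ifP => mt; last first.
      rewrite big1_seq ?subr0 // => j /= jt.
      by case: eqP => // mj; rewrite mj jt in mt.
    rewrite (bigD1_seq m) //= eqxx big1 ?addr0 ?subrr // => j /negbTE jm.
    by rewrite eq_sym jm.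
  have [s ->] := gpart_sumE w; elim/big_rec: _ => [|m x _]; first exact: gim0.
  apply: gimD; rewrite wE; case: ifP => mt; first exact: gim0.
  have [mA|mA] := ltrP m A; first by rewrite (AP m (gpart m y) mA (gpart_homog m y)); exact: gim0.
  have [mL|mL] := ltrP m L; first by rewrite tP in mt.
  exact: fL mL (gpart_homog _ _).
by rewrite y_wordE coker_pi_sum; apply: eq_bigr => i _; rewrite coker_piZ.
Qed.

Section FrameIso.
Variables (M : gr D) (N : int) (n : nat) (u : 'I_n -> grmod M) (g : 'I_n -> int).
Hypotheses (MT : tail_free T M N) (uF : frame T N u g).

Fact frame_tx_deg s : gmdeg (g s + 1) (tx T *: u s).
Proof. by rewrite addrC; apply/gmdegZ; [exact: tx_deg|case: uF => /(_ s) []]. Qed.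

Definition frame_map : @Hom (gr D) (free_obj D (fun s => g s + 1)) M :=
  free_map frame_tx_deg.

Lemma frame_Serre_iso : Serre_iso (@fdim k D) frame_map.
Proof.
have fE (d : free_gmod D (fun s => g s + 1)) :
    sval (frame_map : ghom _ M) d = \sum_s ((d s : D) * tx T) *: u s.
  by apply: eq_bigr => s _; rewrite scalerA.
split.
  exists (zero_gr D), (zero_map (zero_gr D) (free_obj D (fun s => g s + 1))).
  split; last exact: fdim_zero_gr.
  apply: gr_injective_kernel => d; rewrite fE => /(frame_inj MT uF) d0.
  by apply/ffunP => s; rewrite ffunE; exact: d0.
exists (coker_obj frame_map), (coker_map frame_map); split.
  exact: coker_is_cokernel.
have [L LP] := frame_span uF (grmodP M).
apply: (@coker_fdim _ _ _ L) => m y Lm /(LP _ _ Lm) [d ->].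
exists (finfun (d : 'I_n -> D^o)); rewrite fE.
by apply: eq_bigr => s _; rewrite ffunE.
Qed.
End FrameIso.

(** A frame that starts in a high degree yields generators in high degrees, as
    [zz_lift] requires. *)
Lemma free_resolution (M : gr D) (N : int) :
  exists (n : nat) (a : 'I_n -> int) (f : @Hom (gr D) (free_obj D a) M),
    (forall s, N <= a s) /\ Serre_iso (@fdim k D) f.
Proof.
have [N0 [MG MF]] := fp_tail T (grmodP M); pose N1 := Num.max N N0.
have N01 m : N1 <= m -> N0 <= m by rewrite ge_max => /andP[].
have [|n [u [g uF]]] := @frame_ex _ _ _ T M N1 (grmodP M).
  by move=> m v /N01; exact: MG.
have MF1 : tail_free T M N1 by move=> m v /N01; exact: MF.
exists n, (fun s => g s + 1), (frame_map uF); split; last exact: frame_Serre_iso.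
move=> s; case: uF => _ /(_ s) gs _ _; rewrite (@le_trans _ _ N1) //.
  by rewrite le_max lexx.
by rewrite (le_trans gs) // lerDl.
Qed.
End Serre.

(** * Morphisms of qgr as relations in high degrees *)

Definition eventually (P : int -> Prop) := exists L, forall n, L <= n -> P n.

Lemma eventually_and P Q : eventually P -> eventually Q -> eventually (fun n => P n /\ Q n).
Proof.
case=> L PL [K QK]; exists (Num.max L K) => n; rewrite ge_max => /andP[nL nK].
by split; [exact: PL|exact: QK].
Qed.

Lemma eventually_impl (P Q : int -> Prop) : (forall n, P n -> Q n) -> eventually P -> eventually Q.
Proof. by move=> PQ [L PL]; exists L => n /PL; exact: PQ. Qed.

Section Germs.
Variables (k : fieldType) (D : graded_algebra k).

Local Notation W := (@Serre_iso (gr D) (@fdim k D)).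
Local Notation qgrD := (Serre_quotient (@fdim k D)).

(** A formal inverse is a map in high degrees only, so that a zigzag defines a
    linear relation in every degree, which is a map from some degree on. *)
Fixpoint zz_rel (X Y : gr D) (f : zigzag W X Y) : int -> grmod X -> grmod Y -> Prop :=
  match f with
  | zz_of X Y f => fun n x y => gmdeg n x /\ y = sval (f : ghom X Y) x
  | zz_inv X Y s _ => fun n y x => gmdeg n x /\ y = sval (s : ghom X Y) x
  | zz_comp X Y Z f g => fun n x z => exists2 y, zz_rel f n x y & zz_rel g n y z
  end.

Lemma zz_rel_deg X Y (f : zigzag W X Y) n x y : zz_rel f n x y -> gmdeg n x /\ gmdeg n y.
Proof.
elim: f x y => {X Y} [X Y f|X Y s _|X Y Z f IHf g IHg] x y /=.
- by case=> xn ->; split=> //; exact: ghom_deg.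
- by case=> yn ->; split=> //; exact: ghom_deg.
by case=> z /IHf [xn _] /IHg [_ yn].
Qed.

Lemma zz_rel0 X Y (f : zigzag W X Y) n : zz_rel f n 0 0.
Proof.
elim: f => {X Y} [X Y f|X Y s _|X Y Z f IHf g IHg] /=; last by exists 0.
  by split; [exact: gmdeg0|rewrite ghom0].
by split; [exact: gmdeg0|rewrite ghom0].
Qed.

Lemma zz_relD X Y (f : zigzag W X Y) n x x' y y' :
  zz_rel f n x y -> zz_rel f n x' y' -> zz_rel f n (x + x') (y + y').
Proof.
elim: f x x' y y' => {X Y} [X Y f|X Y s _|X Y Z f IHf g IHg] x x' y y' /=.
- by case=> xn -> [xn' ->]; split; [exact: gmdegD|rewrite ghomD].
- by case=> xn -> [xn' ->]; split; [exact: gmdegD|rewrite ghomD].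
by case=> z fz gz [z' fz' gz']; exists (z + z'); [exact: IHf|exact: IHg].
Qed.

Lemma zz_relZ X Y (f : zigzag W X Y) i n a x y : gdeg i a ->
  zz_rel f n x y -> zz_rel f (i + n) (a *: x) (a *: y).
Proof.
move=> ai; elim: f x y => {X Y} [X Y f|X Y s _|X Y Z f IHf g IHg] x y /=.
- by case=> xn ->; split; [exact: gmdegZ|rewrite ghomZ].
- by case=> xn ->; split; [exact: gmdegZ|rewrite ghomZ].
by case=> z fz gz; exists (a *: z); [exact: IHf|exact: IHg].
Qed.

Lemma zz_rel_kscale X Y (f : zigzag W X Y) n c x y :
  zz_rel f n x y -> zz_rel f n (kscale c x) (kscale c y).
Proof. by move=> xy; rewrite -[n]add0r; apply: zz_relZ xy; apply/gdegZ/gdeg1. Qed.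

Lemma zz_relB X Y (f : zigzag W X Y) n x x' y y' :
  zz_rel f n x y -> zz_rel f n x' y' -> zz_rel f n (x - x') (y - y').
Proof. by move=> xy /(zz_rel_kscale (-1)); rewrite !kscaleN1; exact: zz_relD. Qed.

Lemma zz_rel_fun X Y (f : zigzag W X Y) : eventually (fun n =>
  (forall x, gmdeg n x -> exists y, zz_rel f n x y) /\ (forall y, zz_rel f n 0 y -> y = 0)).
Proof.
elim: f => {X Y} [X Y f|X Y s Ws|X Y Z f IHf g IHg].
- exists 0 => n _ /=; split=> [x xn|y [_ ->]]; last exact: ghom0.
  by exists (sval (f : ghom X Y) x).
- have [L LP] := Serre_iso_bij Ws; exists L => n /LP [sI sS]; split=> /=.
    by move=> y /sS [x xn y_wordE]; exists x.
  by move=> x [xn /esym]; exact: sI.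
apply: eventually_impl (eventually_and IHf IHg) => n [[ft ff] [gt gf]]; split=> /= [x /ft [y xy]|z].
  by have [_ /gt [z yz]] := zz_rel_deg xy; exists z, y.
by case=> y /ff ->; exact: gf.
Qed.

(** A morphism of qgr therefore has well-defined relations in high degrees: the
    defining congruences hold there because morphisms in [W] are bijective. *)
Lemma zz_rel_sound X Y (f g : zigzag W X Y) : zz_eq f g ->
  eventually (fun n => forall x y, zz_rel f n x y <-> zz_rel g n x y).
Proof.
have now (P : int -> Prop) : (forall n, P n) -> eventually P by move=> Pn; exists 0 => n _.
elim=> {X Y f g}.
- by move=> X Y f; exact: now.
- by move=> X Y f g _; apply: eventually_impl => n fg x y; split=> /fg.
- move=> X Y f g h _ fg _ gh; apply: eventually_impl (eventually_and fg gh) => n [{}fg {}gh] x y.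
  by rewrite fg.
- move=> X Y Z f f' g g' _ ff _ gg; apply: eventually_impl (eventually_and ff gg) => n [{}ff {}gg] x z.
  by split=> -[y /ff xy /gg yz]; exists y.
- move=> X Y Z U f g h; apply: now => n x u /=; split.
    by case=> y fy [z gz hu]; exists z => //; exists y.
  by case=> z [y fy gz] hu; exists y => //; exists z.
- move=> X Y f; apply: now => n x y /=; split=> [[z [xn ->] //]|xy].
  by exists x => //; split=> //; case: (zz_rel_deg xy).
- move=> X Y f; apply: now => n x y /=; split=> [[z xz [_ ->] //]|xy].
  by exists y => //; split=> //; case: (zz_rel_deg xy).
- move=> X Y Z f g; apply: now => n x z /=; split=> [[xn ->]|].
    by eexists; split=> //; exact: ghom_deg.
  by case=> y [xn ->] [_ ->].
- move=> X Y s Ws; have [L LP] := Serre_iso_bij Ws; exists L => n /LP [sI _] x y /=.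
  split=> [[z [xn zE] [yn]]|[xn ->]]; last by eexists; split=> //.
  rewrite {}zE => /eqP; rewrite -subr_eq0 -ghomB => /eqP /sI E.
  by split=> //; apply/esym/subr0_eq/E; exact: gmdegB.
move=> X Y s Ws; have [L LP] := Serre_iso_bij Ws; exists L => n /LP [_ sS] x y /=.
split=> [[z [zn ->] [_ ->]]|[/sS [z zn xE] ->]]; first by split=> //; exact: ghom_deg.
by exists z.
Qed.

Definition loc_rel (X Y : gr D) (f : @Hom qgrD X Y) := zz_rel (crepr f).

Lemma loc_rel_pi X Y (f : zigzag W X Y) :
  eventually (fun n => forall x y, loc_rel (loc_pi f) n x y <-> zz_rel f n x y).
Proof. by apply: zz_rel_sound; apply: crepr_pi; exact: zz_refl. Qed.

Lemma loc_rel_of X Y (f : @Hom (gr D) X Y) : eventually (fun n => forall x y,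
  loc_rel (loc_of W f) n x y <-> gmdeg n x /\ y = sval (f : ghom X Y) x).
Proof. exact: loc_rel_pi. Qed.

Lemma loc_rel_comp (X Y Z : gr D) (f : @Hom qgrD X Y) (g : @Hom qgrD Y Z) :
  eventually (fun n => forall x z, loc_rel (f ;; g) n x z <-> exists2 y, loc_rel f n x y & loc_rel g n y z).
Proof. exact: loc_rel_pi (zz_comp (crepr f) (crepr g)). Qed.

(** On a free module with generators in high degrees, a morphism of qgr is an
    honest morphism of graded modules: formal inverses are resolved by lifting the
    generators through a morphism that is surjective in these degrees. *)
Lemma zz_lift (X Y : gr D) (f : zigzag W X Y) : exists N : int,
  forall n (a : 'I_n -> int) (h : @Hom (gr D) (free_obj D a) X), (forall s, N <= a s) ->
  exists g : @Hom (gr D) (free_obj D a) Y,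
    loc_comp (loc_of W h) (loc_pi f) = loc_of W g /\
    forall m v, gmdeg m v -> zz_rel f m (sval (h : ghom _ X) v) (sval (g : ghom _ Y) v).
Proof.
elim: f => {X Y} [X Y f|X Y s Ws|X Y Z f [N IHf] g [K IHg]].
- exists 0 => n a h _; exists (h ;; f); split; first by rewrite (loc_ofM W h f).
  by move=> m v vm /=; split=> //; exact: ghom_deg.
- have [N NP] := Serre_iso_bij Ws; exists N => n a h aN.
  have /choice [y yP] t : exists y, gmdeg (a t) y /\
      sval (h : ghom _ Y) (fbas D a t) = sval (s : ghom X Y) y.
    have [_ /(_ (sval (h : ghom _ Y) (fbas D a t)))] := NP _ (aN t).
    by case=> [|y]; [apply/ghom_deg/fbas_deg|exists y].
  have ya t : gmdeg (a t) (y t) by case: (yP t).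
  pose g : @Hom (gr D) (free_obj D a) X := free_map ya.
  have hE : h = g ;; s.
    apply: free_ext => t; rewrite (yP t).2.
    by apply/esym; exact: (congr1 _ (free_map_bas ya t)).
  exists g; split=> [|m v vm].
    rewrite hE [loc_of _ _](loc_ofM W g s).
    rewrite -(loc_compA (loc_of W g)) (loc_pi_comp _ (zz_inv Ws)).
    by rewrite (_ : loc_pi _ = loc_pi (zz_of W (idm X))) ?loc_compf1 //; apply/loc_piP/zz_invr.
  by split; [exact: (ghom_deg (g : ghom _ X))|rewrite hE].
exists (Num.max N K) => n a h aN.
have aN1 t : N <= a t by move: (aN t); rewrite ge_max => /andP[].
have aN2 t : K <= a t by move: (aN t); rewrite ge_max => /andP[].
have [u [uE uP]] := IHf _ _ h aN1; have [v [vE vP]] := IHg _ _ u aN2.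
exists v; split; first by rewrite -loc_pi_comp loc_compA uE.
move=> m x xm /=; exists (sval (u : ghom _ Y) x); [exact: uP|exact: vP].
Qed.

Lemma loc_lift (X Y : gr D) (f : @Hom qgrD X Y) : exists N : int,
  forall n (a : 'I_n -> int) (h : @Hom (gr D) (free_obj D a) X), (forall s, N <= a s) ->
  exists g : @Hom (gr D) (free_obj D a) Y,
    (loc_of W h : @Hom qgrD _ _) ;; f = loc_of W g /\
    forall m v, gmdeg m v -> loc_rel f m (sval (h : ghom _ X) v) (sval (g : ghom _ Y) v).
Proof. by have := zz_lift (crepr f); rewrite (_ : loc_pi _ = f); last exact: creprK. Qed.

Lemma loc_Serre_inv (X Y : gr D) (s : @Hom (gr D) X Y) : W s ->
  exists t : @Hom qgrD Y X,
    (loc_of W s : @Hom qgrD _ _) ;; t = idm _ /\ t ;; (loc_of W s : @Hom qgrD _ _) = idm _.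
Proof.
move=> Ws; exists (loc_pi (zz_inv Ws)); split.
  by apply: etrans (loc_pi_comp _ _) _; apply/loc_piP/zz_invr.
by apply: etrans (loc_pi_comp _ _) _; apply/loc_piP/zz_invl.
Qed.

Variables (r : nat) (T : tail_data D r).

(** Precompose with a resolution by a free module in high degrees: both morphisms
    become honest ones, which agree on generators. *)
Lemma loc_faithful (X Y : gr D) (f g : @Hom qgrD X Y) :
  eventually (fun n => forall x y, loc_rel f n x y -> loc_rel g n x y) -> f = g.
Proof.
case=> K fg; have [N NP] := loc_lift f; have [N' NP'] := loc_lift g.
have [L LP] := zz_rel_fun (crepr g).
have [n [a [s [aN sW]]]] := free_resolution T X (Num.max (Num.max N N') (Num.max L K)).
have aNt t : [/\ N <= a t, N' <= a t, L <= a t & K <= a t].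
  by move: (aN t); rewrite !ge_max => /andP[/andP[-> ->] /andP[-> ->]].
have [|f' [f'E f'P]] := NP _ _ s; first by move=> t; case: (aNt t).
have [|g' [g'E g'P]] := NP' _ _ s; first by move=> t; case: (aNt t).
have fg' : f' = g'.
  apply: free_ext => t; apply/subr0_eq; have [_ _ aL aK] := aNt t.
  have [_] := LP _ aL; apply.
  have := zz_relB (fg _ aK _ _ (f'P _ _ (fbas_deg D a t))) (g'P _ _ (fbas_deg D a t)).
  by rewrite subrr.
have [t [_ ts]] := loc_Serre_inv sW.
rewrite -[f](@hcomp1f qgrD) -ts -(@hcompA qgrD) f'E fg' -g'E (@hcompA qgrD) ts.
exact: (@hcomp1f qgrD).
Qed.

Lemma zero_gr_qgr : @zero_object qgrD (zero_gr D).
Proof.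
split=> X.
  exists (loc_of W (zero_map X (zero_gr D))) => g; apply: loc_faithful.
  apply: eventually_impl (loc_rel_of (zero_map X (zero_gr D))) => n E x y xy; apply/E.
  by split; [case: (zz_rel_deg xy)|exact: zero_gr0].
exists (loc_of W (zero_map (zero_gr D) X)) => g; apply: loc_faithful.
apply: eventually_impl (eventually_and (loc_rel_of (zero_map (zero_gr D) X)) (zz_rel_fun (crepr g))).
move=> n [E [_ gF]] x y xy; apply/E; split; first by case: (zz_rel_deg xy).
by apply: gF; rewrite -(zero_gr0 x).
Qed.

Lemma qgr_zero_morphism (X Y : gr D) (f : @Hom qgrD X Y) :
  zero_morphism f <-> eventually (fun n => forall x y, loc_rel f n x y -> y = 0).
Proof.
split=> [[Z [a [b [[Z0 _] fE]]]]|f0].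
  have [z zP] := Z0 Z.
  have idE : @idm qgrD Z = loc_of W (zero_map Z Z) by rewrite [LHS]zP [RHS]zP.
  have {fE} -> : f = (a ;; (loc_of W (zero_map Z Z) : @Hom qgrD Z Z)) ;; b.
    by rewrite -idE (@hcompf1 qgrD).
  set c := loc_of W _ : @Hom qgrD Z Z.
  apply: eventually_impl (eventually_and (loc_rel_comp (a ;; c) b) (eventually_and (loc_rel_comp a c)
    (eventually_and (loc_rel_of (zero_map Z Z)) (zz_rel_fun (crepr b))))).
  move=> n [E1 [E2 [E3 [_ bF]]]] x y /E1 [z' /E2 [z'' _ /E3 [_ ->]] bz].
  exact: bF.
exists (zero_gr D), (loc_of W (zero_map X (zero_gr D))), (loc_of W (zero_map (zero_gr D) Y)).
split; first exact: zero_gr_qgr.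
rewrite -(loc_ofM W (zero_map X (zero_gr D) : @Hom (gr D) _ _) (zero_map (zero_gr D) Y)).
apply: loc_faithful; apply: eventually_impl (eventually_and f0 (loc_rel_of (zero_map X Y))).
move=> n [{}f0 E] x y xy; rewrite (f0 _ _ xy).
rewrite (_ : _ ;; _ = (zero_map X Y : @Hom (gr D) X Y)); last exact: ghom_eq.
by apply/E; split=> //; case: (zz_rel_deg xy).
Qed.
End Germs.

(** * Generators of the Grothendieck group *)

Section K0Generic.
Variable C : category.

Lemma K0_exact (X' X X'' : C) (f : Hom X' X) (g : Hom X X'') : short_exact f g ->
  K0_class X = K0_add (K0_class X') (K0_class X'').
Proof. by move=> fg; rewrite K0_addE; apply/K0_equivP; exact: K0_rel_exact fg. Qed.

Lemma K0_zero (Z : C) : zero_object Z -> K0_class Z = K0_pi (fsum0 C).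
Proof.
move=> Z0; have zr (X : C) (f : Hom X Z) : zero_morphism f.
  by exists Z, f, (idm Z); rewrite hcompf1.
have zl (X : C) (f : Hom Z X) : zero_morphism f.
  by exists Z, (idm Z), f; rewrite hcomp1f.
have ex : short_exact (idm Z) (idm Z).
  split; split=> [|T h _]; first exact: zr.
  - by exists h; split=> [|u <-]; rewrite hcompf1.
  - exact: zr.
  by exists h; split=> [|u <-]; rewrite hcomp1f.
have := K0_exact ex; move: (K0_class Z) => z zz.
by rewrite -[LHS](@K0_add0 C) -(@K0_addN C z) -(@K0_addA C) -zz.
Qed.

(** The sequence [X -> Y -> 0] is exact. *)
Lemma K0_iso (Z X Y : C) (f : Hom X Y) (g : Hom Y X) : zero_object Z ->
  f ;; g = idm X -> g ;; f = idm Y -> K0_class Y = K0_class X.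
Proof.
move=> Z0 fg gf; have [p pP] := Z0.1 Y.
have zp (T : C) (h : Hom T Z) : zero_morphism h.
  by exists Z, h, (idm Z); rewrite hcompf1; split.
have ex : short_exact f p.
  split; split.
  - exact: zp.
  - move=> T h _; exists (h ;; g); split; first by rewrite -hcompA gf hcompf1.
    by move=> u <-; rewrite -hcompA fg hcompf1.
  - exact: zp.
  move=> T h [N [a [b [N0 fh]]]]; have [u uP] := Z0.2 T; exists u.
  split; last by move=> v _; rewrite [v]uP.
  have [z _] := Z0.2 N; have [d dP] := N0.1 Y.
  have -> : h = (g ;; a) ;; b by rewrite -hcompA -fh hcompA gf hcomp1f.
  by rewrite [g ;; a]dP -(dP (p ;; z)) -hcompA (uP (z ;; b)).
by rewrite (K0_exact ex) (K0_zero Z0) (@K0_addC C) (@K0_add0 C).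
Qed.

Lemma K0_gen (P : K0 C -> Prop) : P (K0_pi (fsum0 C)) ->
  (forall x y, P x -> P y -> P (K0_add x y)) -> (forall x, P x -> P (K0_opp x)) ->
  (forall X, P (K0_class X)) -> forall x, P x.
Proof.
move=> P0 PD PN PC; have PZ (X : C) (n : int) : forall f : fsum C,
    (forall Y, f Y = n * fdelta X Y) -> P (K0_pi f).
  have nat_case m : forall f : fsum C,
      (forall Y, f Y = m%:Z * fdelta X Y) -> P (K0_pi f).
    elim: m => [|m IH] f fE.
      by rewrite (@K0_eq _ f (fsum0 C)) // => Y; rewrite fE mul0r.
    pose g := fsum_add f (fsum_opp (fsum_delta X)).
    rewrite (@K0_eq _ f (fsum_add (fsum_delta X) g)) => [|Y /=]; last by ring.
    rewrite -K0_addE; apply: PD; first exact: PC.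
    by apply: IH => Y /=; rewrite fE -addn1 PoszD; ring.
  case: n => m f fE; first exact: nat_case fE.
  rewrite (@K0_eq _ f (fsum_opp (fsum_opp f))) => [|Y /=]; last by rewrite opprK.
  rewrite -K0_oppE; apply/PN/(nat_case m.+1) => Y /=.
  by rewrite fE NegzE mulNr opprK.
elim/K0_ind=> f; have [I [v vP]] := fsum_fin f.
have : forall X, f X <> 0 -> exists2 i, i \in enum I & v i = X.
  by move=> X /vP [i <-]; exists i; rewrite ?mem_enum.
elim: (enum I) f {vP} => [|i s IH] f fs.
  rewrite (@K0_eq _ f (fsum0 C)) // => X /=.
  by apply: contrapT => /fs [].
have gF : finite_support (fun Y => f (v i) * fdelta (v i) Y).
  exists unit, (fun=> v i) => Y; rewrite /fdelta.
  by case: asboolP => [<- _|_]; [exists tt|rewrite mulr0].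
pose g := FSum gF; pose h := fsum_add f (fsum_opp g).
rewrite (@K0_eq _ f (fsum_add g h)) => [|Y /=]; last by rewrite addrC subrK.
rewrite -K0_addE; apply: PD; first exact: PZ.
apply: IH => Y /=; rewrite /fdelta; case: asboolP => [<-|vY].
  by rewrite mulr1 subrr.
rewrite mulr0 subr0 => /fs [j + jY]; rewrite inE => /orP[/eqP ji|js].
  by case: vY; rewrite -ji.
by exists j.
Qed.
End K0Generic.

Section BigmodTheory.
Variables (R : pzRingType) (V : bigmod R).
Implicit Types x y z : V.

Lemma madd_idem x : madd x x = x -> x = m0 V.
Proof.
by move=> xx; rewrite -[LHS]madd0 -(maddN x) -maddA xx.
Qed.

Lemma mscale0l x : mscale 0 x = m0 V.
Proof. by apply: madd_idem; rewrite -mscaleDl addr0. Qed.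

Lemma mscale0r a : mscale a (m0 V) = m0 V.
Proof. by apply: madd_idem; rewrite -mscaleDr madd0. Qed.

Lemma mscaleN1 x : mscale (-1) x = mopp x.
Proof.
have H : madd (mscale (-1) x) x = m0 V.
  by rewrite -{2}[x]mscale1 -mscaleDl addNr mscale0l.
by rewrite -[RHS]madd0 -H -maddA (maddC x) maddN maddC madd0.
Qed.
End BigmodTheory.

Definition tpow (a : int) : laurent := << 1 *g (a : zexp) >>.

Lemma tpowD a b : tpow (a + b) = tpow a * tpow b.
Proof. by rewrite /tpow pm_mulE pm_mulUU mulr1. Qed.

Lemma tpow0 : tpow 0 = 1.
Proof. by rewrite /1%R /= /pm_one big_seq1. Qed.

Lemma tpowX n : laurent_t ^+ n = tpow n%:Z.
Proof.
elim: n => [|n IH]; first by rewrite tpow0.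
by rewrite exprS IH -[laurent_t]/(tpow 1) -tpowD.
Qed.

Section K0qgr.
Variables (k : fieldType) (D : graded_algebra k) (r : nat) (T : tail_data D r).
Local Notation W := (@Serre_iso (gr D) (@fdim k D)).
Local Notation qgrD := (Serre_quotient (@fdim k D)).
Local Notation K := (K0_module (qgr D)).
Local Notation O := (K0_class (structure_sheaf D) : K).

Definition qgr_of (X Y : gr D) (f : @Hom (gr D) X Y) : @Hom qgrD X Y := loc_of W f.

Lemma qgr_ofM (X Y Z : gr D) (f : @Hom (gr D) X Y) (g : @Hom (gr D) Y Z) :
  qgr_of (f ;; g) = qgr_of f ;; qgr_of g.
Proof. exact: loc_ofM. Qed.

Lemma loc_rel_qgr_of X Y (f : @Hom (gr D) X Y) : eventually (fun n => forall x y,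
  loc_rel (qgr_of f) n x y <-> gmdeg n x /\ y = sval (f : ghom X Y) x).
Proof. exact: loc_rel_of. Qed.

(** The localization carries no addition a priori; the universal properties are
    checked on relations in high degrees, where elements can be added. *)
Lemma qgr_split (A E B : gr D) (i : @Hom (gr D) A E) (q : @Hom (gr D) E A)
    (p : @Hom (gr D) E B) (s : @Hom (gr D) B E) :
  i ;; q = idm A -> s ;; p = idm B ->
  (forall a, sval (p : ghom E B) (sval (i : ghom A E) a) = 0) ->
  (forall x, x = sval (i : ghom A E) (sval (q : ghom E A) x) +
                 sval (s : ghom B E) (sval (p : ghom E B) x)) ->
  short_exact (qgr_of i) (qgr_of p).
Proof.
move=> iq sp ip xE; have ip0 : zero_morphism (qgr_of i ;; qgr_of p).
  rewrite -qgr_ofM; apply/(qgr_zero_morphism T).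
  by apply: eventually_impl (loc_rel_qgr_of (i ;; p)) => n H x y /H [_ ->]; exact: ip.
split; split=> // U h h0.
  exists (h ;; qgr_of q); split; last first.
    by move=> u <-; rewrite -hcompA -qgr_ofM iq; exact: (@hcompf1 qgrD).
  apply: (loc_faithful T).
  move/(qgr_zero_morphism T): h0 => h0.
  apply: eventually_impl (eventually_and h0 (eventually_and (loc_rel_comp (h ;; qgr_of q) (qgr_of i))
    (eventually_and (loc_rel_comp h (qgr_of q)) (eventually_and (loc_rel_comp h (qgr_of p))
    (eventually_and (loc_rel_qgr_of i) (eventually_and (loc_rel_qgr_of q) (loc_rel_qgr_of p))))))).
  move=> n [{}h0 [E1 [E2 [E3 [E4 [E5 E6]]]]]] x y.
  move=> /E1 [a /E2 [e he /E5 [en ->]] /E4 [_ ->]].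
  have /h0 pe0 : loc_rel (h ;; qgr_of p) n x (sval (p : ghom E B) e).
    by apply/E3; exists e => //; apply/E6.
  by move: (xE e); rewrite pe0 ghom0 addr0 => <-.
exists (qgr_of s ;; h); split; last first.
  by move=> u <-; rewrite hcompA -qgr_ofM sp; exact: (@hcomp1f qgrD).
apply: (loc_faithful T).
move/(qgr_zero_morphism T): h0 => h0.
apply: eventually_impl (eventually_and h0 (eventually_and (loc_rel_comp (qgr_of p) (qgr_of s ;; h))
  (eventually_and (loc_rel_comp (qgr_of s) h) (eventually_and (loc_rel_comp (qgr_of i) h) (eventually_and (zz_rel_fun (crepr h))
  (eventually_and (loc_rel_qgr_of i) (eventually_and (loc_rel_qgr_of s) (loc_rel_qgr_of p)))))))).
move=> n [{}h0 [E1 [E2 [E3 [[ht _] [E4 [E5 E6]]]]]]] x y.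
move=> /E1 [b /E6 [xn ->] /E2 [e /E5 [_ ->] hy]].
have qn : gmdeg n (sval (q : ghom E A) x) by exact: ghom_deg.
have iqn : gmdeg n (sval (i : ghom A E) (sval (q : ghom E A) x)) by exact: ghom_deg.
have [z hz] := ht _ iqn; have /h0 z0 : loc_rel (qgr_of i ;; h) n (sval (q : ghom E A) x) z.
  by apply/E3; eexists; [apply/E4; split; first exact: qn|exact: hz].
by rewrite (xE x) -[y]add0r; apply: zz_relD hy; rewrite -z0.
Qed.

Lemma K0_twist (a : int) (X : qgr D) :
  mscale (tpow a) (K0_class X : K) = K0_class (twist (- a) X).
Proof.
rewrite /= /K0_class K0_scaleE; apply: K0_eq => Y.
rewrite [LHS](K0_actE (tpow a)) [LHS]mmapU [LHS]mul1r /=.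
rewrite /fdelta (_ : `[< _ >] = `[< gr_shift (- a) X = Y >]) //.
apply: asbool_equiv_eq; split=> [->|<-].
  by rewrite gr_shiftD addNr gr_shift0.
by rewrite gr_shiftD addrN gr_shift0.
Qed.

Lemma K0_free n (a : 'I_n -> int) :
  K0_class (free_obj D a : qgr D) = mscale (\sum_s tpow (a s)) O.
Proof.
elim: n a => [|n IH] a.
  rewrite big_ord0 mscale0l (_ : a = fun=> 0); last by apply/funext => -[].
  exact: (@K0_zero qgrD _ (zero_gr_qgr T)).
rewrite big_ord_recl mscaleDl K0_twist -IH.
set A : gr D := gr_shift (- a ord0) (structure_sheaf D).
set E : gr D := free_obj D a; set B : gr D := free_obj D _.
have iP : @is_ghom k D A E (fun b => (b : D) *: fbas D a ord0).
  split=> [b x y|j x xj]; first by rewrite scalerDl scalerA.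
  rewrite (_ : j = - a ord0 + j + a ord0); last by lia.
  exact: gmdegZ xj (fbas_deg _ _ _).
have qP : @is_ghom k D E A (fun x => x ord0).
  split=> [b x y|j x xj /=]; first by rewrite !ffunE.
  by have := xj ord0; rewrite addrC.
have pP : @is_ghom k D E B (fun x => [ffun s => x (lift ord0 s)]).
  split=> [b x y|j x xj s]; last by rewrite ffunE.
  by apply/ffunP => s; rewrite !ffunE.
have sP : @is_ghom k D B E (fun x => [ffun s => oapp x 0 (unlift ord0 s)]).
  split=> [b x y|j x xj s]; last first.
    rewrite ffunE; case: unliftP => [t ->|_]; first exact: xj.
    exact: gdeg0.
  apply/ffunP => s; rewrite !ffunE; case: unliftP => [t _|_] /=; rewrite ?ffunE //.
  by rewrite scaler0 addr0.
apply: (K0_exact (C := qgrD) (f := qgr_of (exist _ _ iP : @Hom (gr D) A E))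
  (g := qgr_of (exist _ _ pP : @Hom (gr D) E B))).
apply: (@qgr_split A E B _ (exist _ _ qP) _ (exist _ _ sP)).
- apply: ghom_eq => x /=; rewrite !ffunE eqxx; exact: mulr1.
- by apply: ghom_eq => x; apply/ffunP => s /=; rewrite !ffunE liftK.
- by move=> x /=; apply/ffunP => s; rewrite !ffunE /= scaler0.
move=> x; apply/ffunP => s; rewrite /= !ffunE.
case: unliftP => [t ->|->] /=.
  by rewrite ffunE scaler0 add0r.
by rewrite addr0; apply: esym; exact: mulr1.
Qed.

Lemma K0_Serre_iso (X Y : gr D) (s : @Hom (gr D) X Y) : W s ->
  K0_class (Y : qgr D) = K0_class (X : qgr D).
Proof.
move=> /loc_Serre_inv [t [st ts]].
exact: (@K0_iso qgrD _ _ _ _ _ (zero_gr_qgr T) st ts).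
Qed.

(** Every object is a sum of twists of [O] in qgr. *)
Lemma K0_cyclic (x : K) : exists p : laurent, x = mscale p O.
Proof.
elim/K0_gen: x => [|x y [p ->] [q ->]|x [p ->]|X].
- by exists 0; rewrite mscale0l.
- by exists (p + q); rewrite mscaleDl.
- by exists (- p); rewrite -mulN1r -mscaleA mscaleN1.
have [n [a [s [_ sW]]]] := free_resolution T X 0.
by exists (\sum_s tpow (a s)); rewrite (K0_Serre_iso sW) K0_free.
Qed.

Lemma f_polyE : f_poly r = 1 - \sum_(i < r.+1) tpow (i%:Z + 1).
Proof.
rewrite /f_poly; congr (_ - _).
rewrite -[r.+2]addn1 -{1}[1%N]add0n big_addn addn1 subn1 big_mkord.
by apply: eq_bigr => i _; rewrite tpowX PoszD.
Qed.

(** The embedding of [sum_i O(-i-1)] into [O] by right multiplication with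
    [x w_0, ..., x w_r] gives the defining relation. *)
Lemma K0_relation : mscale (f_poly r) O = m0 K.
Proof.
have MT := @regular_tail_free _ _ _ T 0; have uF := @regular_frame _ _ _ T.
have sW := @frame_Serre_iso _ _ _ T (structure_sheaf D) 0 _ _ _ MT uF.
rewrite f_polyE mscaleDl mscale1 -mulN1r -mscaleA mscaleN1.
rewrite -(K0_free (fun s : 'I_r.+1 => s%:Z + 1)) -(K0_Serre_iso sW).
by rewrite maddC maddN.
Qed.
End K0qgr.

(** * The additive invariant *)

Section Numerator.
Variable r : nat.
Implicit Types (d : int -> int) (N : int).

Definition mono (c a : int) : laurent := << c *g (a : zexp) >>.

Lemma monoD c c' a : mono (c + c') a = mono c a + mono c' a.
Proof. exact: monalgUD. Qed.
Lemma monoN c a : mono (- c) a = - mono c a.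
Proof. exact: monalgUN. Qed.
Lemma monoM c a c' a' : mono c a * mono c' a' = mono (c * c') (a + a').
Proof. by rewrite /mono pm_mulE pm_mulUU. Qed.

(** The numerator of the series [sum_(m >= N) d m t^m] over [1 - t - .. - t^(r+1)]
    when [d] satisfies the corresponding recurrence from [N] on. *)
Definition numer N d : laurent :=
  \sum_(i < r.+1) mono (d (N + i%:Z) - \sum_(j < i) d (N + j%:Z)) (N + i%:Z).

Definition recur N d :=
  forall m, N <= m -> d (m + r.+1%:Z) = \sum_(j < r.+1) d (m + j%:Z).

(** Moving the start of the series only changes its numerator by a multiple of [f]. *)
Lemma numer_step N d : recur N d -> numer (N + 1) d = numer N d - mono (d N) N * f_poly r.
Proof.
move=> /(_ N (lexx _)) dN; pose c (i : nat) := d (N + i%:Z) - \sum_(j < i) d (N + j%:Z).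
have shift (i : nat) : d (N + 1 + i%:Z) - \sum_(j < i) d (N + 1 + j%:Z) = c i.+1 + d N.
  rewrite /c big_ord_recl addr0 (_ : N + i.+1%:Z = N + 1 + i%:Z); last by lia.
  have -> : \sum_(j < i) d (N + (lift ord0 j)%:Z) = \sum_(j < i) d (N + 1 + j%:Z).
    by apply: eq_bigr => j _; congr d; rewrite /= /bump; lia.
  by ring.
pose S := \sum_(i < r.+1) mono (c i.+1) (N + i.+1%:Z).
have SE : S = numer N d - mono (d N) N.
  have : \sum_(i < r.+2) mono (c i) (N + i%:Z) = numer N d.
    by rewrite big_ord_recr /= /c dN subrr /mono monalgU0 addr0.
  by rewrite big_ord_recl {1}/c big_ord0 subr0 addr0 addrC => <-; rewrite addrK.
have -> : numer (N + 1) d = S + \sum_(i < r.+1) mono (d N) (N + i.+1%:Z).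
  rewrite -big_split; apply: eq_bigr => i _; rewrite shift /= -monoD.
  by rewrite (_ : N + 1 + i%:Z = N + i.+1%:Z); last by lia.
have -> : \sum_(i < r.+1) mono (d N) (N + i.+1%:Z) =
    mono (d N) N * \sum_(i < r.+1) tpow (i%:Z + 1).
  rewrite mulr_sumr; apply: eq_bigr => i _.
  by rewrite -[tpow _]/(mono 1 _) monoM mulr1; congr mono; lia.
by rewrite SE f_polyE mulrBr mulr1 opprB addrA addrAC.
Qed.

Lemma numer_eq N d d' : (forall m, N <= m -> d m = d' m) -> numer N d = numer N d'.
Proof.
move=> dd; apply: eq_bigr => i _; rewrite dd; last by lia.
by rewrite (eq_bigr (fun j : 'I_i => d' (N + j%:Z))) // => j _; apply: dd; lia.
Qed.

Lemma numerD N d d' : numer N (fun m => d m + d' m) = numer N d + numer N d'.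
Proof.
rewrite -big_split; apply: eq_bigr => i _; rewrite /= -monoD.
by rewrite big_split /= opprD addrACA.
Qed.

Lemma numer_shift N a d : numer N (fun m => d (a + m)) = tpow (- a) * numer (a + N) d.
Proof.
rewrite mulr_sumr; apply: eq_bigr => i _.
rewrite -[tpow _]/(mono 1 _) monoM mul1r addrA; congr (mono (_ - _) _); last by lia.
by apply: eq_bigr => j _; rewrite addrA.
Qed.

Lemma numer_initial d :
  (forall i, (i <= r)%N -> d i%:Z = 1 + \sum_(j < i) d j%:Z) ->
  numer 0 d = \sum_(i < r.+1) tpow i%:Z.
Proof.
move=> dE; apply: eq_bigr => i _; rewrite add0r -[RHS]/(mono 1 _); congr mono.
rewrite dE; last by rewrite -ltnS.
under [X in _ - X]eq_bigr => j _ do rewrite add0r.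
by rewrite addrK.
Qed.

Local Notation Q := (laurent_quot (f_poly r)).
Local Notation cl := (laurent_class (f_poly r)).

Lemma laurent_class_eqP p q : cl p = cl q <-> multiple_of (f_poly r) (p - q).
Proof. exact: (quot_piP (laurent_ideal (f_poly r))). Qed.

Lemma numer_class N N' d : recur N d -> N <= N' -> cl (numer N' d) = cl (numer N d).
Proof.
move=> dN NN'; have [n ->] : exists n : nat, N' = N + n%:Z by exists `|N' - N|%N; lia.
elim: n => [|n IH]; first by rewrite addr0.
rewrite -[RHS]IH -addn1 PoszD addrA numer_step; last by move=> m mn; apply: dN; lia.
apply/laurent_class_eqP; exists (- mono (d (N + n%:Z)) (N + n%:Z)).
by rewrite addrAC subrr add0r mulNr.
Qed.

(** The factor [t] normalizes the value of the structure sheaf to [1]. *)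
Definition chi_seq d : Q :=
  match pselect (exists N, recur N d) with
  | left dN => cl (tpow 1 * numer (sval (cid dN)) d)
  | right _ => cl 0
  end.

Lemma laurent_classM p q q' : cl q = cl q' -> cl (p * q) = cl (p * q').
Proof.
move=> /laurent_class_eqP [h E]; apply/laurent_class_eqP; exists (p * h).
by rewrite -mulrBr E mulrA.
Qed.

Lemma chi_seqE N d : recur N d -> chi_seq d = cl (tpow 1 * numer N d).
Proof.
move=> dN; rewrite /chi_seq; case: pselect => [ex|[]]; last by exists N.
apply: laurent_classM; have := svalP (cid ex); set K := sval _ => dK.
have KL : K <= Num.max K N by rewrite le_max lexx.
have NL : N <= Num.max K N by rewrite le_max lexx orbT.
by rewrite -(numer_class dK KL) -(numer_class dN NL).
Qed.

End Numerator.

Section Chi.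
Variables (k : fieldType) (D : graded_algebra k) (r : nat) (T : tail_data D r).
Local Notation W := (@Serre_iso (gr D) (@fdim k D)).
Local Notation qgrD := (Serre_quotient (@fdim k D)).
Local Notation Q := (laurent_quot (f_poly r)).
Local Notation cl := (laurent_class (f_poly r)).

Definition edim (M : gr D) (m : int) : nat := sval (cid (edeg_kdim T (grmodP M) m)).

Lemma edimP (M : gr D) m : kdim (@edeg _ _ _ T M m) (edim M m).
Proof. exact: svalP (cid (edeg_kdim T (grmodP M) m)). Qed.

Lemma tail_edim (M : gr D) N : tail_gen T M N -> tail_free T M N -> forall m, N <= m ->
  edim M m = (\sum_(i < r.+1) edim M (m - i%:Z - 1))%N.
Proof.
move=> MG MF m mN; apply: (kdim_uniq (edimP M m)).
apply: (@kdim_dsum _ _ _ _ (fun (i : 'I_r.+1) => @edeg _ _ _ T M (m - i%:Z - 1))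
  (fun i => tw T i * tx T)).
- by move=> i; exact: edimP.
- move=> y; split=> [[ym ye]|[u [uP ->]]].
    have [u um uE] := MG _ _ mN ym; exists (fun i => te T *: u i); split.
      by move=> i; exact/edeg_te/um.
    by rewrite -ye uE; exact: zsum_te.
  split; last exact: te_zsum.
  by apply: zsum_deg => i; case: (uP i).
move=> u uP u0 i; have [_ <-] := uP i; apply: MF mN _ u0 _ => {}i.
by case: (uP i).
Qed.

Definition edimz (M : gr D) (m : int) : int := (edim M m)%:Z.

Lemma tail_recur (M : gr D) N : tail_gen T M (N + r.+1%:Z) ->
  tail_free T M (N + r.+1%:Z) -> recur r N (edimz M).
Proof.
move=> MG MF m mN; rewrite /edimz (tail_edim MG MF); last by lia.
rewrite (big_morph Posz PoszD (erefl 0%:Z)) (reindex_inj rev_ord_inj) /=.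
by apply: eq_bigr => j _; congr (edim M _)%:Z; have := ltn_ord j; lia.
Qed.

Lemma recur_ex (M : gr D) : exists N, recur r N (edimz M).
Proof.
have [N [MG MF]] := fp_tail T (grmodP M); exists N; apply: tail_recur.
  by move=> m v mN; apply: MG; lia.
by move=> m v mN; apply: MF; lia.
Qed.

Definition chi (M : gr D) : Q := chi_seq r (edimz M).

Lemma edimz_recur_eventually (M : gr D) : eventually (fun N => recur r N (edimz M)).
Proof. by have [N MN] := recur_ex M; exists N => n nN m mn; apply: MN; lia. Qed.

Lemma chi_twist (a : int) (M : gr D) :
  chi (gr_shift a M) = mscale (tpow (- a)) (chi M).
Proof.
have [N MN] := recur_ex M; have E m : edimz (gr_shift a M) m = edimz M (a + m).
  by congr Posz; apply: kdim_uniq (edimP _ _) _; exact: (edimP M (a + m)).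
have SN : recur r (N - a) (edimz (gr_shift a M)).
  move=> m mN; rewrite E addrA MN; last by lia.
  by apply: eq_bigr => j _; rewrite E addrA.
rewrite /chi (chi_seqE SN) (chi_seqE MN).
rewrite (@numer_eq _ _ _ (fun m => edimz M (a + m))) => [|m _]; last exact: E.
rewrite numer_shift (_ : a + (N - a) = N); last by lia.
by rewrite mulrCA; exact: quot_piZ.
Qed.

Lemma zz_rel_unique X Y (f : zigzag W X Y) n : (forall y, zz_rel f n 0 y -> y = 0) ->
  forall x y y', zz_rel f n x y -> zz_rel f n x y' -> y = y'.
Proof.
move=> f0 x y y' xy xy'; apply/subr0_eq/f0.
by have := zz_relB xy xy'; rewrite subrr.
Qed.

Lemma qgr_zero_eq (X Y : gr D) (f g : @Hom qgrD X Y) :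
  zero_morphism f -> zero_morphism g -> f = g.
Proof.
move=> /(qgr_zero_morphism T) f0 /(qgr_zero_morphism T) g0; apply: (loc_faithful T).
apply: eventually_impl (eventually_and f0 (eventually_and g0 (zz_rel_fun (crepr g)))) => n.
move=> [{}f0 [{}g0 [gt _]]] x y xy; rewrite (f0 _ _ xy).
have [xn _] := zz_rel_deg xy; have [z xz] := gt _ xn.
by have := xz; rewrite (g0 _ _ xz).
Qed.

Lemma qgr_of_zero (X Y : gr D) : zero_morphism (qgr_of (zero_map X Y : @Hom (gr D) X Y)).
Proof.
apply/(qgr_zero_morphism T).
by apply: eventually_impl (loc_rel_qgr_of (zero_map X Y : @Hom (gr D) X Y)) => n H x y /H [].
Qed.

(** A cokernel in gr of a morphism of qgr, which represents its image in high
    degrees. *)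
Lemma qgr_image (X Y : gr D) (f : @Hom qgrD X Y) :
  exists (C : gr D) (q : @Hom (gr D) Y C), zero_morphism (f ;; qgr_of q) /\
    eventually (fun m => forall y, gmdeg m y -> sval (q : ghom Y C) y = 0 ->
      exists x, loc_rel f m x y).
Proof.
have [N NP] := loc_lift f; have [n [a [s [aN sW]]]] := free_resolution T X N.
have [g [gE gP]] := NP _ _ s aN; exists (coker_obj g), (coker_map g); split; last first.
  exists 0 => m _ y ym /coker_pi_eq0 [v y_wordE]; exists (sval (s : ghom _ X) (gpart m v)).
  have := gP _ _ (gpart_homog m v); congr loc_rel.
  by rewrite -ghom_gpart -y_wordE gpart_id.
apply/(qgr_zero_morphism T).
apply: eventually_impl (eventually_and (Serre_iso_bij sW) (eventually_and (zz_rel_fun (crepr f))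
  (eventually_and (loc_rel_comp f (qgr_of (coker_map g))) (loc_rel_qgr_of (coker_map g))))).
move=> m [[_ sS] [[_ f0] [E1 E2]]] x z /E1 [y xy /E2 [ym ->]].
have [xm _] := zz_rel_deg xy; have [v vm xE] := sS _ xm.
rewrite {}xE in xy; rewrite (zz_rel_unique f0 xy (gP _ _ vm)).
by apply/coker_pi_eq0; exists v.
Qed.

(** In high degrees [w_0 x] acts injectively on [e M], being one of the operators of
    [tail_free]. *)
Lemma torsion_free (M : gr D) N m (x : grmod M) q : tail_free T M N -> N <= m ->
  edeg T m x -> (tw T 0 * tx T) ^+ q *: x = 0 -> x = 0.
Proof.
move=> MF; elim: q m x => [|q IH] m x mN [xm xe]; first by rewrite expr0 scale1r.
set z := tw T 0 * tx T in IH *; have zd : gdeg 1 z by rewrite /z -[1]add0r; apply/gdegM/tx_deg/(tw_deg T 0).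
have ze : te T * z = z by rewrite /z mulrA tew.
rewrite exprSr -scalerA => /IH E.
have {}E : z *: x = 0.
  apply: (E (1 + m)); first by lia.
  by split; [exact: gmdegZ|rewrite scalerA ze].
rewrite -xe; have := @MF (1 + m) (fun i => if i == ord0 then x else 0) _ _ _ ord0.
rewrite eqxx; apply; first by lia.
  move=> i; case: eqP => [->|_]; last exact: gmdeg0.
  by rewrite (_ : 1 + m - _ - 1 = m) //=; lia.
rewrite /zsum big_ord_recl /= -/z E add0r big1 // => i _.
by rewrite scaler0.
Qed.

(** If [f] kills [x], then it kills the morphism [D(-m) -> X'] given by [x], which is
    zero in qgr by uniqueness of factorizations through a kernel. So [x] is
    annihilated by all elements of [D] of high degree, against [torsion_free]. *)
Lemma qgr_kernel_inj (X' X X'' : gr D) (f : @Hom qgrD X' X) (g : @Hom qgrD X X'') :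
  is_kernel f g -> eventually (fun m => forall x, edeg T m x -> loc_rel f m x 0 -> x = 0).
Proof.
case=> fg0 fP; have [N NP] := loc_lift f; have [K KP] := zz_rel_fun (crepr f).
have [L [_ LP]] := fp_tail T (grmodP X').
exists (Num.max N (Num.max K L)) => m; rewrite !ge_max => /and3P[Nm Km Lm] x xe x0.
pose F : gr D := free_obj D (fun _ : 'I_1 => m); pose b : grmod F := fbas D _ ord0.
have bm : gmdeg m b by exact: (fbas_deg D (fun _ : 'I_1 => m)).
pose h : @Hom (gr D) F X' := free_map (fun=> xe.1).
have hb : sval (h : ghom F X') b = x by exact: free_map_bas.
have null (h' : @Hom (gr D) F X') : loc_rel f m (sval (h' : ghom F X') b) 0 ->
    zero_morphism (qgr_of h' ;; f).
  have [//|g' [-> g'P]] := NP _ _ h'; move=> h'0.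
  rewrite (_ : g' = (zero_map F X : @Hom (gr D) F X)); first exact: qgr_of_zero.
  apply: free_ext => s; rewrite (ord1 s).
  have [_ f0] := KP _ Km; exact: (zz_rel_unique f0 (g'P _ _ bm) h'0).
have hf0 : zero_morphism (qgr_of h ;; f) by apply: null; rewrite hb.
have zf0 : zero_morphism (qgr_of (zero_map F X' : @Hom (gr D) F X') ;; f).
  by apply: null; exact: zz_rel0.
have [|u [_ uU]] := fP _ (qgr_of h ;; f); first exact: zero_morphism_compr hf0.
have hz : qgr_of h = qgr_of (zero_map F X' : @Hom (gr D) F X').
  rewrite -(uU (qgr_of h)) // -(uU (qgr_of (zero_map F X' : @Hom (gr D) F X'))) //.
  exact: qgr_zero_eq.
have [P PP] := eventually_and (loc_rel_qgr_of h) (loc_rel_qgr_of (zero_map F X' : @Hom (gr D) F X')).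
apply: (torsion_free (q := `|P - m|%N) LP Lm xe).
set z := _ ^+ _; have zd : gdeg `|P - m|%N%:Z z.
  rewrite /z; elim: `|_|%N => [|q IH]; first exact: gdeg1.
  rewrite exprS -addn1 PoszD addrC; apply: gdegM IH.
  exact: (gdegM (tw_deg T 0) (tx_deg T)).
have [|E1 E2] := PP (`|P - m|%N%:Z + m); first by lia.
have zb := gmdegZ zd bm; rewrite -hb -ghomZ.
have /E2 [] // : loc_rel (qgr_of (zero_map F X' : @Hom (gr D) F X')) (`|P - m|%N%:Z + m)
    (z *: b) (sval (h : ghom F X') (z *: b)) by rewrite -hz; apply/E1.
Qed.

(** In high degrees the relations of [f] and [g] form a short exact sequence on the
    [e]-parts: injectivity is [qgr_kernel_inj], while surjectivity and exactness in
    the middle follow by testing the cokernel property on the images of [qgr_image]. *)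
Lemma chi_additive (X' X X'' : qgrD) (f : Hom X' X) (g : Hom X X'') :
  short_exact f g -> chi X = madd (chi X') (chi X'').
Proof.
case=> fgK fgC; have fI := qgr_kernel_inj fgK; case: fgK => fg0 _; case: fgC => _ gP.
have [C [q [fq0 qf]]] := qgr_image f; have [u [uE _]] := gP _ _ fq0.
have [C' [q' [gq0 qg]]] := qgr_image g.
have q'0 : zero_morphism (qgr_of q').
  have [w [_ wU]] := gP _ _ (zero_morphism_compl f gq0).
  rewrite -(wU (qgr_of q')) // (wU (qgr_of (zero_map X'' C' : @Hom (gr D) X'' C'))).
    exact: qgr_of_zero.
  by apply: qgr_zero_eq => //; apply: zero_morphism_compl; exact: qgr_of_zero.
move/(qgr_zero_morphism T): q'0 => q'0; move/(qgr_zero_morphism T): fg0 => fg0.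
have [N NP] : eventually (fun m => edimz X m = edimz X' m + edimz X'' m).
  apply: eventually_impl (eventually_and fI (eventually_and fg0 (eventually_and qf (eventually_and qg (eventually_and q'0
    (eventually_and (loc_rel_comp f g) (eventually_and (loc_rel_comp g u) (eventually_and (loc_rel_qgr_of q)
    (eventually_and (loc_rel_qgr_of q') (eventually_and (zz_rel_fun (crepr u))
    (eventually_and (zz_rel_fun (crepr f)) (zz_rel_fun (crepr g))))))))))))).
  move=> m [{}fI [{}fg0 [{}qf [{}qg [{}q'0 [Efg [Egu [Eq [Eq' [[_ u0] [[ft f0] [gt g0]]]]]]]]]]]].
  have relE (A B : gr D) (h : @Hom qgrD A B) x y :
      loc_rel h m x y -> loc_rel h m (te T *: x) (te T *: y).
    by move=> xy; rewrite -[m]add0r; apply: zz_relZ xy; exact: te_deg.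
  rewrite /edimz -PoszD; congr Posz; apply: (kdim_uniq (edimP X m)).
  apply: (kdim_exact (F := loc_rel f m) (G := loc_rel g m) (edimP X' m) (edimP X'' m)).
  - exact: edeg_subspace.
  - exact: zz_rel0.
  - by move=> c x x' y y' xy; apply: zz_relD; exact: zz_rel_kscale.
  - exact: zz_rel0.
  - by move=> c x x' y y' xy; apply: zz_relD; exact: zz_rel_kscale.
  - move=> x [xm xe]; have [y xy] := ft _ xm; exists (te T *: y).
      by apply: edeg_te; case: (zz_rel_deg xy).
    by rewrite -xe; exact: relE.
  - by move=> x xm; exact: fI.
  - by move=> x y y' _; exact: zz_rel_unique.
  - move=> x [xm xe]; have [y xy] := gt _ xm; exists (te T *: y).
      by apply: edeg_te; case: (zz_rel_deg xy).
    by rewrite -xe; exact: relE.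
  - by move=> x y y' _; exact: zz_rel_unique.
  - move=> y [ym ye].
    have [x xy] : exists x, loc_rel g m x y.
      by apply: qg => //; apply: (q'0 y); apply/Eq'.
    exists (te T *: x); last by rewrite -ye; exact: relE.
    by apply: edeg_te; case: (zz_rel_deg xy).
  - move=> x y _ xy; have [_ ym] := zz_rel_deg xy; have [z yz] := gt _ ym.
    have /fg0 z0 : loc_rel (f ;; g) m x z by apply/Efg; exists y.
    by rewrite z0 in yz.
  move=> y [ym ye] y0.
  have [x xy] : exists x, loc_rel f m x y.
    apply: qf => //; have /Eq : gmdeg m y /\ sval (q : ghom X C) y = sval (q : ghom X C) y by [].
    rewrite -uE => /Egu [z yz]; rewrite (zz_rel_unique g0 yz y0).
    exact: u0.
  exists (te T *: x); last by rewrite -ye; exact: relE.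
  by apply: edeg_te; case: (zz_rel_deg xy).
have [L LP] := eventually_and (edimz_recur_eventually X) (eventually_and (edimz_recur_eventually X') (edimz_recur_eventually X'')).
have [M0 MN ML] : exists2 M0, N <= M0 & L <= M0.
  by exists (Num.max N L); rewrite le_max lexx ?orbT.
have [RX [RX' RX'']] := LP _ ML.
rewrite /chi (chi_seqE RX) (chi_seqE RX') (chi_seqE RX'') /laurent_class.
rewrite [RHS](esym (quot_piD _ _ _)) -mulrDr -numerD; congr (quot_pi _ (_ * _)).
by apply: numer_eq => m mM; apply: NP; lia.
Qed.

(** The numerator is [1 + t + ... + t^r], and [t] times it is [1 - f]. *)
Lemma chi_structure_sheaf : chi (structure_sheaf D) = cl 1.
Proof.
have OF N := @regular_tail_free _ _ _ T N.
have OG : tail_gen T (regular_gmod D) (0 + r.+1%:Z).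
  move=> m v mr vm; have [d [c [dm _ _ E]]] := td_gen_int T vm.
  exists d => //; rewrite [LHS]E tw_big ?scaler0 ?add0r //; lia.
have OR := @tail_recur (structure_sheaf D) 0 OG (OF _).
rewrite /chi (chi_seqE OR) numer_initial; last first.
  have neg m : m < 0 -> edim (structure_sheaf D) m = 0%N.
    move=> m0; apply: kdim_uniq (edimP _ _) _; apply: kdim_ext (kdim0 _) => x.
    split=> [->|[xm _]]; last exact: (td_neg T m0 xm).
    by have [] := edeg_subspace T (structure_sheaf D) m.
  have twE n c (d : 'I_r.+1 -> D) :
      \sum_(j : unit + 'I_r.+1) (match j with inl _ => tw T n | inr i => tw T i * tx T end) *:
        (match j with inl _ => kscale c (1 : D^o) | inr i => (d i : D^o) end) =
      c *: tw T n + \sum_(i < r.+1) tw T i * tx T * d i.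
    rewrite big_sumType /= (big_pred1 tt) => [|[] //]; congr (_ + _).
    by rewrite -kscale_scale [_ *: _]mulr1 regular_kscale.
  move=> n nr; have E : edim (structure_sheaf D) n%:Z =
      (1 + \sum_(i < r.+1) edim (structure_sheaf D) (n%:Z - i%:Z - 1))%N.
    have -> : (1 + \sum_(i < r.+1) edim (structure_sheaf D) (n%:Z - i%:Z - 1))%N =
        (\sum_(j : unit + 'I_r.+1) match j with inl _ => 1%N
          | inr i => edim (structure_sheaf D) (n%:Z - i%:Z - 1) end)%N.
      by rewrite big_sumType /= (big_pred1 tt) // => -[].
    apply: kdim_uniq (edimP _ _) _.
    apply: (@kdim_dsum _ _ _ _ (fun j : unit + 'I_r.+1 => match j with
        | inl _ => fun y : D^o => exists c, y = kscale c (1 : D^o)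
        | inr i => @edeg _ _ _ T (structure_sheaf D) (n%:Z - i%:Z - 1) end)
      (fun j => match j with inl _ => tw T n | inr i => tw T i * tx T end)).
    - case=> [_|i]; last exact: (edimP (structure_sheaf D) (n%:Z - i%:Z - 1)).
      by apply: kdim_line; apply/eqP; exact: oner_neq0.
    - move=> y; split=> [[yn ye]|[u [uQ ->]]].
        have [d [c [dn de _ y_wordE]]] := td_gen_int T yn.
        exists (fun j => match j with inl _ => kscale c (1 : D^o) | inr i => d i end).
        split=> [[_|i]|]; [by exists c|by split; [exact: dn|exact: de]|].
        by rewrite twE -[LHS]ye; exact: y_wordE.
      have [c cE] := uQ (inl tt); have uE i := uQ (inr i).
      rewrite (_ : u = fun j => match j with inl _ => kscale c (1 : D^o) | inr i => u (inr i) end);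
        last by apply/funext => -[[]|].
      rewrite twE; split.
        apply: gdegD; first by apply/gdegZ/(tw_deg T n).
        by apply: gdeg_sum => i _; apply: tw_tx_deg; case: (uE i).
      apply: etrans (mulrDr _ _ _) _; rewrite -scalerAr tew mulr_sumr; congr (_ + _).
      by apply: eq_bigr => i _; rewrite !mulrA tew.
    move=> u uQ; have [c cE] := uQ (inl tt); have uE i := uQ (inr i).
    rewrite (_ : u = fun j => match j with inl _ => kscale c (1 : D^o) | inr i => u (inr i) end);
      last by apply/funext => -[[]|].
    rewrite twE => /td_free [i|cw u0]; first by case: (uE i).
    case=> [_|i]; last by case: (uE i) => _ <-; exact: u0.
    have := @tw_neq0 _ _ _ T n nr; move: cw => /eqP.
    by rewrite scaler_eq0 => /orP[/eqP -> _|/eqP //]; exact: kscale0l.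
  rewrite /edimz E PoszD (big_morph Posz PoszD (erefl 0%:Z)); congr (_ + _).
  rewrite [RHS](reindex_inj rev_ord_inj) /=.
  rewrite (big_ord_widen r.+1 (fun j => (edim (structure_sheaf D) (n - j.+1)%N)%:Z)); last exact: leqW.
  rewrite [RHS]big_mkcond; apply: eq_bigr => i _; case: ltnP => ni.
    by congr (edim _ _)%:Z; lia.
  by rewrite neg //; lia.
apply/laurent_class_eqP; exists (-1); rewrite f_polyE mulN1r opprB; congr (_ - _).
by rewrite mulr_sumr; apply: eq_bigr => i _; rewrite -tpowD addrC.
Qed.
End Chi.

(** * Computation of the Grothendieck group *)

Section Value.
Variables (C : category) (V : zmodType) (v : C -> V).

(** Elements of the free group on objects are functions of finite support; lists of
    terms allow to evaluate them, and by [list_value_eq] the value depends only on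
    the function. *)
Definition list_coef (s : seq (int * C)) (Y : C) : int := \sum_(p <- s) p.1 * fdelta p.2 Y.
Definition list_value (s : seq (int * C)) : V := \sum_(p <- s) v p.2 *~ p.1.

Lemma list_value_eq0 s : (forall Y, list_coef s Y = 0) -> list_value s = 0.
Proof.
have [n] := ubnP (size s); elim: n s => // n IH [|[c X] s] /=; first by rewrite /list_value big_nil.
rewrite ltnS => sn s0.
(* If another term has the same object, the two are merged; otherwise evaluating at
   this object shows that the coefficient vanishes. *)
have [[s1 [d [s2 sE]]]|sX] :=
    EM (exists s1 d s2, s = s1 ++ (d, X) :: s2 :> seq (int * C)).
  have /IH H : (size (s1 ++ ((c + d)%R, X) :: s2) < n)%N.
    by move: sn; rewrite sE !size_cat.
  rewrite -[RHS]H; last first.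
    move=> Y; rewrite -[RHS](s0 Y) /list_coef sE big_cons !big_cat !big_cons /=.
    by ring.
  rewrite /list_value sE big_cons !big_cat !big_cons /= mulrzDr.
  by rewrite -!addrA [LHS]addrCA.
have cX : list_coef s X = 0.
  elim: s sX {sn s0} => [|[d Z] s IHs] sX; first by rewrite /list_coef big_nil.
  rewrite /list_coef big_cons -/(list_coef s X) IHs ?addr0 /=.
    rewrite /fdelta; case: asboolP => [ZX|_]; last by rewrite mulr0.
    by case: sX; exists [::], d, s; rewrite ZX.
  by case=> s1 [e [s2 sE]]; case: sX; exists ((d, Z) :: s1), e, s2; rewrite sE.
have c0 : c = 0.
  have := s0 X; rewrite /list_coef big_cons -/(list_coef s X) cX addr0 /= /fdelta.
  by case: asboolP => // _; rewrite mulr1.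
rewrite /list_value big_cons c0 mulr0z add0r; apply: IH => // Y.
by have := s0 Y; rewrite /list_coef big_cons c0 mul0r add0r.
Qed.

Lemma list_value_eq s t : (forall Y, list_coef s Y = list_coef t Y) -> list_value s = list_value t.
Proof.
move=> st; pose t' := [seq (- p.1, p.2) | p <- t].
have : list_value (s ++ t') = 0.
  apply: list_value_eq0 => Y; rewrite /list_coef big_cat big_map /=.
  under [X in _ + X]eq_bigr => p _ do rewrite mulNr.
  by rewrite sumrN; apply/eqP; rewrite subr_eq0; apply/eqP; exact: st.
rewrite /list_value big_cat big_map /=.
under [X in _ + X]eq_bigr => p _ do rewrite mulrNz.
by rewrite sumrN => /subr0_eq.
Qed.

Hypothesis v_additive : forall (X' X X'' : C) (f : Hom X' X) (g : Hom X X''),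
  short_exact f g -> v X = v X' + v X''.

Lemma K0_rel_value (g : C -> int) : K0_rel g ->
  exists2 s, forall Y, g Y = list_coef s Y & list_value s = 0.
Proof.
elim=> {g} [|f g _ [s fs s0] _ [t gt t0]|X' X X'' f g fg].
- by exists [::] => [Y|]; rewrite /list_coef /list_value big_nil.
- exists (s ++ [seq (- p.1, p.2) | p <- t]) => [Y|].
    rewrite fs gt /list_coef big_cat big_map /= -sumrN; congr (_ + _).
    by apply: eq_bigr => p _; rewrite mulNr.
  rewrite /list_value big_cat big_map /= -/(list_value s) s0 add0r.
  under eq_bigr => p _ do rewrite mulrNz.
  by rewrite sumrN -/(list_value t) t0 oppr0.
exists [:: (1, X); (-1, X'); (-1, X'')] => [Y|].
  by rewrite /list_coef !big_cons big_nil /=; ring.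
rewrite /list_value !big_cons big_nil /= (v_additive fg) mulrNz !mulr1z addr0.
by rewrite mulrNz mulr1z addrACA subrr add0r subrr.
Qed.

Lemma K0_pi_value (f g : fsum C) s t : K0_pi f = K0_pi g ->
  (forall Y, f Y = list_coef s Y) -> (forall Y, g Y = list_coef t Y) -> list_value s = list_value t.
Proof.
move=> /K0_equivP /K0_rel_value [u uE u0] fs gt.
have : list_value s = list_value (t ++ u).
  apply: list_value_eq => Y; rewrite /list_coef big_cat /= -/(list_coef t Y) -/(list_coef u Y) -/(list_coef s Y).
  by rewrite -gt -uE -fs addrC subrK.
by rewrite /list_value big_cat /= -/(list_value u) u0 addr0.
Qed.
End Value.

Section Main.
Variables (k : fieldType) (D : graded_algebra k) (r : nat) (T : tail_data D r).
Local Notation K := (K0_module (qgr D)).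
Local Notation O := (K0_class (structure_sheaf D) : K).
Local Notation f := (f_poly r).
Local Notation Q := (quot_mod (laurent_ideal f)).

Lemma mono_tpow c a : mono c a = tpow a *~ c.
Proof.
have nat_case (n : nat) : mono n%:Z a = tpow a *+ n.
  elim: n => [|n IH]; first exact: monalgU0.
  by rewrite -addn1 PoszD monoD IH mulrnDr.
case: c => n; first exact: nat_case.
by rewrite NegzE monoN nat_case mulrNz.
Qed.

(** Evaluating [chi] on [p . [O] = 0] gives [p = 0] modulo [f]. *)
Lemma K0_annihilator (p : laurent) : mscale p O = m0 K -> multiple_of f p.
Proof.
rewrite /= /K0_class K0_scaleE => pO.
pose s := [seq (p@_i, twist (- i) (structure_sheaf D)) | i : zexp <- finmap.enum_fset (msupp p)].
have sE Y : fsum_act p (fsum_delta (structure_sheaf D)) Y = list_coef s Y.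
  rewrite /= /K0_act /list_coef big_map /=; apply: eq_bigr => i _; congr (_ * _).
  rewrite /fdelta (_ : `[< _ >] = `[< gr_shift (- i) (structure_sheaf D) = Y >]) //.
  apply: asbool_equiv_eq; split=> [->|<-].
    by rewrite gr_shiftD addNr gr_shift0.
  by rewrite gr_shiftD addrN gr_shift0.
pose v (X : Serre_quotient (@fdim k D)) : Q := chi T X.
have := @K0_pi_value _ Q v _ _ _ s [::] pO sE _.
rewrite {2}/list_value big_nil => sv.
have {}sv : list_value v s = 0.
  apply: sv => [X' X X'' g h|Y]; first exact: chi_additive.
  by rewrite /list_coef big_nil.
suff : quot_pi (laurent_ideal f) p = quot_pi (laurent_ideal f) 0.
  by move/quot_piP; rewrite subr0.
have pi_sum := raddf_sum (\pi_(Quotient.quot (submod_pred (laurent_ideal f))))%qT.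
rewrite [RHS](raddf0 (\pi_(Quotient.quot (submod_pred (laurent_ideal f))))%qT) -[RHS]sv.
rewrite [in LHS](monalgE p) [LHS]pi_sum /list_value big_map /=; apply: eq_bigr => i _.
rewrite -[<< _ *g _ >>]/(mono p@_i i) mono_tpow.
apply: etrans (raddfMz (\pi_(Quotient.quot (submod_pred (laurent_ideal f))))%qT _ _) _.
congr (_ *~ _); apply: esym; apply: etrans (chi_twist T (- i) _) _.
rewrite opprK chi_structure_sheaf; apply: etrans (esym (quot_piZ _ _ _)) _.
by congr (quot_pi _ _); exact: mulr1.
Qed.

Lemma K0_scale_eq (p q : laurent) :
  mscale p O = mscale q O <-> laurent_class f p = laurent_class f q.
Proof.
split=> [pq|/laurent_class_eqP [h E]].
  apply/laurent_class_eqP/K0_annihilator.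
  rewrite mscaleDl pq -mulN1r -mscaleA mscaleN1 maddC; exact: maddN.
have fO := K0_relation T; rewrite -[p](subrK q) E mscaleDl -mscaleA fO.
by rewrite mscale0r madd0.
Qed.

(** The class of [O] generates ([K0_cyclic]), and its annihilator is the ideal of
    [f] ([K0_relation], [K0_annihilator]). *)
Theorem K0_qgr : exists psi : K -> laurent_quot f,
  bigmod_iso psi /\ psi O = laurent_class f 1.
Proof.
have /choice [p pE] := K0_cyclic T.
have pP q : laurent_class f (p (mscale q O)) = laurent_class f q.
  by apply/K0_scale_eq; rewrite -pE.
have pO : laurent_class f (p O) = laurent_class f 1.
  by apply/K0_scale_eq; rewrite -pE mscale1.
exists (fun x => laurent_class f (p x)); split=> //.
split.
- exists (fun c : laurent_quot f => mscale (quot_repr c) O) => [x|c].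
    rewrite [RHS]pE; apply/K0_scale_eq; exact: quot_reprK.
  by rewrite pP; exact: quot_reprK.
- move=> x y; rewrite {1}[x]pE {1}[y]pE -mscaleDl pP.
  exact: quot_piD.
move=> a x; rewrite {1}[x]pE mscaleA pP.
exact: (quot_piZ (laurent_ideal f) a (p x)).
Qed.
End Main.

Lemma bigmod_iso_inv (R : pzRingType) (U V : bigmod R) (f : U -> V) :
  bigmod_iso f -> exists g : V -> U, [/\ bigmod_iso g, cancel f g & cancel g f].
Proof.
case=> -[g fg gf] fD fZ; exists g; split=> //; split; first by exists f.
  by move=> x y; rewrite -[x]gf -[y]gf -fD !fg.
by move=> a x; rewrite -[x]gf -fZ !fg.
Qed.

Lemma bigmod_iso_comp (R : pzRingType) (U V W : bigmod R) (f : U -> V) (g : V -> W) :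
  bigmod_iso f -> bigmod_iso g -> bigmod_iso (g \o f).
Proof.
case=> fb fD fZ [gb gD gZ]; split; first exact: bij_comp.
  by move=> x y /=; rewrite fD gD.
by move=> a x /=; rewrite fZ gZ.
Qed.

(** Both groups are identified with [Z[t, t^-1]/(f)], the classes of the structure
    sheaves corresponding to [1]; the twist is the action of [t]. *)
Lemma K0_qgr_iso (k : fieldType) (r : nat) (D E : graded_algebra k) :
  tail_data D r -> tail_data E r ->
  exists (phi : K0_module (qgr D) -> K0_module (qgr E))
         (psi : K0_module (qgr E) -> laurent_quot (f_poly r)),
  [/\ bigmod_iso phi, bigmod_iso psi,
      phi (K0_class (structure_sheaf D)) = K0_class (structure_sheaf E),
      psi (K0_class (structure_sheaf E)) = laurent_class (f_poly r) 1 &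
      forall F : qgr D, psi (phi (K0_class (twist (-1) F))) =
          mscale laurent_t (psi (phi (K0_class F)))].
Proof.
move=> TD TE; have [f [fI f1]] := K0_qgr TD; have [psi [psiI psi1]] := K0_qgr TE.
have [g [gI psig gpsi]] := bigmod_iso_inv psiI.
have phiI := bigmod_iso_comp fI gI.
exists (g \o f), psi; split=> // [|F]; first by rewrite /= f1 -psi1 psig.
have tF : K0_class (twist (-1) F) =
    mscale laurent_t (K0_class F : K0_module (qgr D)) by rewrite -K0_scale_t.
case: phiI psiI => _ _ phiZ [_ _ psiZ].
by rewrite tF phiZ psiZ.
Qed.

(** * The path algebra *)

Section PathProducts.
Variables (k : fieldType) (Qv : quiver).
Implicit Types (p q u : qpath Qv) (f g : pmalg k (qpath Qv)).

Definition path_elt p : pmalg k (qpath Qv) := << 1 *g p >>.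

Lemma path_mul_data p q u : path_mul p q = Some u ->
  [/\ pend p = pstart q, pstart u = pstart p, parrows u = parrows p ++ parrows q
    & pend u = pend q].
Proof.
have [pq|/negbTE pq] := eqVneq (pend p) (pstart q); last first.
  by rewrite /path_mul pq.
by have [w [-> ws wa we]] := path_mulP pq => -[<-].
Qed.

Lemma path_mul_inj p q q' u : path_mul p q = Some u -> path_mul p q' = Some u -> q = q'.
Proof.
move=> /path_mul_data [pq us ua _] /path_mul_data [pq' _ ua' _].
apply: qpath_eq; first by rewrite -pq.
have : parrows p ++ parrows q == parrows p ++ parrows q' by rewrite -ua -ua'.
by rewrite eqseq_cat // eqxx => /eqP.
Qed.

Lemma mcoeff_pmU (c : k) (o : option (qpath Qv)) u :
  (pmU c o)@_u = if o == Some u then c else 0.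
Proof.
case: o => [w|] /=; last by rewrite mcoeff0.
rewrite mcoeffU (_ : (Some w == Some u) = (w == u)) //.
by case: eqP; rewrite ?mulr1n ?mulr0n.
Qed.

Lemma path_elt_scale (c : k) p : c *: path_elt p = << c *g p >>.
Proof. by apply: etrans (pm_scaleU _ _ _) _; rewrite mulr1. Qed.

Lemma path_mulUU (c d : k) p q :
  (<< c *g p >> : pmalg k (qpath Qv)) * << d *g q >> = pmU (c * d) (path_mul p q).
Proof. exact: pm_mulUU. Qed.

Lemma coef_pathl p q u g : path_mul p q = Some u -> (path_elt p * g)@_u = g@_q.
Proof.
move=> pq; elim/pm_ind: g => [|f g IH IH'|c q'].
  by rewrite mulr0 !mcoeff0.
  by rewrite mulrDr !mcoeffD; congr (_ + _); [exact: IH|exact: IH'].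
rewrite path_mulUU mul1r mcoeff_pmU mcoeffU.
have [pq'|pq'] := eqVneq (path_mul p q') (Some u).
  by rewrite (path_mul_inj pq' pq) eqxx mulr1n.
have [qq|_] := eqVneq q' q; last by rewrite mulr0n.
by rewrite qq pq eqxx in pq'.
Qed.

Lemma coef_pathl0 p u g : (forall q, path_mul p q <> Some u) -> (path_elt p * g)@_u = 0.
Proof.
move=> pu; elim/pm_ind: g => [|f g IH IH'|c q]; first by rewrite mulr0 mcoeff0.
  by rewrite mulrDr mcoeffD -[RHS]addr0; congr (_ + _); [exact: IH|exact: IH'].
by rewrite path_mulUU mcoeff_pmU; case: eqP => // /pu [].
Qed.

Lemma path_mulU (c d : k) p q u : path_mul p q = Some u ->
  (<< c *g p >> : pmalg k (qpath Qv)) * << d *g q >> = << c * d *g u >>.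
Proof. by move=> pq; rewrite path_mulUU pq. Qed.

Lemma path_mulU0 (c d : k) p q : pend p <> pstart q ->
  (<< c *g p >> : pmalg k (qpath Qv)) * << d *g q >> = 0.
Proof. by move=> /eqP/negbTE pq; rewrite path_mulUU /path_mul pq. Qed.

Lemma path_homog_ind (n : int) (P : pmalg k (qpath Qv) -> Prop) :
  P 0 -> (forall f g, P f -> P g -> P (f + g)) ->
  (forall c p, path_deg p = n -> P << c *g p >>) -> forall f, path_homog n f -> P f.
Proof.
move=> P0 PD PU f fn; rewrite [f]monalgE big_seq.
by elim/big_ind: _ => [//|x y|p /fn pn]; [exact: PD|exact: PU].
Qed.

Definition path_list (n : nat) : seq (qpath Qv) :=
  pmap insub [seq (t.1, (t.2 : seq _)) | t : qvert Qv * n.-tuple (qarrow Qv)].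

Lemma path_listP n p : path_deg p = n%:Z -> p \in path_list n.
Proof.
move=> [pn]; rewrite mem_pmap_sub; apply/mapP.
have sp : size (parrows p) == n by apply/eqP.
exists (pstart p, Tuple sp); first by rewrite mem_enum.
by rewrite /pstart /parrows /=; case: (pdata p).
Qed.
End PathProducts.

Section Alg.
Variables (k : fieldType) (r : nat).
Local Notation QQ := (Q r).
Local Notation path := (qpath QQ).
Local Notation A := (pmalg k path).
Implicit Types (p q u : path).

Definition is_y (a : qarrow QQ) : bool := if a is inr _ then true else false.

Lemma walk_y (v : qvert QQ) (s : seq (qarrow QQ)) : is_walk v s -> all is_y s ->
  (walk_end v s : nat) = (v + size s)%N :> nat.
Proof.
elim: s v => [|[i|i] s IH] v //=; first by rewrite addn0.
move=> /andP[/eqP <- ws] sy; rewrite /walk_end /= -/(walk_end _ s) (IH _ ws sy) /=.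
by rewrite /bump /=; lia.
Qed.

Lemma walk_y_unique (v : qvert QQ) (s s' : seq (qarrow QQ)) : is_walk v s -> is_walk v s' ->
  all is_y s -> all is_y s' -> size s = size s' -> s = s'.
Proof.
elim: s s' v => [|[i|i] s IH] [|[j|j] s'] v //=.
move=> /andP[/eqP iv ws] /andP[/eqP jv ws'] sy sy' [ss].
have ij : i = j by apply: val_inj; have := congr1 val (etrans iv (esym jv)).
by rewrite -ij in ws' *; rewrite (IH s' _ ws ws').
Qed.

Lemma ypath_ex (n : nat) : (n <= r)%N -> exists p : path,
  [/\ pstart p = ord0, all is_y (parrows p) & size (parrows p) = n].
Proof.
elim: n => [|n IH] nr; first by exists (@trivial_path QQ ord0).
have [p [p0 py pn]] := IH (ltnW nr).
have endE : pend p = @qsrc QQ (inr (Ordinal nr)).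
  by apply: val_inj; rewrite /= (walk_y (pwalk p) py) -/(pstart p) p0 pn.
have aw : is_walk (pend p) [:: (inr (Ordinal nr) : qarrow QQ)].
  by apply/andP; split=> //; apply/eqP; exact: esym endE.
have [u [_ us ua _]] := @path_mulP QQ p (@QPath QQ (_, _) aw) erefl.
exists u; rewrite us ua all_cat py size_cat pn addn1.
by split.
Qed.

(** For [n > r] this takes a default value; there [Q_w n] is zero. *)
Definition ypath (n : nat) : path :=
  if pselect (n <= r)%N is left nr then sval (cid (ypath_ex nr))
  else @trivial_path QQ ord0.

Lemma ypathP n : (n <= r)%N ->
  [/\ pstart (ypath n) = ord0, all is_y (parrows (ypath n))
    & size (parrows (ypath n)) = n].
Proof.
by rewrite /ypath; case: pselect => // nr _; exact: svalP (cid (ypath_ex nr)).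
Qed.

Lemma ypath_unique p n : pstart p = ord0 -> all is_y (parrows p) ->
  size (parrows p) = n -> p = ypath n.
Proof.
move=> p0 py pn; have nr : (n <= r)%N.
  by have := ltn_ord (pend p); rewrite (walk_y (pwalk p) py) -/(pstart p) p0 pn ltnS.
have [y0 yy yn] := ypathP nr; apply: qpath_eq; first by rewrite p0 y0.
have w := pwalk (ypath n); rewrite -/(pstart (ypath n)) y0 -p0 in w.
by apply: (walk_y_unique (pwalk p) w py yy); rewrite yn.
Qed.

Fact xpath_walk (v : qvert QQ) : is_walk v [:: (inl v : qarrow QQ)].
Proof. by rewrite /= eqxx. Qed.
Definition xpath (v : qvert QQ) : path := @QPath QQ (v, [:: inl v]) (xpath_walk v).

Definition Q_x : A := \sum_(v : 'I_r.+1) path_elt k (xpath v).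
Definition Q_e : A := path_elt k (@trivial_path QQ ord0).
Definition Q_w (n : nat) : A := if (n <= r)%N then path_elt k (ypath n) else 0.

Lemma path_then_x_ex p : exists u, path_mul p (xpath (pend p)) = Some u.
Proof. by have [u [pu _ _ _]] := @path_mulP QQ p (xpath (pend p)) erefl; exists u. Qed.
Definition path_then_x p : path := sval (cid (path_then_x_ex p)).

Lemma path_then_xP p : [/\ path_mul p (xpath (pend p)) = Some (path_then_x p),
  pstart (path_then_x p) = pstart p, parrows (path_then_x p) = parrows p ++ [:: inl (pend p)]
  & pend (path_then_x p) = ord0].
Proof.
have pu := svalP (cid (path_then_x_ex p)); rewrite -/(path_then_x p) in pu.
by have [_ us ua ue] := path_mul_data pu.
Qed.

Lemma path_elt_x p : path_elt k p * Q_x = path_elt k (path_then_x p).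
Proof.
have [pu _ _ _] := path_then_xP p.
apply: etrans (mulr_sumr _ _ _ _) _; rewrite (bigD1 (pend p)) //.
rewrite /= [X in _ + X]big1 => [|v vp]; last first.
  by apply: path_mulU0 => /eqP; rewrite eq_sym (negbTE vp).
rewrite addr0; apply: etrans (path_mulU 1 1 pu) _.
by rewrite mul1r.
Qed.

Lemma path_degE p n : size (parrows p) = n -> path_deg p = n%:Z.
Proof. by rewrite /path_deg => ->. Qed.

Lemma arrows_split (s : seq (qarrow QQ)) : all is_y s \/
  exists s1 j s2, s = s1 ++ inl j :: s2 /\ all is_y s1.
Proof.
elim: s => [|[j|j] s IH]; [by left|by right; exists [::], j, s|].
case: IH => [sy|[s1 [j' [s2 [-> sy]]]]]; first by left.
by right; exists (inr j :: s1), j', s2.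
Qed.

(** The arrows [y] raise the number of the vertex, so at most [r] of them can be
    traversed before an arrow [x]. *)
Lemma path_split p : all is_y (parrows p) \/
  exists (b q : path), [/\ pstart b = pstart p, all is_y (parrows b),
    (size (parrows b) <= r)%N, pstart q = ord0 & path_mul (path_then_x b) q = Some p].
Proof.
have [|[s1 [j [s2 [sE sy]]]]] := arrows_split (parrows p); [by left|right].
have := pwalk p; rewrite -/(pstart p) -/(parrows p) sE is_walk_cat.
move=> /andP[w1 /andP[/eqP jE w2]].
pose b : path := @QPath QQ (pstart p, s1) w1; pose q : path := @QPath QQ (ord0, s2) w2.
have [_ bs ba be] := path_then_xP b.
have [u [uE us ua _]] := @path_mulP QQ (path_then_x b) q be.
exists b, q; split=> //.
  by rewrite -ltnS; apply: leq_ltn_trans (ltn_ord (pend b)); rewrite (walk_y w1 sy) leq_addl.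
rewrite uE; congr Some; apply: qpath_eq; first by rewrite us bs.
rewrite ua ba sE -catA /=; congr (_ ++ inl _ :: _); exact: esym jE.
Qed.

Lemma path_then_x_inj b b' q q' u : pstart b = pstart b' ->
  all is_y (parrows b) -> all is_y (parrows b') ->
  path_mul (path_then_x b) q = Some u -> path_mul (path_then_x b') q' = Some u -> b = b'.
Proof.
move=> bb yb yb' /path_mul_data [_ _ ua _] /path_mul_data [_ _ ua' _].
have [_ _ ba _] := path_then_xP b; have [_ _ ba' _] := path_then_xP b'.
have fE (c v : path) : all is_y (parrows c) -> parrows v =
    (parrows c ++ [:: inl (pend c)]) ++ drop (size (parrows c)).+1 (parrows v) ->
    find (predC is_y) (parrows v) = size (parrows c).
  move=> yc ->; rewrite -catA find_cat /= addn0.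
  by rewrite -[has _ _]negbK -all_predC (eq_all (a2 := is_y)) ?yc // => a /=; rewrite negbK.
have sz : size (parrows b) = size (parrows b').
  have E c d (v : path) : parrows (path_then_x c) = parrows c ++ [:: inl (pend c)] ->
      parrows v = parrows (path_then_x c) ++ parrows d -> parrows v =
      (parrows c ++ [:: inl (pend c)]) ++ drop (size (parrows c)).+1 (parrows v).
    by move=> -> ->; rewrite drop_size_cat // size_cat addn1.
  by rewrite -(fE b u) ?(fE b' u) //; [apply: (E b' q')|apply: (E b q)].
apply: qpath_eq => //; apply: (walk_y_unique (pwalk b)) => //.
have w := pwalk b'; rewrite -/(pstart b') -bb in w; exact: w.
Qed.

Definition QA : graded_algebra k := path_algebra QQ k.

Lemma e_coef (g : A) q : pstart q = ord0 -> (Q_e * g)@_q = g@_q.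
Proof.
move=> q0; apply: coef_pathl; rewrite path_mul_triviall.
by rewrite q0 eqxx.
Qed.

Lemma e_path (c : k) q : Q_e * << c *g q >> = if pstart q == ord0 then << c *g q >> else 0 :> A.
Proof.
apply: etrans (path_mulUU _ _ _ _) _; rewrite mul1r path_mul_triviall eq_sym.
by case: ifP.
Qed.

Lemma e_eq0 (g : A) : (forall q, pstart q = ord0 -> g@_q = 0) -> Q_e * g = 0.
Proof.
move=> g0; apply/malgP => q; rewrite mcoeff0.
have [q0|q0] := eqVneq (pstart q) ord0; first by rewrite e_coef // g0.
apply: coef_pathl0 => q' /path_mul_data [_ qs _ _].
by rewrite qs eqxx in q0.
Qed.

Lemma w_path (i : 'I_r.+1) : Q_w i * Q_x = path_elt k (path_then_x (ypath i)).
Proof. by rewrite /Q_w -ltnS ltn_ord path_elt_x. Qed.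

Lemma Q_w_deg (n : nat) : path_homog n%:Z (Q_w n).
Proof.
rewrite /Q_w; case: ifP => nr; last by have [h0 _ _ _] := path_homogP QQ k; exact: h0.
have [_ _ sz] := ypathP nr; rewrite -(path_degE sz); exact: path_homogU.
Qed.

Lemma Q_x_deg : path_homog 1 Q_x.
Proof. by apply: path_homog_sum => v _; exact: path_homogU. Qed.

Lemma Q_neg m (a : QA) : m < 0 -> gdeg m a -> a = 0.
Proof.
move=> m0 /mhomogP am; apply/malgP => w; rewrite mcoeff0 am // /path_deg.
by apply/eqP; lia.
Qed.

Lemma Q_fin m : exists L : seq QA, forall a : QA, gdeg m a ->
    exists c : nat -> k, a = \sum_(i < size L) c i *: L`_i.
Proof.
have [m0|m0] := ltrP m 0.
  by exists [::] => a /(Q_neg m0) ->; exists (fun=> 0); rewrite big_ord0.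
have [n ->] : exists n : nat, m = n%:Z by exists `|m|%N; lia.
exists [seq path_elt k p | p <- path_list QQ n] => a.
move: a; apply: (@path_homog_ind k QQ n%:Z (fun a => exists c : nat -> k,
  a = \sum_(i < size [seq path_elt k p | p <- path_list QQ n]) c i *: [seq path_elt k p | p <- path_list QQ n]`_i)).
- by exists (fun=> 0); rewrite big1 // => i _; rewrite scale0r.
- move=> f g [c ->] [d ->]; exists (fun i => c i + d i); rewrite -big_split.
  by apply: eq_bigr => i _; rewrite scalerDl.
move=> c p /path_listP pL; exists (fun i => if i == index p (path_list QQ n) then c else 0).
rewrite size_map; have lt_size : (index p (path_list QQ n) < size (path_list QQ n))%N.
  by rewrite index_mem.
rewrite (bigD1 (Ordinal lt_size)) //= eqxx (nth_map p) ?nth_index // big1 ?addr0.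
  by rewrite [RHS]pm_scaleU mulr1.
move=> i ne; rewrite ifF ?scale0r //; apply: contraNF ne => /eqP E.
exact/eqP/val_inj.
Qed.

End Alg.

Section Alg2.
Variables (k : fieldType) (r : nat).
Local Notation QQ := (Q r).
Local Notation path := (qpath QQ).
Local Notation A := (pmalg k path).
Local Notation QA := (QA k r).
Local Notation Q_e := (Q_e k r).
Local Notation Q_x := (Q_x k r).
Local Notation Q_w := (@Q_w k r).
Local Notation ypath := (@ypath r).
Implicit Types (p q u : path).

Lemma Q_gen (n : nat) (a : A) : path_homog n%:Z a ->
    exists (c : k) (d : 'I_r.+1 -> A),
      (forall i : 'I_r.+1, path_homog (n%:Z - i%:Z - 1) (d i)) /\
      Q_e * a = c *: Q_w n + \sum_(i < r.+1) Q_w i * Q_x * d i.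
Proof.
pose P (a : A) := exists (c : k) (d : 'I_r.+1 -> A),
  (forall i : 'I_r.+1, path_homog (n%:Z - i%:Z - 1) (d i)) /\
  Q_e * a = c *: Q_w n + \sum_(i < r.+1) Q_w i * Q_x * d i.
have [h0 _ _ _] := path_homogP QQ k.
have P0 : P 0.
  exists 0, (fun=> 0); split=> [i|]; first exact: h0.
  by rewrite mulr0 scale0r add0r big1 // => i _; rewrite mulr0.
move: a; refine (@path_homog_ind k QQ n%:Z P P0 _ _) => [f g [c [d [dn E]]] [c' [d' [dn' E']]]|c p pn].
  exists (c + c'), (fun i => d i + d' i); split=> [i|].
    exact: (gdegD (D := QA) (dn i) (dn' i)).
  rewrite mulrDr; apply: etrans (congr2 _ E E') _; rewrite scalerDl addrACA.
  congr (_ + _); rewrite -big_split; apply: eq_bigr => i _.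
  exact: esym (mulrDr _ _ _).
have Ep := e_path c p; case: eqP Ep => [p0|_] Ep; last first.
  exists 0, (fun=> 0); split=> [i|]; first exact: h0.
  apply: etrans Ep _; rewrite scale0r add0r; apply: esym.
  by apply: big1 => i _; exact: mulr0.
have [py|[b [q [b0 yb br q0 bq]]]] := path_split p.
  have nE : size (parrows p) = n by move: pn; rewrite /path_deg => -[].
  have nr : (n <= r)%N.
    have := ltn_ord (pend p); rewrite (walk_y (pwalk p) py) -/(pstart p) p0 /=.
    by rewrite -/(parrows p) nE ltnS.
  exists c, (fun=> 0); split=> [i|]; first exact: h0.
  rewrite [X in _ + X]big1 ?addr0 => [|i _]; last exact: mulr0.
  by apply: etrans Ep _; rewrite /Q_w nr {1}(ypath_unique p0 py nE); exact: esym (path_elt_scale _ _).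
have [ubq us ua _] := path_mul_data bq; have [_ _ ba _] := path_then_xP b.
set i := Ordinal (br : (size (parrows b) < r.+1)%N).
have bE : b = ypath i by apply: ypath_unique => //; rewrite b0 p0.
exists 0, (fun j => if j == i then << c *g q >> else 0); split=> [j|].
  case: eqP => [->|_]; last exact: h0.
  rewrite (_ : _ - 1 = path_deg q); last first.
    by rewrite -pn /path_deg ua ba !size_cat /=; lia.
  exact: path_homogU.
rewrite scale0r add0r (bigD1 i) //= eqxx [X in _ + X]big1 => [|j /negbTE ->]; last exact: mulr0.
rewrite addr0; apply: etrans Ep _; apply: esym.
apply: etrans (congr1 (fun z : A => z * << c *g q >>) (w_path k i)) _.
by rewrite -bE; apply: etrans (path_mulU 1 c bq) _; rewrite mul1r.
Qed.

Lemma Q_coef (n : nat) (c : k) (u : 'I_r.+1 -> A) (i : 'I_r.+1) q : pstart q = ord0 ->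
  c *: Q_w n + \sum_(j < r.+1) Q_w j * Q_x * u j = 0 -> (u i)@_q = 0.
Proof.
move=> q0 E; have [_ bs ba be] := path_then_xP (ypath i).
have [w [wE ws wa _]] := @path_mulP QQ (path_then_x (ypath i)) q (etrans be (esym q0)).
have yP (j : 'I_r.+1) := ypathP (ltn_ord j : (j <= r)%N).
have := congr1 (mcoeff w) E; rewrite mcoeff0 => <-.
rewrite mcoeffD mcoeffZ raddf_sum (bigD1 i) //=.
have -> : (Q_w n)@_w = 0.
  rewrite /Q_w; case: ifP => nr; last by rewrite mcoeff0.
  rewrite mcoeffU; case: eqP => // y_word; have [_ yy _] := ypathP nr.
  by move: yy; rewrite y_word wa ba !all_cat /= andbF.
rewrite mulr0 add0r [X in _ = _ + X]big1 => [|j /eqP ji].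
  rewrite addr0; apply: esym.
  by apply: etrans (congr1 (fun z : A => (z * u i)@_w) (w_path k i)) _; exact: coef_pathl.
apply: etrans (congr1 (fun z : A => (z * u j)@_w) (w_path k j)) _.
apply: coef_pathl0 => q' jq'; case: ji; apply: val_inj => /=.
have [y0 yy yn] := yP i; have [z0 zy zn] := yP j.
by rewrite -yn -zn (path_then_x_inj _ zy yy jq' wE) // z0 y0.
Qed.

Lemma insert_unit (R : pzRingType) (w x e u : R) :
  x * e = x -> w * x * u = w * x * (e * u).
Proof. by move=> xe; rewrite mulrA -(mulrA w x e) xe. Qed.

Lemma Q_xe : Q_x * Q_e = Q_x.
Proof.
apply: etrans (mulr_suml _ _ _ _) _; apply: eq_bigr => v _.
have E : path_mul (xpath v) (@trivial_path QQ ord0) = Some (xpath v).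
  by rewrite path_mul_trivialr eqxx.
by apply: etrans (path_mulU 1 1 E) _; rewrite mul1r.
Qed.

Lemma Q_free (n : nat) (c : k) (u : 'I_r.+1 -> A) :
    c *: Q_w n + \sum_(i < r.+1) Q_w i * Q_x * u i = 0 ->
    c *: Q_w n = 0 /\ forall i, Q_e * u i = 0.
Proof.
move=> E; have u0 i : Q_e * u i = 0 by apply: e_eq0 => q q0; exact: Q_coef q0 E.
split=> //; rewrite -[LHS]addr0 -[RHS]E; congr (_ + _).
apply: esym; apply: big1 => i _; apply: etrans (insert_unit _ _ Q_xe) _.
by rewrite u0; exact: mulr0.
Qed.

Lemma Q_ee : Q_e * Q_e = Q_e.
Proof. by apply: etrans (e_path _ _) _; rewrite eqxx. Qed.

Lemma Q_ew n : Q_e * Q_w n = Q_w n.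
Proof.
rewrite /Q_w; case: ifP => nr; last exact: mulr0.
by apply: etrans (e_path _ _) _; have [-> _ _] := ypathP nr; rewrite eqxx.
Qed.

Lemma Q_w_neq0 n : (n <= r)%N -> Q_w n <> 0.
Proof.
move=> nr /(congr1 (mcoeff (ypath n))); rewrite /Q_w nr mcoeff0 mcoeffU eqxx.
by move/eqP; rewrite oner_eq0.
Qed.

Lemma Q_factor_x (n : nat) (a : A) : (r < n)%N -> path_homog n%:Z a ->
    forall P : A -> Prop, P 0 -> (forall b c, P b -> P c -> P (b + c)) ->
    (forall (i : 'I_r.+1) b c, path_homog (n%:Z - i%:Z - 1) c -> P (b * Q_x * c)) -> P a.
Proof.
move=> rn an P P0 PD Px; move: a an.
refine (@path_homog_ind k QQ n%:Z P P0 PD _) => c p pn.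
have nE : size (parrows p) = n by move: pn; rewrite /path_deg => -[].
have [py|[b [q [b0 yb br q0 bq]]]] := path_split p.
  have := ltn_ord (pend p); rewrite (walk_y (pwalk p) py) -/(parrows p) nE; lia.
have [_ us ua _] := path_mul_data bq; have [_ _ ba _] := path_then_xP b.
have -> : << c *g p >> = path_elt k b * Q_x * << c *g q >> :> A.
  apply: esym; apply: etrans (congr1 (fun z : A => z * << c *g q >>) (path_elt_x k b)) _.
  by apply: etrans (path_mulU 1 c bq) _; rewrite mul1r.
apply: (Px (Ordinal (br : (size (parrows b) < r.+1)%N))).
rewrite (_ : _ - 1 = path_deg q); first exact: path_homogU.
by rewrite -pn /path_deg ua ba !size_cat /=; lia.
Qed.

(** Multiplication by the path of arrows [y] from the first vertex to the start of
    [q] recovers the coefficient of [q] inside [e A]. *)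
Lemma Q_sep (a : A) : (forall m (d : A), path_homog m d -> Q_e * d * a = 0) -> a = 0.
Proof.
move=> a0; apply/malgP => q; rewrite mcoeff0.
have vr : (pstart q <= r)%N by rewrite -ltnS ltn_ord.
have [y0 yy yn] := ypathP vr.
have ye : pend (ypath (pstart q)) = pstart q.
  by apply: val_inj; rewrite /= (walk_y (pwalk _) yy) -/(pstart (ypath _)) y0 -/(parrows _) yn.
have [w [wE _ _ _]] := path_mulP ye.
have := a0 _ _ (@path_homogU QQ k 1 (ypath (pstart q))) => /(congr1 (mcoeff w)).
rewrite mcoeff0 => <-.
have E : Q_e * path_elt k (ypath (pstart q)) = path_elt k (ypath (pstart q)).
  by apply: etrans (e_path _ _) _; rewrite y0 eqxx.
apply: esym; apply: etrans (congr1 (fun z : A => (z * a)@_w) E) _.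
exact: coef_pathl wE.
Qed.

Lemma Q_e_deg : path_homog 0 Q_e.
Proof. exact: path_homogU. Qed.

Lemma Q_w_big n : (r < n)%N -> Q_w n = 0.
Proof. by rewrite ltnNge /Q_w => /negbTE ->. Qed.

Definition Q_tail_data : tail_data QA r.
Proof.
refine (@TailData k QA r Q_e Q_x Q_w (@Q_neg k r) (@Q_fin k r) Q_e_deg (@Q_x_deg k r)
  (@Q_w_deg k r) Q_ee Q_xe Q_ew Q_w_big Q_w_neq0 Q_gen _ Q_factor_x Q_sep).
by move=> n c u _; exact: Q_free.
Qed.
End Alg2.

(** * The algebra B *)

Section FreeWords.
Variables (k : fieldType) (r : nat).
Local Notation A := (freealg2 k).
Local Notation word := {fmonom bool}.
Implicit Types (u v w : word) (f g : A).

Definition word_elt w : A := << 1 *g w >>.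

Lemma word_eq (v w : word) : v = w :> seq bool -> v = w.
Proof. by move=> vw; apply/eqP; rewrite fmP; apply/eqP. Qed.

Lemma word_mul_inj u v v' : mmul u v = mmul u v' -> v = v'.
Proof.
move=> /(congr1 (@fmonom_val _)); rewrite !fmM => /eqP.
by rewrite eqseq_cat // eqxx => /eqP /word_eq.
Qed.

Lemma coef_word_elt u v g : (word_elt u * g)@_(mmul u v) = g@_v.
Proof.
elim/free_ind: g => [|f g IH IH'|c w]; first by rewrite mulr0 !mcoeff0.
  by rewrite mulrDr !mcoeffD; congr (_ + _); [exact: IH|exact: IH'].
apply: etrans (congr1 (mcoeff (mmul u v)) (free_mulUU _ _ _ _)) _.
rewrite mul1r !mcoeffU; congr (_ *+ _).
by have [->|wv] := eqVneq w v; rewrite ?eqxx //; apply/eqP; rewrite eqb0; apply: contra wv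
   => /eqP /word_mul_inj ->.
Qed.

Lemma coef_word_elt0 u w g : (forall v, mmul u v <> w) -> (word_elt u * g)@_w = 0.
Proof.
move=> uw; elim/free_ind: g => [|f g IH IH'|c v]; first by rewrite mulr0 mcoeff0.
  by rewrite mulrDr mcoeffD -[RHS]addr0; congr (_ + _); [exact: IH|exact: IH'].
apply: etrans (congr1 (mcoeff w) (free_mulUU _ _ _ _)) _.
by rewrite mcoeffU; case: eqP => // /uw [].
Qed.

Lemma word_elt_mul u v : word_elt u * word_elt v = word_elt (mmul u v).
Proof. by apply: etrans (free_mulUU _ _ _ _) _; rewrite mulr1. Qed.

Lemma word_elt_scale (c : k) w : c *: word_elt w = << c *g w >>.
Proof. by apply: etrans (free_scaleU _ _ _) _; rewrite mulr1. Qed.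

Lemma word_homog_ind (n : int) (P : A -> Prop) :
  P 0 -> (forall f g, P f -> P g -> P (f + g)) ->
  (forall c w, word_deg w = n -> P << c *g w >>) ->
  forall f, mhomog word_deg n f -> P f.
Proof.
move=> P0 PD PU f fn; rewrite [f]monalgE big_seq.
by elim/big_ind: _ => [//|x y|p /fn pn]; [exact: PD|exact: PU].
Qed.

Lemma word_homogU (c : k) w : mhomog word_deg (word_deg w) << c *g w >>.
Proof. by move=> z /(fsubsetP msuppU_le); rewrite inE => /eqP ->. Qed.

Definition y_word n : word := FMonom (nseq n true).
Definition yx_word n : word := FMonom (rcons (nseq n true) false).

Lemma y_wordE n : free_y k ^+ n = word_elt (y_word n).
Proof.
elim: n => [|n IH]; first by congr word_elt; apply: word_eq; rewrite fm1.
rewrite exprS IH; apply: etrans (word_elt_mul _ _) _; congr word_elt; apply: word_eq.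
by rewrite fmM fmU.
Qed.

Lemma yx_wordE n : free_y k ^+ n * free_x k = word_elt (yx_word n).
Proof.
rewrite y_wordE; apply: etrans (word_elt_mul _ _) _; congr word_elt; apply: word_eq.
by rewrite fmM fmU cats1.
Qed.

(** The words which vanish in [B]. *)
Definition bad w := infix (nseq r.+1 true) w.

Local Notation inI := (in_ideal (B_rel k r)).

(** The ideal is spanned by the words it contains, being generated by a word. *)
Lemma in_ideal_bad g : inI g <-> forall w, w \in msupp g -> bad w.
Proof.
split=> [gI|gb].
  pose J f := forall w, w \in msupp f -> bad w.
  have J0 : J 0 by move=> w; rewrite msupp0 inE.
  have JD f h : J f -> J h -> J (f + h).
    by move=> Jf Jh w /(fsubsetP (msuppD_le f h)); rewrite inE => /orP[/Jf|/Jh].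
  have JZ a f : J f -> J (a *: f) by move=> Jf w /(fsubsetP (msuppZ_le a f)) /Jf.
  apply: (gI (Submodule J0 JD JZ)) => /= [a z Jz w|a z Jz w|w].
  - by move=> /msuppM_le [u [v [_ /Jz vb ->]]]; rewrite /bad fmM infix_catl.
  - by move=> /msuppM_le [u [v [/Jz ub _ ->]]]; rewrite /bad fmM infix_catr.
  rewrite /B_rel y_wordE => /(fsubsetP msuppU_le); rewrite inE => /eqP ->.
  exact: infix_refl.
rewrite [g]monalgE big_seq; elim/big_ind: _ => [|x y|w /gb /infixP [s [s' wE]]].
- exact: in_ideal0.
- exact: in_idealD.
rewrite -word_elt_scale; apply: in_idealZ.
have -> : word_elt w = word_elt (FMonom s) * (B_rel k r * word_elt (FMonom s')).
  rewrite /B_rel y_wordE; apply: esym; apply: etrans (congr1 _ (word_elt_mul _ _)) _.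
  by apply: etrans (word_elt_mul _ _) _; congr word_elt; apply: word_eq; rewrite !fmM wE.
by apply: in_idealMl; apply: in_idealMr; exact: in_ideal_gen.
Qed.

Lemma in_ideal_coef g : inI g <-> forall w, ~~ bad w -> g@_w = 0.
Proof.
rewrite in_ideal_bad; split=> H w wb; first by apply/mcoeff_outdom; apply: contra wb; exact: H.
by apply: contraLR wb => /H g0; rewrite -mcoeff_neq0 g0 eqxx.
Qed.

Lemma bad_y_word n : bad (y_word n) = (r < n)%N.
Proof.
apply/idP/idP => [/size_infix|nr]; first by rewrite !size_nseq.
by apply/infixP; exists [::], (nseq (n - r.+1) true); rewrite cat0s -nseqD subnKC.
Qed.

(** An occurrence of [y^(r+1)] cannot overlap the letter [x]. *)
Lemma bad_yx_word i v : (i <= r)%N -> bad (mmul (yx_word i) v) = bad v.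
Proof.
rewrite /bad fmM /= cat_rcons => ir.
have prefixF m j s : (j < m)%N -> prefix (nseq m true) (nseq j true ++ false :: s) = false.
  by elim: j m => [|j IH] [|m] //= jm; rewrite ?eqxx IH.
have iE (s1 : seq bool) x s2 : prefix s1 (x :: s2) = false -> infix s1 (x :: s2) = infix s1 s2.
  by move=> E; transitivity (prefix s1 (x :: s2) || infix s1 s2); [case: s1 E|rewrite E].
have infixF m j s : (j < m)%N ->
    infix (nseq m true) (nseq j true ++ false :: s) = infix (nseq m true) s.
  elim: j => [|j IH] jm; first exact: iE (prefixF m 0%N s jm).
  by apply: etrans (iE _ _ _ (prefixF m j.+1 s jm)) _; apply/IH/ltnW.
exact: (infixF r.+1 i v ir).
Qed.

Local Notation BA := (B k r).

Definition piB f : B_alg k r := alg_pi (principal_ideal (@B_proper k r)) f.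

Lemma piBD : {morph piB : f g / f + g}. Proof. by move=> f g; exact: quot_piD. Qed.
Lemma piBZ (c : k) f : piB (c *: f) = c *: piB f. Proof. exact: quot_piZ. Qed.
Lemma piBM f g : piB (f * g) = piB f * piB g. Proof. exact: alg_piM. Qed.
Lemma piB0 : piB 0 = 0. Proof. by apply: (addrI (piB 0)); rewrite -piBD !addr0. Qed.
Lemma piB_sum I (s : seq I) (P : pred I) (F : I -> A) :
  piB (\sum_(i <- s | P i) F i) = \sum_(i <- s | P i) piB (F i).
Proof. exact: (big_morph piB piBD piB0). Qed.
Lemma piB_eq0 f : piB f = 0 <-> inI f.
Proof.
rewrite -piB0; have := quot_piP (principal_ideal (@B_proper k r)) f 0.
by rewrite subr0.
Qed.
Definition B_x := piB (free_x k).
Definition B_w n := piB (free_y k ^+ n).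

Lemma B_wx n g : B_w n * B_x * piB g = piB (word_elt (yx_word n) * g).
Proof. by rewrite /B_w /B_x -!piBM; congr (piB (_ * _)); exact: yx_wordE. Qed.

Lemma B_neg m (a : BA) : m < 0 -> gdeg m a -> a = 0.
Proof.
move=> m0 [g gm ->]; apply/piB_eq0/in_ideal_bad => w /gm.
by rewrite /word_deg; lia.
Qed.

Lemma word_degE w n : word_deg w = n%:Z -> size w = n.
Proof. by move=> [<-]. Qed.

Lemma B_fin m : exists L : seq BA, forall a : BA, gdeg m a ->
    exists c : nat -> k, a = \sum_(i < size L) c i *: L`_i.
Proof.
have [m0|m0] := ltrP m 0.
  by exists [::] => a /(B_neg m0) ->; exists (fun=> 0); rewrite big_ord0.
have [n ->] : exists n : nat, m = n%:Z by exists `|m|%N; lia.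
pose W := [seq FMonom (t : seq bool) | t : n.-tuple bool].
exists [seq piB (word_elt w) | w <- W] => _ [g gn ->]; move: g gn.
apply: word_homog_ind.
- by exists (fun=> 0); rewrite big1 => [|i _]; [exact: piB0|exact: scale0r].
- move=> f g [c cE] [d dE]; exists (fun i => c i + d i).
  apply: etrans (piBD f g) _; apply: etrans (congr2 _ cE dE) _; rewrite -big_split.
  by apply: eq_bigr => i _; rewrite scalerDl.
move=> c w /word_degE wn; exists (fun i => if i == index w W then c else 0).
have wW : w \in W.
  have sw : size w == n by apply/eqP.
  by apply/mapP; exists (Tuple sw); rewrite ?mem_enum //; apply: word_eq.
rewrite size_map; have lt_size : (index w W < size W)%N by rewrite index_mem.
rewrite (bigD1 (Ordinal lt_size)) //= eqxx (nth_map w) ?nth_index // big1 ?addr0.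
  by rewrite -piBZ word_elt_scale.
move=> i ne; rewrite ifF ?scale0r //; apply: contraNF ne => /eqP E.
exact/eqP/val_inj.
Qed.

Lemma word_split w : w = y_word (size w) \/ exists i v, w = mmul (yx_word i) v.
Proof.
suff : (w : seq bool) = nseq (size w) true \/
    exists i s, (w : seq bool) = nseq i true ++ false :: s.
  case=> [E|[i [s E]]]; [left; exact: word_eq|right].
  by exists i, (FMonom s); apply: word_eq; rewrite fmM /= cat_rcons.
elim: (w : seq bool) => [|[] s IH] /=; [by left| |by right; exists 0%N, s].
by case: IH => [<-|[i [s' ->]]]; [left|right; exists i.+1, s'].
Qed.

Lemma B_gen (n : nat) (a : BA) : gdeg n%:Z a ->
    exists (c : k) (d : 'I_r.+1 -> BA),
      (forall i : 'I_r.+1, gdeg (n%:Z - i%:Z - 1) (d i)) /\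
      1 * a = c *: B_w n + \sum_(i < r.+1) B_w i * B_x * d i.
Proof.
have h0 i : gdeg i (0 : BA) by exact: gdeg0.
case=> g gn ->; rewrite mul1r; move: g gn.
apply: word_homog_ind.
- exists 0, (fun=> 0); split=> //; rewrite scale0r add0r big1 => [|i _]; last exact: mulr0.
  exact: piB0.
- move=> f g [c [d [dn E]]] [c' [d' [dn' E']]].
  exists (c + c'), (fun i => d i + d' i); split=> [i|]; first exact: gdegD.
  apply: etrans (piBD f g) _; apply: etrans (congr2 _ E E') _; rewrite scalerDl addrACA.
  congr (_ + _); rewrite -big_split; apply: eq_bigr => i _.
  exact: esym (mulrDr _ _ _).
move=> c w wn; have [wE|[i [v wE]]] := word_split w.
  exists c, (fun=> 0); split=> //; rewrite big1 ?addr0 => [|i _]; last exact: mulr0.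
  by rewrite /B_w y_wordE -piBZ word_elt_scale -(word_degE wn) -wE.
have [ir|ri] := ltnP i r.+1; last first.
  exists 0, (fun=> 0); split=> //; rewrite scale0r add0r big1 => [|j _]; last exact: mulr0.
  apply/piB_eq0; rewrite -word_elt_scale; apply: in_idealZ.
  apply/in_ideal_bad => u /(fsubsetP msuppU_le); rewrite inE => /eqP ->.
  rewrite wE /bad fmM infix_catr //=; apply: infix_trans (infix_rcons _ _).
  by have := bad_y_word i; rewrite /bad ri.
exists 0, (fun j => if j == i :> nat then piB << c *g v >> else 0); split=> [j|].
  case: eqP => [ji|_] //; exists << c *g v >> => //.
  rewrite (_ : _ - 1 = word_deg v); first exact: word_homogU.
  rewrite -wn wE word_degM /word_deg ji /fdeg /= size_rcons size_nseq.
  by lia.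
rewrite scale0r add0r (bigD1 (Ordinal ir)) //= eqxx [X in _ + X]big1 => [|j ji]; last first.
  by rewrite ifF ?mulr0 //; apply: contraNF ji => /eqP ji; apply/eqP/val_inj.
rewrite addr0 B_wx wE; congr piB; rewrite -word_elt_scale -word_elt_mul -word_elt_scale.
by rewrite -scalerAr.
Qed.

Lemma B_free (n : nat) (c : k) (u : 'I_r.+1 -> BA) :
    (forall i : 'I_r.+1, gdeg (n%:Z - i%:Z - 1) (u i)) ->
    c *: B_w n + \sum_(i < r.+1) B_w i * B_x * u i = 0 ->
    c *: B_w n = 0 /\ forall i, 1 * u i = 0.
Proof.
move=> un E; have /choice [g gE] i : exists g, u i = piB g.
  by have [g _ ->] := un i; exists g.
have u0 i : u i = 0.
  rewrite gE; apply/piB_eq0/in_ideal_coef => v vb.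
  have : inI (c *: word_elt (y_word n) + \sum_(j < r.+1) word_elt (yx_word j) * g j).
    apply/piB_eq0; rewrite -[RHS]E piBD piBZ piB_sum /B_w y_wordE; congr (_ + _).
    by apply: eq_bigr => j _; rewrite gE; exact: esym (B_wx _ _).
  move=> /in_ideal_coef /(_ (mmul (yx_word i) v)).
  rewrite (bad_yx_word v (ltn_ord i : (i <= r)%N)) => /(_ vb).
  rewrite mcoeffD mcoeffZ raddf_sum (bigD1 i) //= coef_word_elt.
  have -> : (word_elt (y_word n))@_(mmul (yx_word i) v) = 0.
    rewrite mcoeffU; case: eqP => // /(congr1 (fun w : word => false \in (w : seq bool))).
    by rewrite fmM mem_cat /= mem_rcons inE eqxx mem_nseq andbF.
  rewrite mulr0 add0r big1 ?addr0 // => j ji.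
  apply: coef_word_elt0 => v' /(congr1 (fun w : word => index false (w : seq bool))).
  have idx m (s : seq bool) : index false (rcons (nseq m true) false ++ s) = m.
    by rewrite cat_rcons index_cat mem_nseq andbF size_nseq /= addn0.
  by rewrite !fmM /= !idx => /val_inj/eqP; rewrite (negbTE ji).
split=> [|i]; last by rewrite u0 mulr0.
rewrite -[RHS]E [X in _ + X]big1 ?addr0 // => i _.
by rewrite u0 mulr0.
Qed.

Lemma B_w_big n : (r < n)%N -> B_w n = 0.
Proof.
move=> rn; apply/piB_eq0; rewrite y_wordE; apply/in_ideal_bad => u.
by move=> /(fsubsetP msuppU_le); rewrite inE => /eqP ->; rewrite bad_y_word.
Qed.

Lemma B_w_neq0 n : (n <= r)%N -> B_w n <> 0.
Proof.
move=> nr /piB_eq0; rewrite y_wordE => /in_ideal_coef /(_ (y_word n)).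
rewrite bad_y_word -leqNgt => /(_ nr); rewrite mcoeffU eqxx => /eqP.
by rewrite oner_eq0.
Qed.

Lemma B_factor_x (n : nat) (a : BA) : (r < n)%N -> gdeg n%:Z a ->
    forall P : BA -> Prop, P 0 -> (forall b c, P b -> P c -> P (b + c)) ->
    (forall (i : 'I_r.+1) (b c : B_alg k r), B_deg (n%:Z - i%:Z - 1) c ->
       P (b * B_x * c)) -> P a.
Proof.
move=> rn /B_gen [c [d [dn]]]; rewrite mul1r B_w_big // scaler0 add0r => -> P P0 PD Px.
by elim/big_ind: _ => [|x y|i _]; [exact: P0|exact: PD|exact/Px/dn].
Qed.

Lemma B_sep (a : BA) : (forall m (d : BA), gdeg m d -> 1 * d * a = 0) -> a = 0.
Proof. by move=> /(_ 0 1 (gdeg1 _)); rewrite !mul1r. Qed.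

Lemma B_x_deg : gdeg 1 (B_x : BA).
Proof.
exists (free_x k) => // w; rewrite msuppU1 inE => /eqP ->.
by rewrite /word_deg fdegU.
Qed.

Lemma B_w_deg (n : nat) : gdeg n%:Z (B_w n : BA).
Proof. by exists (free_y k ^+ n) => //; rewrite -natz; apply/free_homogX/free_homogy. Qed.

Definition B_tail_data : tail_data BA r.
Proof.
refine (@TailData k BA r 1 B_x B_w (@B_neg) B_fin (gdeg1 _) B_x_deg
  B_w_deg (mulr1 _) (mulr1 _) (fun n => mul1r _) B_w_big B_w_neq0 B_gen B_free B_factor_x B_sep).
Qed.
End FreeWords.

(** * Comparison of the two algebras *)

Theorem theorem7p8 (k : fieldType) (r : nat) (r_ge1 : (1 <= r)%N) :
  exists (phi : K0_module (qgr (B k r)) ->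
                K0_module (qgr (path_algebra (Q r) k)))
         (psi : K0_module (qgr (path_algebra (Q r) k)) ->
                laurent_quot (f_poly r)),
  [/\ bigmod_iso phi,
      bigmod_iso psi,
      phi (K0_class (structure_sheaf (B k r))) =
        K0_class (structure_sheaf (path_algebra (Q r) k)),
      psi (K0_class (structure_sheaf (path_algebra (Q r) k))) =
        laurent_class (f_poly r) 1 &
      forall F : qgr (B k r),
        psi (phi (K0_class (twist (-1) F))) =
          mscale laurent_t (psi (phi (K0_class F)))].
Proof. exact: K0_qgr_iso (B_tail_data k r) (Q_tail_data k r). Qed.
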